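(* Let $r$ be a positive integer and let $\kappa$ be an infinite cardinal. For every edge-colouring $c\colon E(G)\to[r]$ of the complete bipartite graph $G=K_{\kappa,\kappa}$ (both bipartition classes of cardinality $\kappa$), the vertex set of $G$ can be partitioned into $2r-1$ monochromatic generalised paths (partition classes may be empty) such that each colour is used by at most two of these paths.
   Context: $[r]=\{1,\dots,r\}$. A generalised path is a graph $P$ together with a well-order $\prec$ on $V(P)$ (the path order) such that for every vertex $v$ and every $v'\prec v$ there is a neighbour $w$ of $v$ in $P$ with $v'\preceq w\prec v$ (i.e. the down-neighbours of each vertex are cofinal below it). A path $P\subseteq G$ is monochromatic in colour $k$ if all its edges have colour $k$, i.e. $P$ is a generalised path in the subgraph formed by the edges of colour $k$. Partitions are vertex partitions. *)

(* Defs.v *)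
From mathcomp Require Import all_boot.
From mathcomp Require Import boolp wochoice classical_sets functions cardinality.

Set Implicit Arguments.
Unset Strict Implicit.
Unset Printing Implicit Defensive.

Local Open Scope classical_set_scope.

(* Simple graphs with vertices in an ambient type V; an edge is a two-element
   set of vertices. *)
Record graph (V : Type) := Graph {
  vertices : set V;
  edges : set (set V);
  edgesP : forall e, edges e ->
    exists u v, [/\ vertices u, vertices v, u <> v & e = [set u; v]]
}.

Definition adjacent (V : Type) (G : graph V) (u v : V) : Prop :=
  edges G [set u; v].

Definition subgraph (V : Type) (H G : graph V) : Prop :=
  vertices H `<=` vertices G /\ edges H `<=` edges G.

Definition bipartite_edges (A B : Type) : set (set (A + B)) :=
  [set e | exists a b, e = [set inl a; inr b]].

Lemma bipartite_edgesP (A B : Type) (e : set (A + B)) :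
  bipartite_edges e ->
  exists u v, [/\ [set: A + B] u, [set: A + B] v, u <> v & e = [set u; v]].
Proof. by move=> [a [b ->]]; exists (inl a), (inr b); split. Qed.

Definition complete_bipartite (A B : Type) : graph (A + B) :=
  Graph (@bipartite_edgesP A B).

(* The path order is given by its reflexive version le; only its restriction
   to the vertices of P matters.  wo_chain says that every nonempty subset of
   vertices P has exactly one le-minimum, which makes le a (reflexive, linear)
   well-order there. *)
Definition path_order (V : Type) (P : graph V) (le : rel V) : Prop :=
  wo_chain le [in vertices P] /\
  (forall v v', vertices P v -> vertices P v' -> le v' v -> v' <> v ->
   exists w, [/\ vertices P w, adjacent P v w, le v' w, le w v & w <> v]).

Definition generalised_path (V : Type) (P : graph V) : Prop :=
  exists le : rel V, path_order P le.

Definition edge_colouring (V : Type) (G : graph V) (r : nat) : Type :=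
  edges G -> 'I_r.

(* A path without edges is monochromatic in every colour. *)
Definition monochromatic (V : Type) (G : graph V) (r : nat)
    (c : edge_colouring G r) (k : 'I_r) (P : graph V) : Prop :=
  forall e : edges G, edges P (val e) -> c e = k.

Definition monochromatic_path (V : Type) (G : graph V) (r : nat)
    (c : edge_colouring G r) (k : 'I_r) (P : graph V) : Prop :=
  [/\ subgraph P G, generalised_path P & monochromatic c k P].

Definition vertex_partition (V I : Type) (G : graph V) (P : I -> graph V) :
    Prop :=
  trivIset [set: I] (fun i => vertices (P i)) /\
  \bigcup_(i in [set: I]) vertices (P i) = vertices G.

(* Main.v *)
(* Call a set small if kappa does not embed into it and big otherwise.  A colour
   [k] is good for a set [T] when (i) any two vertices of [T] are joined by finite
   paths of colour [k] avoiding any given small set, and (ii) [T] contains a big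
   set [X] such that big parts of [X] and of the other side always carry a big
   skeleton: a well-ordered set whose limit vertices have cofinally many
   [k]-neighbours below them, all in [X], but in which consecutive vertices of [X]
   need not be adjacent.  By (i) the gaps of a skeleton can be filled, in a
   transfinite recursion, by finite paths running through prescribed vertices, so
   that [T] is covered by a single path of colour [k]; several sets are treated
   simultaneously and disjointly.

   Such an [X] exists between any two big opposite sets: either a colour is
   rich, so that small skeletons can be found everywhere and concatenated, or a
   small obstruction to it contradicts the case of a side larger than the other.
   An ultrafilter on the other side singles out the colour that links [X].

   Every vertex outside [T] has only few [k]-neighbours in a big set [M] whose
   vertices can be led back into [T]; replacing the other side by [M] makes the
   colour useless, so after at most [r] rounds only a small set is left, which
   is covered with the remaining colours by induction on their number, apart
   from some vertices that are attached to the previous paths by detours through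
   [M].  Each side of the bipartite graph thus needs at most [r] paths, of
   distinct colours.  In the first round one set [T] serves both sides, which
   saves one path. *)

Require Import Defs.
From mathcomp Require Import all_boot.
From mathcomp Require Import boolp wochoice classical_sets functions cardinality.
From mathcomp Require Import filter.

Set Implicit Arguments.
Unset Strict Implicit.
Unset Printing Implicit Defensive.

Local Open Scope classical_set_scope.
Local Open Scope card_scope.

(** * Cardinal comparison *)

(** The obstacle that shapes the proof is a singular kappa: a union of fewer than kappa small sets
    can be big, so a recursion with small stages may exhaust everything before it ends. Three
    devices answer this: common size bounds for families of skeletons, recursion along a shortest
    cofinal index set, and a pigeonhole argument that bounds exceptional sets uniformly. Stages that
    add only finitely many vertices are harmless, which is why gaps are filled by finite paths.

    Another recurring device makes properties of colours hereditary. Being rich, or not being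
    excluded, can only be lost when the two sides shrink. As there are finitely many colours, some
    pair of big sets has the fewest such colours, and none of its big subpairs loses one. *)

Notation "A '#!<=' B" := (~ (A #<= B)) (at level 79, format "A  '#!<='  B") : card_scope.

Lemma card_leI T U (A : set T) (B : set U) (f : T -> U) :
  (forall x, A x -> B (f x)) ->
  (forall x y, A x -> A y -> f x = f y -> x = y) -> A #<= B.
Proof.
move=> fAB finj; have fi : {in A &, injective f}.
  by move=> x y /set_mem Ax /set_mem Ay; apply: finj.
have := inj_card_eq fi; rewrite card_eq_sym card_eq_le => /andP[AfA _].
by apply: card_le_trans AfA _; apply: subset_card_le => _ [x Ax <-]; apply: fAB.
Qed.

Lemma card_leE T U (A : set T) (B : set U) : A #<= B -> forall u0 : U,
  exists f : T -> U, (forall x, A x -> B (f x)) /\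
    (forall x y, A x -> A y -> f x = f y -> x = y).
Proof.
move=> /card_leP[f] u0.
pose g x := if pselect (A x) is left Ax then val (f (SigSub (mem_set Ax))) else u0.
exists g; split=> [x Ax|x y Ax Ay].
  by rewrite /g; case: pselect => // {}Ax; case: (f _) => /= z /set_mem.
rewrite /g; case: pselect => // {}Ax; case: pselect => // {}Ay /val_inj.
by move=> /(@inj _ _ _ f); rewrite !inE => /(_ I I) [].
Qed.

Lemma card_min (I T : Type) (S : I -> set T) (i0 : I) :
  exists i, forall j, S i #<= S j.
Proof.
pose P (M : set (I -> T)) := (forall g, M g -> forall i, S i (g i)) /\
  (forall g h i, M g -> M h -> g i = h i -> g = h).
have [F FP Ftot|M [[MS Minj] Mmax]] := @Zorn_bigcup _ P.
  split=> [g [X FX Xg] i|g h i [X FX Xg] [Y FY Yh] gh].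
    by have [XS _] := FP _ FX; apply: XS.
  have [XY|YX] := Ftot _ _ FX FY.
    by have [_] := FP _ FY; apply; [exact: XY Xg|exact: Yh|exact: gh].
  by have [_] := FP _ FX; apply; [exact: Xg|exact: YX Yh|exact: gh].
apply: contrapT => noi.
have noh i : exists y, S i y /\ forall g, M g -> g i <> y.
  apply: contrapT => hit; apply: noi; exists i => j.
  have /choice [c cP] y : exists g, S i y -> M g /\ g i = y.
    have [Siy|nS] := pselect (S i y); last by exists (fun=> y).
    apply: contrapT => h; apply: hit; exists y; split=> // g Mg gy.
    by apply: h; exists g.
  apply: (@card_leI _ _ _ _ (fun y => c y j)) => [y Sy|y z Sy Sz].
    by have [Mc _] := cP y Sy; apply: MS.
  have [Mcy cy] := cP y Sy; have [Mcz cz] := cP z Sz.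
  by move=> /(Minj _ _ _ Mcy Mcz) e; rewrite -cy -cz e.
have [g gP] := choice noh.
apply: (Mmax (M `|` [set g])).
  split; first by move=> h; left.
  by move=> /(_ g (or_intror erefl)) Mg; have [_ /(_ _ Mg)] := gP i0.
split=> [h [Mh|->] i|h h' i].
- exact: MS.
- by have [] := gP i.
case=> [Mh|->] [Mh'|->] //; first exact: Minj.
  by have [_ /(_ _ Mh)] := gP i.
by have [_ /(_ _ Mh') ne] := gP i; move=> /esym.
Qed.

Lemma card_le_total T U (A : set T) (B : set U) : A #<= B \/ B #<= A.
Proof.
pose S b := if b then inl @` A else inr @` B : set (T + U).
have [[] iP] := card_min S true; have := iP true; have := iP false; rewrite /S.
- move=> AB _; left; apply: card_le_trans (card_image_le inr B).
  apply: card_le_trans AB; apply: (card_leI (f := inl)) => [x Ax|x y _ _ []//].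
  by exists x.
- move=> _ BA; right; apply: card_le_trans (card_image_le inl A).
  apply: card_le_trans BA; apply: (card_leI (f := inr)) => [x Ax|x y _ _ []//].
  by exists x.
Qed.

Lemma card_ind T (P : set T -> Prop) :
  (forall S, (forall S', S #!<= S' -> P S') -> P S) -> forall S, P S.
Proof.
move=> ih S; apply: contrapT => nPS.
pose nP (S : set T) := ~ P S.
have [[S0 nP0] mP] := @card_min {S : set T | nP S} T (fun s => sval s) (exist nP S nPS).
apply: (nP0); apply: ih => S' nle; apply: contrapT => nP'.
by have := mP (exist nP S' nP') => /=.
Qed.

(** * Well-orders *)

Definition wo T (Q : set T) (lt : T -> T -> Prop) :=
  [/\ forall x, Q x -> ~ lt x x,
      forall x y z, Q x -> Q y -> Q z -> lt x y -> lt y z -> lt x z &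
      forall P, P `<=` Q -> P !=set0 ->
        exists m, P m /\ forall x, P x -> x = m \/ lt m x].

Definition seg T (Q : set T) (lt : T -> T -> Prop) x := [set y | Q y /\ lt y x].

Lemma wo_total T (Q : set T) lt : wo Q lt ->
  forall x y, Q x -> Q y -> [\/ lt x y, x = y | lt y x].
Proof.
move=> [_ _ mn] x y Qx Qy.
have [|//|m [[]->]] := mn [set x; y]; first by move=> z [] ->.
- by exists x; left.
- by move=> /(_ y (or_intror erefl)) [->|]; [constructor 2|constructor 1].
- by move=> /(_ x (or_introl erefl)) [->|]; [constructor 2|constructor 3].
Qed.

Lemma wo_ind T (Q : set T) lt (P : T -> Prop) : wo Q lt ->
  (forall i, Q i -> (forall j, Q j -> lt j i -> P j) -> P i) ->
  forall i, Q i -> P i.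
Proof.
move=> woQ ih i Qi; have [irr tr mn] := woQ; apply: contrapT => nPi.
have [|//|m [[Qm nPm] mP]] := mn [set j | Q j /\ ~ P j]; first by move=> z [].
  by exists i.
apply: nPm; apply: ih => // j Qj jm; apply: contrapT => nPj.
have [e|mj] := mP j (conj Qj nPj); first by move: jm; rewrite e; apply: irr.
case: (irr m Qm).
exact: (tr m j m).
Qed.

Lemma wo_asym T (Q : set T) lt x y : wo Q lt -> Q x -> Q y ->
  lt x y -> ~ lt y x.
Proof. by move=> [irr tr _] Qx Qy xy yx; apply: (irr x Qx); apply: (tr x y x). Qed.

Lemma wo_sub T (Q Q' : set T) lt : Q' `<=` Q -> wo Q lt -> wo Q' lt.
Proof.
move=> QQ [irr tr mn]; split=> [x /QQ|x y z /QQ ? /QQ ? /QQ ?|P PQ].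
- exact: irr.
- exact: tr.
by apply: mn => x /PQ/QQ.
Qed.

Lemma wo_pull T U (Q : set T) (Q' : set U) lt (f : T -> U) : wo Q' lt ->
  (forall x, Q x -> Q' (f x)) ->
  (forall x y, Q x -> Q y -> f x = f y -> x = y) ->
  wo Q (fun x y => lt (f x) (f y)).
Proof.
move=> [irr tr mn] fQ finj; split=> [x /fQ|x y z /fQ ? /fQ ? /fQ ?|P PQ [p Pp]].
- exact: irr.
- exact: tr.
have [||m [[x Px <-] mP]] := mn (f @` P).
- by move=> _ [x /PQ/fQ ? <-].
- by exists (f p), p.
exists x; split=> // y Py; have [|/finj e|] := mP (f y); first by exists y.
- by left; apply: e; apply: PQ.
- by right.
Qed.

(** Start from any well-order. If some initial segment is as large as [S], take the least [m] with
    such a segment and pull the order back along an injection [f] of [S] into it: the new segment of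
    [x] embeds into the old one of [f x], and [f x] precedes [m]. *)
Lemma wo_initial T (S : set T) :
  exists lt, wo S lt /\ forall x, S x -> S #!<= seg S lt x.
Proof.
have [R Rwo] := well_ordering_principle {classic T}.
pose lt (x y : T) := R x y /\ x <> y.
have Rwc : wo_chain R predT by apply: withinW => A; exact: Rwo.
have anti x y : R x y -> R y x -> x = y.
  by move=> xy yx; apply: (wo_chain_antisymmetric Rwc) => //; rewrite xy.
have mnR (P : set T) : P !=set0 -> exists m, P m /\ forall x, P x -> R m x.
  move=> [p Pp]; have [|m [[]]] := Rwo (fun x => `[< P x >]).
    by exists p; apply/asboolP.
  by move=> /asboolP Pm mP _; exists m; split=> // x Px; apply: mP; apply/asboolP.
have woS Q : wo Q lt.
  split=> [x _ []//|x y z _ _ _ [xy nxy] [yz nyz]|P _ /mnR[m [Pm mP]]].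
    have xz : R x z.
      have [|m [mem mP]] := mnR [set w | [\/ w = x, w = y | w = z]].
        by exists x; constructor 1.
      case: mem => e; subst m.
      - by apply: mP; constructor 3.
      - have yx := mP x (Or31 _ _ erefl).
        by case: nxy; apply: anti.
      - have zy := mP y (Or32 _ _ erefl).
        by case: nyz; apply: anti.
    split=> // e; subst z; apply: nxy; exact: anti.
  exists m; split=> // x Px; have [->|ne] := pselect (x = m); first by left.
  by right; split; [exact: mP|move=> e; apply: ne].
have [[v [Sv Sle]]|no] := pselect (exists v, S v /\ S #<= seg S lt v); last first.
  by exists lt; split=> // x Sx le; apply: no; exists x.
have [_ _ mn] := woS S.
have [|//|m [[Sm mle] mP]] := mn [set v | S v /\ S #<= seg S lt v].
- by move=> ? [].
- by exists v.
have [f [fS finj]] := card_leE mle m.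
exists (fun x y => lt (f x) (f y)); split.
  by apply: (wo_pull (Q' := S)) => // x /fS[].
move=> x Sx le; have [Sfx fxm] := fS x Sx.
have : S #<= seg S lt (f x).
  apply: card_le_trans le _; apply: (card_leI (f := f)) => [y [Sy yx]|y z [Sy _] [Sz _]].
    by split=> //; have [] := fS y Sy.
  exact: finj.
move=> le'; have [e|] := mP (f x) (conj Sfx le'); first by move: fxm; rewrite e => -[].
by apply: (wo_asym (woS S)) fxm.
Qed.

(** [Psi i f x] says that [x] is an admissible value at [i]; by the first hypothesis this depends on
    [f] only before [i]. A relation instead of a function hides the choices, and each step may
    assume that all earlier values are admissible. *)
Lemma wo_rec I (A : Type) (a0 : A) (N : set I) lt
    (Psi : I -> (I -> A) -> A -> Prop) : wo N lt ->
  (forall i f g x, N i -> (forall j, N j -> lt j i -> f j = g j) ->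
     Psi i f x -> Psi i g x) ->
  (forall i f, N i -> (forall j, N j -> lt j i -> Psi j f (f j)) ->
     exists x, Psi i f x) ->
  exists f, forall i, N i -> Psi i f (f i).
Proof.
move=> woN ext step; pose R j i := [/\ N j, N i & lt j i].
have Rwf : well_founded R.
  move=> i; have [Ni|nNi] := pselect (N i); last by split=> j [].
  move: i Ni; apply: (wo_ind woN) => i Ni ih; split=> j [Nj _ ji]; exact: ih.
pose get (P : set A) := if pselect (exists x, P x) is left h then projT1 (cid h) else a0.
have getP (P : set A) x : P x -> P (get P).
  by move=> Px; rewrite /get; case: pselect => [h|[]]; [case: cid|exists x].
pose F i (rec : forall j, R j i -> A) :=
  get (Psi i (fun j => if pselect (R j i) is left h then rec j h else a0)).
pose f := Fix Rwf (fun _ => A) F.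
have fE i : f i = get (Psi i (fun j => if pselect (R j i) then f j else a0)).
  rewrite /f Fix_eq /F; last first.
    by move=> x g h gh; congr (get (Psi _ _)); apply/funext => j;
      case: pselect.
  by congr (get (Psi _ _)); apply/funext => j; case: pselect.
exists f; apply: (wo_ind woN) => i Ni ih.
have [x xP] := step i f Ni ih.
have agree : forall j, N j -> lt j i -> f j = if pselect (R j i) then f j else a0.
  by move=> j Nj ji; case: pselect => // nR; case: nR.
rewrite fE; apply: (ext i (fun j => if pselect (R j i) then f j else a0)) => //.
  by move=> j Nj ji; rewrite -agree.
by apply: (getP (Psi i _) x); apply: ext xP.
Qed.

(** At most [seg N lt i] many values are used up before [i], too few to exhaust [E i]. *)
Lemma inj_choice I T (t0 : T) (N : set I) lt (E : I -> set T) : wo N lt ->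
  (forall i, N i -> E i #!<= seg N lt i) ->
  exists b, (forall i, N i -> E i (b i)) /\
    (forall i j, N i -> N j -> b i = b j -> i = j).
Proof.
move=> woN big.
have [|i f Ni _|b bP] := @wo_rec _ _ t0 N lt
    (fun i f x => E i x /\ forall j, N j -> lt j i -> f j <> x) woN.
- by move=> i f g x _ fg [Ex fx]; split=> // j Nj ji; rewrite -fg //; exact: fx.
- apply: contrapT => no; apply: (big i Ni).
  apply: card_le_trans (card_image_le f _); apply: subset_card_le => x Ex.
  apply: contrapT => nx; apply: no; exists x; split=> // j Nj ji e.
  by apply: nx; exists j.
exists b; split=> [i /bP[]//|i j Ni Nj e].
have [ij|//|ji] := wo_total woN Ni Nj.
- by have [_ /(_ i Ni ij)] := bP j Nj; rewrite e.
- by have [_ /(_ j Nj ji)] := bP i Ni; rewrite e.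
Qed.

Lemma wo_card_le T U (P : set T) lt (S : set U) : wo P lt ->
  (forall x, P x -> S #!<= seg P lt x) -> P #<= S.
Proof.
move=> woP h; have [->|/set0P[p Pp]] := eqVneq P set0; first exact: card_ge0.
have [E|/set0P[s Ss]] := eqVneq S set0.
  by case: (h p Pp); rewrite E; exact: card_ge0.
have [b [bS binj]] := inj_choice s (E := fun=> S) woP h.
exact: card_leI bS binj.
Qed.

Definition lexlt I T (pi : T -> I) (ltN : I -> I -> Prop)
  (ltf : I -> T -> T -> Prop) x y :=
  ltN (pi x) (pi y) \/ pi x = pi y /\ ltf (pi x) x y.

Lemma wo_lex I T (N : set I) ltN (Q : set T) (pi : T -> I) ltf : wo N ltN ->
  (forall x, Q x -> N (pi x)) ->
  (forall i, N i -> wo [set x | Q x /\ pi x = i] (ltf i)) ->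
  wo Q (lexlt pi ltN ltf).
Proof.
move=> woN piN wof; have [irr tr mn] := woN; split.
- move=> x Qx [|[_]]; first by apply: irr; apply: piN.
  by have [h _ _] := wof _ (piN x Qx); apply: h.
- move=> x y z Qx Qy Qz [xy|[exy xy]] [yz|[eyz yz]].
  + by left; apply: (tr _ (pi y)) => //; apply: piN.
  + by left; rewrite -eyz.
  + by left; rewrite exy.
  + right; rewrite exy; split=> //; have [_ h _] := wof _ (piN y Qy).
    by rewrite exy in xy *; apply: (h x y z).
- move=> P PQ [p Pp].
  have [||i [[m0 Pm0 m0i] iP]] := mn (pi @` P).
  + by move=> _ [x /PQ/piN ? <-].
  + by exists (pi p), p.
  have Ni : N i by rewrite -m0i; apply/piN/PQ.
  have [_ _ h] := wof _ Ni.
  have [||m [[Pm mi] mP]] := h [set x | P x /\ pi x = i].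
  + by move=> x [/PQ].
  + by exists m0.
  exists m; split=> // x Px; have [e|] := iP (pi x) (imageP _ Px).
    by have [->|mx] := mP x (conj Px e); [left|right; right; rewrite mi e].
  by right; left; rewrite mi.
Qed.

(** * Cardinal arithmetic *)

(** Hilbert's hotel: a copy [f] of the natural numbers in [A] is shifted by one, and [x] takes the
    place [f 0]. *)
Lemma infinite_setU1_le T (A : set T) x : infinite_set A -> (A `|` [set x]) #<= A.
Proof.
move=> infA; have [Ax|nAx] := pselect (A x).
  by apply: subset_card_le => y [|->].
have /card_leE /(_ x) [f [fA finj]] := (infiniteP A).1 infA.
have {}finj i j : f i = f j -> i = j by apply: finj.
pose g y := if pselect (exists n, f n = y) is left h then f (projT1 (cid h)).+1
  else if pselect (y = x) then f 0%N else y.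
have gf n : g (f n) = f n.+1.
  by rewrite /g; case: pselect => [h|[]]; [case: cid => m /= /finj ->|exists n].
have gx : g x = f 0%N.
  rewrite /g; case: pselect => [[n e]|_]; last by case: pselect.
  by case: nAx; rewrite -e; apply: fA.
have go y : ~ (exists n, f n = y) -> y <> x -> g y = y.
  by rewrite /g; case: pselect => // _; case: pselect.
have caseA y : (A `|` [set x]) y ->
    [\/ exists n, y = f n, y = x | ~ (exists n, f n = y) /\ (y <> x /\ A y)].
  move=> Ay; have [->|nyx] := pselect (y = x); first by constructor 2.
  have [[n <-]|nn] := pselect (exists n, f n = y).
    by constructor 1; exists n.
  by constructor 3; split=> //; split=> //; case: Ay.
apply: (card_leI (f := g)) => [y /caseA|y z /caseA + /caseA].
- by case=> [[n ->]|->|[? [? ?]]]; rewrite ?gf ?gx ?go //; apply: fA.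
- case=> [[n ->]|->|[ny [nyx Ay]]]; case=> [[m ->]|->|[nz [nzx Az]]];
    rewrite ?gf ?gx ?(go _ ny nyx) ?(go _ nz nzx) //.
  + by move=> /finj[->].
  + by move=> /finj.
  + by move=> e; case: nz; exists n.+1.
  + by move=> /finj.
  + by move=> e; case: nz; exists 0%N.
  + by move=> e; case: ny; exists m.+1.
  + by move=> e; case: ny; exists 0%N.
Qed.

Lemma infinite_not_le T U (K : set T) (A : set U) :
  infinite_set K -> finite_set A -> K #!<= A.
Proof. by move=> infK finA le; apply: infK; exact: card_le_finite le finA. Qed.

(** Pairs are ordered by their maximum [mx], then by coordinates. The predecessors of [p] have both
    coordinates in [S'], the elements up to [mx p]. Since the order of [S] is initial, [S'] is
    smaller than [S], and the induction applies to it. *)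
Lemma infinite_square T (S : set T) : infinite_set S -> (S `*` S) #<= S.
Proof.
elim/card_ind: S => S ih infS.
have [lt [woS iniS]] := wo_initial S; have [irr tr mn] := woS.
pose mx (p : T * T) := if `[< lt p.1 p.2 >] then p.2 else p.1.
have mxS p : (S `*` S) p -> S (mx p).
  by move=> [? ?]; rewrite /mx; case: asbool.
pose lt2 := lexlt mx lt (fun _ => lexlt fst lt (fun _ p q => lt p.2 q.2)).
have wo2 : wo (S `*` S) lt2.
  apply: (wo_lex woS) => // i _; apply: (wo_lex woS) => [p [[]]//|j _].
  apply: (wo_pull woS) => [p [[[]]]//|[p1 p2] [q1 q2] /= [_ ->] [_ ->] ->//].
apply: wo_card_le wo2 _ => p Sp.
pose S' := seg S lt (mx p) `|` [set mx p].
have sub : seg (S `*` S) lt2 p `<=` S' `*` S'.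
  move=> q [Sq qp]; have [Sq1 Sq2] := Sq.
  have mle : mx q = mx p \/ lt (mx q) (mx p) by case: qp => [|[]]; [right|left].
  have le1 : q.1 = mx q \/ lt q.1 (mx q).
    by rewrite /mx; case: asboolP => ?; [right|left].
  have le2 : q.2 = mx q \/ lt q.2 (mx q).
    rewrite /mx; case: asboolP => h; first by left.
    by have [//|->|] := wo_total woS Sq1 Sq2; [left|right].
  have inS' x : S x -> x = mx q \/ lt x (mx q) -> S' x.
    move=> Sx [->|xm]; first by case: mle => [->|]; [right|left; split; [exact: mxS|]].
    left; split=> //; case: mle => [<-//|]; apply: tr => //; exact: mxS.
  by split; apply: inS'.
move=> /card_le_trans /(_ (subset_card_le sub)).
have nS' : S #!<= S'.
  move=> le; have infs : infinite_set (seg S lt (mx p)).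
    move=> fin; apply: infinite_not_le infS _ le.
    by rewrite finite_setU; split.
  by apply: (iniS _ (mxS _ Sp)); apply: card_le_trans le (infinite_setU1_le _ infs).
have [finS'|infS'] := pselect (finite_set S').
  by apply: infinite_not_le => //; apply: finite_setX.
by move=> /card_le_trans /(_ (ih _ nS' infS')).
Qed.

Lemma card_leX T T' U U' (A : set T) (B : set U) (A' : set T') (B' : set U') :
  A #<= A' -> B #<= B' -> (A `*` B) #<= (A' `*` B').
Proof.
move=> AA BB; have [->|/set0P[[a b] [/= Aa Bb]]] := eqVneq (A `*` B) set0.
  exact: card_ge0.
have [E|/set0P[a' _]] := eqVneq A' set0.
  by move: AA; rewrite E => /card_le0P E0; move: Aa; rewrite E0.
have [E|/set0P[b' _]] := eqVneq B' set0.
  by move: BB; rewrite E => /card_le0P E0; move: Bb; rewrite E0.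
have [f [fA fi]] := card_leE AA a'; have [g [gB gi]] := card_leE BB b'.
apply: (card_leI (f := fun p => (f p.1, g p.2))) => [p []|[p q] [r s]] /=.
  by split; [apply: fA|apply: gB].
by move=> [? ?] [? ?] [/fi -> // /gi ->].
Qed.

Lemma card_leX_inf T U W (A : set T) (B : set U) (C : set W) :
  infinite_set C -> A #<= C -> B #<= C -> (A `*` B) #<= C.
Proof.
move=> infC AC BC; apply: card_le_trans (infinite_square infC).
exact: card_leX.
Qed.

Lemma card_bigcup_leX I T U (D : set I) (F : I -> set T) (C : set U) :
  (forall i, D i -> F i #<= C) -> \bigcup_(i in D) F i #<= (D `*` C).
Proof.
move=> FC; have [->|/set0P[t [i Di Fit]]] := eqVneq (\bigcup_(i in D) F i) set0.
  exact: card_ge0.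
have [E|/set0P[c _]] := eqVneq C set0.
  by move: (FC i Di); rewrite E => /card_le0P E0; move: Fit; rewrite E0.
have /choice[f fP] j : exists f : T -> U, D j -> (forall x, F j x -> C (f x)) /\
    (forall x y, F j x -> F j y -> f x = f y -> x = y).
  have [Dj|nD] := pselect (D j); last by exists (fun=> c).
  by have [f fP] := card_leE (FC j Dj) c; exists f.
have /choice[p pP] x : exists j, (\bigcup_(i in D) F i) x -> D j /\ F j x.
  by have [[j Dj Fj]|] := pselect ((\bigcup_(i in D) F i) x); [exists j|exists i].
apply: (card_leI (f := fun x => (p x, f (p x) x))) => [x /pP[Dp Fp]|x y].
  by split=> //=; have [h _] := fP _ Dp; apply: h.
move=> /pP[Dp Fp] /pP[Dq Fq] [e]; rewrite -e => ef.
by have [_ h] := fP _ Dp; apply: h => //; rewrite e.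
Qed.

Lemma card_bigcup_le I T U (D : set I) (F : I -> set T) (C : set U) :
  infinite_set C -> D #<= C -> (forall i, D i -> F i #<= C) ->
  \bigcup_(i in D) F i #<= C.
Proof.
move=> infC DC FC; apply: card_le_trans (card_bigcup_leX FC) _.
exact: card_leX_inf.
Qed.

Lemma card_leU T U (A B : set T) (C : set U) :
  infinite_set C -> A #<= C -> B #<= C -> (A `|` B) #<= C.
Proof.
move=> infC AC BC.
rewrite -(bigcup2E A B); apply: card_bigcup_le => //; first exact/infiniteP.
by case=> [|[|n]] _ //; exact: card_ge0.
Qed.

Lemma pigeonhole_le T U P (S : set T) (f : T -> P) (D : set P) (C : set U) :
  (forall x, S x -> D (f x)) -> S #!<= (D `*` C) ->
  exists p, D p /\ [set x | S x /\ f x = p] #!<= C.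
Proof.
move=> fD nle; apply: contrapT => no; apply: nle.
have sub : S `<=` \bigcup_(p in D) [set x | S x /\ f x = p].
  by move=> x Sx; exists (f x) => //; apply: fD.
apply: card_le_trans (subset_card_le sub) _; apply: card_bigcup_leX => p Dp.
by apply: contrapT => n; apply: no; exists p; split=> //; apply/negP/negP; exact/negP.
Qed.

(** * Small sets and their unions *)

Section Small.
Context (W : Type) (K : set W) (infK : infinite_set K).

Definition small T (S : set T) := K #!<= S.

Lemma smallS T U (A : set T) (B : set U) : A #<= B -> small B -> small A.
Proof. by move=> AB sB KA; apply: sB; exact: card_le_trans KA AB. Qed.

Lemma sub_small T (A B : set T) : A `<=` B -> small B -> small A.
Proof. by move=> /subset_card_le; exact: smallS. Qed.

Lemma small_finite T (A : set T) : finite_set A -> small A.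
Proof. exact: infinite_not_le. Qed.

Lemma small_le T (A : set T) : small A -> A #<= K.
Proof. by move=> sA; case: (card_le_total A K). Qed.

Lemma smallX T U (A : set T) (B : set U) : small A -> small B -> small (A `*` B).
Proof.
move=> sA sB.
have [fA|iA] := pselect (finite_set A); have [fB|iB] := pselect (finite_set B).
- by apply: small_finite; apply: finite_setX.
- apply: smallS sB; apply: card_leX_inf => //; apply: card_le_trans ((infiniteP B).1 iB).
  exact: finite_set_countable.
- apply: smallS sA; apply: card_leX_inf => //; apply: card_le_trans ((infiniteP A).1 iA).
  exact: finite_set_countable.
have [AB|BA] := card_le_total A B.
  by apply: smallS sB; apply: card_leX_inf.
by apply: smallS sA; apply: card_leX_inf.
Qed.

Lemma smallU T (A B : set T) : small A -> small B -> small (A `|` B).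
Proof.
move=> sA sB.
have [fA|iA] := pselect (finite_set A); have [fB|iB] := pselect (finite_set B).
- by apply: small_finite; rewrite finite_setU.
- apply: smallS sB; apply: card_leU => //; apply: card_le_trans ((infiniteP B).1 iB).
  exact: finite_set_countable.
- apply: smallS sA; apply: card_leU => //; apply: card_le_trans ((infiniteP A).1 iA).
  exact: finite_set_countable.
have [AB|BA] := card_le_total A B.
  by apply: smallS sB; apply: card_leU.
by apply: smallS sA; apply: card_leU.
Qed.

(** The members need a common small bound [C]: for singular [K] a small union of small sets can be
    big. *)
Lemma small_bigcup I T U (D : set I) (F : I -> set T) (C : set U) :
  small D -> small C -> (forall i, D i -> F i #<= C) ->
  small (\bigcup_(i in D) F i).
Proof. by move=> sD sC FC; apply: smallS (card_bigcup_leX FC) (smallX sD sC). Qed.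

Lemma small_bigcup_finite I T (D : set I) (F : I -> set T) :
  small D -> (forall i, D i -> finite_set (F i)) -> small (\bigcup_(i in D) F i).
Proof.
move=> sD Ff; have [fD|iD] := pselect (finite_set D).
  by apply: small_finite; apply: bigcup_finite.
apply: small_bigcup (sD) (sD) _ => i Di; apply: card_le_trans ((infiniteP D).1 iD).
by apply: finite_set_countable; apply: Ff.
Qed.

Lemma small_bigcup_fin (I : finType) T (F : I -> set T) :
  (forall i, small (F i)) -> small (\bigcup_i F i).
Proof.
move=> sF; have -> : \bigcup_i F i = \bigcup_(i in [set` enum I]) F i.
  by apply: eq_bigcupl; split=> // i _ /=; rewrite mem_enum.
elim: (enum I) => [|i s ih]; first by rewrite set_nil bigcup_set0; apply: small_finite.
rewrite (_ : [set` i :: s] = i |` [set` s]) ?bigcup_setU1; first exact: smallU.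
apply/seteqP; split=> j /=; rewrite inE.
  by move=> /orP[/eqP|]; [left|right].
by move=> [->|js]; rewrite ?eqxx // js orbT.
Qed.

Lemma smallD T (A B : set T) : ~ small A -> small B -> ~ small (A `\` B).
Proof.
move=> bA sB sD; apply: bA; apply: sub_small (smallU sD sB) => x Ax.
by have [Bx|nBx] := pselect (B x); [right|left].
Qed.

Lemma big_card T (A : set T) : ~ small A -> K #<= A.
Proof. by move=> /contrapT. Qed.

Lemma big_ex T (A : set T) : ~ small A -> exists x, A x.
Proof.
move=> bA; apply: contrapT => no; apply: bA; apply: small_finite.
rewrite (_ : A = set0) // -subset0 => x Ax; by apply: no; exists x.
Qed.

End Small.

(** * Generalised paths and their concatenation *)

Section Concatenation.
Context (V : eqType).
Implicit Types (step lim : V -> V -> Prop).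

Definition ispred T (Q : set T) (lt : T -> T -> Prop) u v :=
  [/\ Q u, lt u v & forall w, Q w -> lt u w -> ~ lt w v].

Definition ismin T (Q : set T) (lt : T -> T -> Prop) v :=
  Q v /\ forall u, Q u -> ~ lt u v.

Definition ismax T (Q : set T) (lt : T -> T -> Prop) v :=
  Q v /\ forall u, Q u -> ~ lt v u.

(* With [step] and [lim] both the adjacency relation this is a generalised path;
   the general form also covers the skeletons from which paths are built. *)
Definition gpath step lim (Q : set V) (lt : V -> V -> Prop) := wo Q lt /\ forall v, Q v ->
  [\/ forall u, Q u -> ~ lt u v,
      exists u, ispred Q lt u v /\ step u v |
      (exists u, Q u /\ lt u v) /\
      forall u, Q u -> lt u v -> exists w, [/\ Q w, lt u w, lt w v & lim w v]].

Lemma ismin_eq T (Q : set T) (lt : T -> T -> Prop) x y : wo Q lt -> ismin Q lt x ->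
  (Q y /\ forall u, Q u -> ~ lt u y) -> y = x.
Proof.
move=> woQ [Qx mx] [Qy my]; have [yx|//|xy] := wo_total woQ Qy Qx.
- by case: (mx _ Qy).
- by case: (my _ Qx).
Qed.

(** The blocks are ordered lexicographically. Inside a block the path condition is inherited; only
    its first vertex [m i] needs the hypothesis on [i]: it starts the sum, or follows the last
    vertex of the preceding block, or has neighbours in cofinally many earlier blocks. *)
Lemma gpath_sum I (i0 : I) (N : set I) ltN (P : I -> set V)
    (ltP : I -> V -> V -> Prop) (m : I -> V) step lim :
  wo N ltN ->
  (forall i, N i -> gpath step lim (P i) (ltP i)) ->
  (forall i, N i -> ismin (P i) (ltP i) (m i)) ->
  (forall i j x, N i -> N j -> P i x -> P j x -> i = j) ->
  (forall i, N i ->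
    [\/ forall j, N j -> ~ ltN j i,
        exists j, ispred N ltN j i /\
          exists u, ismax (P j) (ltP j) u /\ step u (m i) |
        (exists j, N j /\ ltN j i) /\ forall j, N j -> ltN j i ->
          exists j' w, [/\ N j', ltN j j', ltN j' i, P j' w & lim w (m i)]]) ->
  exists lt, [/\ gpath step lim (\bigcup_(i in N) P i) lt,
    forall n u, ismin N ltN n -> ismin (P n) (ltP n) u ->
      ismin (\bigcup_(i in N) P i) lt u &
    forall n u, ismax N ltN n -> ismax (P n) (ltP n) u ->
      ismax (\bigcup_(i in N) P i) lt u].
Proof.
move=> woN gP mP dis cond; set Q := \bigcup_(i in N) P i.
have /choice[pi piP] x : exists i, Q x -> N i /\ P i x.
  by have [[i Ni Pix]|] := pselect (Q x); [exists i|exists i0].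
have piE i x : N i -> P i x -> pi x = i.
  move=> Ni Px; have [Np Pp] := piP x (ex_intro2 _ _ i Ni Px).
  exact: dis Np Ni Pp Px.
pose lt := lexlt pi ltN ltP.
have woQ : wo Q lt.
  apply: (wo_lex woN) => [x /piP[]//|i Ni].
  apply: wo_sub (gP i Ni).1 => x [Qx <-]; exact: (piP x Qx).2.
have ltE i x y : N i -> P i x -> P i y -> ltP i x y -> lt x y.
  by move=> Ni Px Py xy; right; rewrite !(piE i).
have ltI i j x y : N i -> N j -> P i x -> P j y -> ltN i j -> lt x y.
  by move=> Ni Nj Px Py ij; left; rewrite (piE i) ?(piE j).
have ltC i j x y : N i -> N j -> P i x -> P j y -> lt x y ->
    ltN i j \/ i = j /\ ltP i x y.
  by move=> Ni Nj Px Py; rewrite /lt/lexlt (piE i) // (piE j).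
have inQ i x : N i -> P i x -> Q x by move=> Ni Px; exists i.
exists lt; split; last 2 first.
- move=> n u [Nn minn] [Pu minu]; split; first exact: inQ Pu.
  move=> v [j Nj Pv] /(ltC _ _ _ _ Nj Nn Pv Pu)[|[jn]]; first exact: minn.
  by subst j; apply: minu.
- move=> n u [Nn maxn] [Pu maxu]; split; first exact: inQ Pu.
  move=> v [j Nj Pv] /(ltC _ _ _ _ Nn Nj Pu Pv)[|[jn]]; first exact: maxn.
  by subst j; apply: maxu.
split=> // v [i Ni Pv]; have [woP h] := gP i Ni; case: (h v Pv) => {h}.
- move=> minv; have vm : v = m i by apply: ismin_eq woP (mP i Ni) _; split.
  case: (cond i Ni).
  + move=> mini; constructor 1 => u [j Nj Pu] /(ltC _ _ _ _ Nj Ni Pu Pv)[|[e]].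
      exact: mini.
    by subst j; apply: minv.
  + move=> [j [[Nj ji nbt] [u [[Pu maxu] st]]]]; constructor 2; exists u.
    rewrite vm; split=> //; rewrite -vm; split; [exact: inQ Pu|exact: ltI Pu Pv ji|].
    move=> w [k Nk Pw] /(ltC _ _ _ _ Nj Nk Pu Pw) uw /(ltC _ _ _ _ Nk Ni Pw Pv) wv.
    case: uw => [jk|[e uw]]; last by subst k; apply: (maxu w).
    case: wv => [ki|[e wv]]; last by subst k; apply: (minv w).
    exact: nbt ki.
  + move=> [[j [Nj ji]] lm]; constructor 3; split.
      by exists (m j); have [Pm _] := mP j Nj; split; [exact: inQ Pm|exact: ltI ji].
    move=> u [k Nk Pu] /(ltC _ _ _ _ Nk Ni Pu Pv) [ki|[e]]; last first.
      by subst k => uv; case: (minv u).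
    have [j' [w [Nj' kj' j'i Pw lw]]] := lm k Nk ki.
    by exists w; rewrite vm; split=> //; rewrite -?vm; [exact: inQ Pw|exact: ltI kj'|exact: ltI j'i].
- move=> [u [[Pu uv nbt] st]]; constructor 2; exists u; split=> //.
  split; [exact: inQ Pu|exact: ltE uv|] => w [k Nk Pw].
  move=> /(ltC _ _ _ _ Ni Nk Pu Pw) uw /(ltC _ _ _ _ Nk Ni Pw Pv) wv.
  case: uw => [ik|[e uw]].
    case: wv => [ki|[e _]]; first exact: wo_asym woN Ni Nk ik ki.
    by subst k; have [irr _ _] := woN; apply: (irr i).
  subst k; case: wv => [ki|[_ wv]]; last exact: nbt wv.
  by have [irr _ _] := woN; apply: (irr i).
- move=> [[u0 [Pu0 u0v]] lm]; constructor 3; split.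
    by exists u0; split; [exact: inQ Pu0|exact: ltE u0v].
  move=> u [k Nk Pu] /(ltC _ _ _ _ Nk Ni Pu Pv) [ki|[e uv]].
    have [w [Pw uw wv lw]] := lm u0 Pu0 u0v.
    by exists w; split=> //; [exact: inQ Pw|exact: ltI ki|exact: ltE wv].
  subst k; have [w [Pw uw wv lw]] := lm u Pu uv.
  by exists w; split=> //; [exact: inQ Pw|exact: ltE uw|exact: ltE wv].
Qed.

Definition stepb step : rel V := fun a b => `[< step a b >].

Definition ltidx (s : seq V) : V -> V -> Prop := fun a b => (index a s < index b s)%N.

Lemma wo_idx (s : seq V) : wo [set` s] (ltidx s).
Proof.
split=> [x _|x y z _ _ _|P Ps [p Pp]]; rewrite /ltidx ?ltnn //; first exact: ltn_trans.
have ex : exists n, `[< exists2 x, P x & index x s = n >].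
  by exists (index p s); apply/asboolP; exists p.
have [k /asboolP[m Pm mk] mink] := ex_minnP ex.
exists m; split=> // y Py; have /(mink _) : `[< exists2 x, P x & index x s = index y s >].
  by apply/asboolP; exists y.
rewrite -mk leq_eqVlt => /orP[/eqP e|]; last by right.
left; have ms := Ps _ Pm; have ys := Ps _ Py.
by rewrite -(nth_index m ms) -(nth_index m ys) e.
Qed.

Lemma gpath_list step lim x (s : seq V) : uniq (x :: s) -> path (stepb step) x s ->
  [/\ gpath step lim [set` x :: s] (ltidx (x :: s)),
      ismin [set` x :: s] (ltidx (x :: s)) x &
      ismax [set` x :: s] (ltidx (x :: s)) (last x s)].
Proof.
move=> us ps; have szs : size (x :: s) = (size s).+1 by [].
split.
- split; first exact: wo_idx.
  move=> v vs; case e : (index v (x :: s)) => [|i].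
    by constructor 1 => u _; rewrite /ltidx e.
  constructor 2; have iv : (i.+1 < size (x :: s))%N by rewrite -e index_mem.
  have ii : (i < size (x :: s))%N by apply: ltn_trans iv.
  have iu : index (nth x (x :: s) i) (x :: s) = i by rewrite index_uniq.
  exists (nth x (x :: s) i); split.
    split; rewrite /ltidx ?iu ?e //=; first exact: mem_nth.
    by move=> w _ iw wi; move: (leq_trans iw wi); rewrite ltnn.
  have /(pathP x) /(_ i iv) := ps; rewrite /stepb => /asboolP.
  by rewrite -[nth x s i]/(nth x (x :: s) i.+1) -e nth_index.
- by split=> [|u _]; rewrite /ltidx /= ?mem_head // eqxx.
split=> [|u]; first exact: mem_last.
rewrite /= => us'; rewrite /ltidx index_last //; apply/negP; rewrite -leqNgt.
by rewrite -ltnS -szs index_mem.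
Qed.

(** This is [gpath_sum] with the blocks [u :: l u]. Every vertex of [Q] heads its block, so the
    cofinal neighbours of a limit vertex stay cofinal, and only the steps between consecutive
    vertices are replaced. *)
Lemma gpath_insert (Q : set V) (lt : V -> V -> Prop) (l : V -> seq V) (step lim step' lim' : V -> V -> Prop) :
  gpath step lim Q lt ->
  (forall u, Q u -> uniq (u :: l u)) ->
  (forall u, Q u -> path (stepb step') u (l u)) ->
  (forall u v, Q v -> ispred Q lt u v -> step u v -> step' (last u (l u)) v) ->
  (forall u v x, Q u -> Q v -> x \in l u -> x \in l v -> u = v) ->
  (forall u x, Q u -> x \in l u -> ~ Q x) ->
  (forall u v, lim u v -> lim' u v) ->
  exists lt', [/\ gpath step' lim' (\bigcup_(u in Q) [set` u :: l u]) lt',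
    forall u, ismin Q lt u -> ismin (\bigcup_(u in Q) [set` u :: l u]) lt' u &
    forall u, ismax Q lt u ->
      ismax (\bigcup_(u in Q) [set` u :: l u]) lt' (last u (l u))].
Proof.
move=> [woQ gQ] ul pl st dis disQ limS.
have [[q Qq]|Q0] := pselect (Q !=set0); last first.
  exists lt; rewrite (_ : \bigcup_(u in Q) _ = Q).
    split; last 2 first.
    - by [].
    - by move=> u [Qu]; case: Q0; exists u.
    by split=> // v Qv; case: Q0; exists v.
  by apply/seteqP; split=> [x [u Qu]|u Qu]; case: Q0; exists u.
have bl u (Qu : Q u) := gpath_list lim' (ul u Qu) (pl u Qu).
have [||||lt' [g mn mx]] := @gpath_sum _ q Q lt (fun u => [set` u :: l u])
    (fun u => ltidx (u :: l u)) id step' lim' woQ.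
- by move=> u /bl[].
- by move=> u /bl[].
- move=> u v x Qu Qv /=; rewrite !inE => /orP[/eqP->|xu] /orP[/eqP|xv] //.
  + by have := disQ _ _ Qv xv.
  + by move=> e; subst x; have := disQ _ _ Qu xu.
  + exact: dis xu xv.
- move=> v Qv; case: (gQ v Qv) => [h|[u [pu sv]]|[h1 h2]]; [by constructor 1| |].
  + constructor 2; exists u; split=> //; have [Qu _ _] := pu.
    by exists (last u (l u)); split; [have [] := bl u Qu|exact: st].
  + constructor 3; split=> // u Qu uv; have [w [Qw uw wv lw]] := h2 u Qu uv.
    by exists w, w; split=> //=; [rewrite mem_head|exact: limS].
exists lt'; split=> // u mu; have [Qu _] := mu; have [_ h1 h2] := bl u Qu.
- exact: mn mu h1.
- exact: mx mu h2.
Qed.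

End Concatenation.

(** * Splitting big sets, minimal counts and a new top element *)

Lemma wo_ltn : wo [set: nat] (fun m n => (m < n)%N).
Proof.
split=> [x _|x y z _ _ _|P _ [p Pp]]; [by rewrite ltnn|exact: ltn_trans|].
have ex : exists n, `[< P n >] by exists p; apply/asboolP.
have [k /asboolP Pk mk] := ex_minnP ex; exists k; split=> // x Px.
have := mk x; rewrite leq_eqVlt => h; have /h/orP[/eqP->|] : `[< P x >] by apply/asboolP.
  by left.
by right.
Qed.

Lemma split_big T U (K : set T) (A : set U) : infinite_set K -> K #<= A ->
  exists A0 A1, [/\ A0 `<=` A, A1 `<=` A, K #<= A0, K #<= A1 &
    forall x, A0 x -> ~ A1 x].
Proof.
move=> infK KA; have [k0 Kk0] := infinite_setN0 infK.
have /card_leE/(_ k0)[g [gK ginj]] : (K `*` [set: bool]) #<= K.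
  apply: card_leX_inf => //; apply: card_le_trans ((infiniteP K).1 infK).
  exact: finite_set_countable.
have [a0 Aa0] : A !=set0.
  by apply/set0P/eqP => A0; move: KA; rewrite A0 => /card_le0P K0; move: Kk0; rewrite K0.
have [f [fA finj]] := card_leE KA a0.
pose B b := [set f (g (x, b)) | x in K].
have BA b : B b `<=` A by move=> _ [x Kx <-]; apply: fA; apply: gK.
have KB b : K #<= B b.
  apply: (card_leI (f := fun x => f (g (x, b)))) => [x Kx|x y Kx Ky].
    by exists x.
  move=> /(finj _ _ (gK (x, b) (conj Kx I)) (gK (y, b) (conj Ky I))).
  by move=> /(ginj (x, b) (y, b) (conj Kx I) (conj Ky I)) [].
exists (B true), (B false); split=> // _ [x Kx <-] [y Ky].
move=> /(finj _ _ (gK (y, false) (conj Ky I)) (gK (x, true) (conj Kx I))).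
by move=> /(ginj (y, false) (x, true) (conj Ky I) (conj Kx I)) [].
Qed.

Lemma min_measure T (P : T -> Prop) (f : T -> nat) :
  (exists x, P x) -> exists x, P x /\ forall y, P y -> (f x <= f y)%N.
Proof.
move=> [x0 Px0]; have ex : exists n, `[< exists2 x, P x & f x = n >].
  by exists (f x0); apply/asboolP; exists x0.
have [n /asboolP[x Px <-] mn] := ex_minnP ex.
by exists x; split=> // y Py; apply: mn; apply/asboolP; exists y.
Qed.

Lemma pred_card_le (T : finType) (P Q : T -> Prop) : (forall x, P x -> Q x) ->
  (#|[pred x | `[< P x >]]| <= #|[pred x | `[< Q x >]]|)%N.
Proof.
move=> PQ; apply: subset_leq_card; apply/fintype.subsetP => x.
by move=> /asboolP Px; apply/asboolP; move: Px => /=; exact: PQ.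
Qed.

(** Used at a pair of sets that minimises the number of colours with a given property: a subpair has
    no fewer of them, so it keeps each one. *)
Lemma pred_card_eq (T : finType) (P Q : T -> Prop) : (forall x, P x -> Q x) ->
  (#|[pred x | `[< Q x >]]| <= #|[pred x | `[< P x >]]|)%N -> forall x, Q x -> P x.
Proof.
move=> PQ le x Qx; apply: contrapT => nPx.
have : (#|[pred x | `[< P x >]]| < #|[pred x | `[< Q x >]]|)%N.
  apply: proper_card; apply/properP; split.
    apply/fintype.subsetP => y.
    by move=> /asboolP Py; apply/asboolP; move: Py => /=; exact: PQ.
  by exists x; [apply/asboolP|apply/negP => /asboolP].
by rewrite ltnNge le.
Qed.

Lemma card_le_fin T U (I : finType) (A : set T) (F : I -> set T) (K : set U) :
  infinite_set K -> A `<=` \bigcup_i F i -> K #<= A -> exists i, K #<= F i.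
Proof.
move=> infK AF KA; apply: contrapT => no.
have : small K (\bigcup_i F i).
  by apply: small_bigcup_fin => // i le; apply: no; exists i.
by apply; apply: card_le_trans KA (subset_card_le AF).
Qed.

(** The new top [None] will index the last block of a closed skeleton. *)
Definition ltopt T (lt : T -> T -> Prop) (i j : option T) :=
  match i, j with
  | Some n, Some m => lt n m
  | Some _, None => True
  | _, _ => False
  end.

Lemma wo_opt T (N : set T) lt : wo N lt ->
  wo [set i | if i is Some n then N n else True] (ltopt lt).
Proof.
move=> [irr tr mn]; split=> [[x|] /= Nx|[x|] [y|] [z|] //= Nx Ny Nz|P PN P0].
- exact: irr.
- by [].
- exact: tr.
have [[x Px]|no] := pselect (exists x, P (Some x)).
  have [||m [Pm mP]] := mn [set x | P (Some x)].
  - by move=> y /PN.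
  - by exists x.
  exists (Some m); split=> // -[y|] Py; last by right.
  by case: (mP y Py) => [->|]; [left|right].
exists None; have [[x|] Px] := P0; first by case: no; exists x.
by split=> // -[y|] Py; [case: no; exists y|left].
Qed.

Lemma card_le_sub T U (K : set T) (A : set U) (u0 : U) : K #<= A ->
  exists B, [/\ B `<=` A, K #<= B & B #<= K].
Proof.
move=> /card_leE/(_ u0)[f [fA finj]]; exists (f @` K); split.
- by move=> _ [x Kx <-]; apply: fA.
- by apply: (card_leI (f := f)) => // x Kx; exists x.
- exact: card_image_le.
Qed.

(** * Cofinality and uniformly bounded exceptions *)

Section Cofinality.
Context (V : Type) (K : set V) (infK : infinite_set K).

(* [M] indexes a shortest covering of a set of size [K] by smaller sets. *)
Lemma cofinal_family : exists (M : set V) (S : V -> set V) lt,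
  [/\ wo M lt, forall i, M i -> small K (S i),
      ~ small K (\bigcup_(i in M) S i), M #<= K &
      (forall i, M i -> M #!<= seg M lt i) /\
      forall (P : set V) (F : V -> set V), M #!<= P ->
        (forall i, P i -> small K (F i)) -> small K (\bigcup_(i in P) F i)].
Proof.
pose ok (M : set V) := exists S : V -> set V,
  (forall i, M i -> small K (S i)) /\ ~ small K (\bigcup_(i in M) S i).
have okK : ok K.
  exists (fun i => [set i]); split=> [i _|]; first exact: small_finite.
  by rewrite bigcup_imset1 image_id => h; apply: h; exact: card_lexx.
have [[M okM] Mmin] := @card_min {M : set V | ok M} V (fun M => sval M) (exist ok K okK).
have [S [sS bS]] := okM; have [lt [woM inM]] := wo_initial M.
exists M, S, lt; split=> //; first exact: (Mmin (exist ok K okK)).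
split=> // P F nMP sF; apply: contrapT => bF; apply: nMP.
by apply: (Mmin (exist ok P _)); exists F.
Qed.

(** The last clause is the point. If [M] is big, any union of small sets over a small index set is
    small. If [M] is small, each [exc x] embeds into some [S i], and a pigeonhole over [i] as well
    bounds all exceptions of the class by one small set. *)
Lemma uniform_class T (V0 : set V) (D : set T) (f : V -> T) (exc : V -> set V)
    (S0 : set V) : ~ small K V0 -> small K D -> small K S0 ->
  (forall x, V0 x -> D (f x)) -> (forall x, V0 x -> small K (exc x)) ->
  exists p C, [/\ D p, C `<=` [set x | V0 x /\ f x = p], S0 #<= C, C #<= S0 &
    small K (\bigcup_(x in C) exc x)].
Proof.
move=> bV sD sS0 fD sexc; have [v0 Vv0] := big_ex infK bV.
have [M [S [lt [woM sS bS MK [inM regM]]]]] := cofinal_family.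
have [sM|bM] := pselect (small K M); last first.
  have [|p [Dp np]] := @pigeonhole_le _ _ _ V0 f D S0 fD.
    by move=> le; apply: bV; apply: smallS le (smallX infK sD sS0).
  have le : S0 #<= [set x | V0 x /\ f x = p] by case: (card_le_total S0 [set x | V0 x /\ f x = p]).
  have [C [sC SC CS]] := card_le_sub v0 le.
  exists p, C; split=> //; apply: regM => [le'|x /sC[Vx _]]; last exact: sexc.
  by apply: bM; apply: smallS (card_le_trans le' CS) sS0.
(* Otherwise every [S i] would embed into [exc x], and over the small [M] their union would be
   small. *)
have /choice[cl hcl] x : exists i, V0 x -> M i /\ exc x #<= S i.
  have [Vx|] := pselect (V0 x); last by exists v0.
  apply: contrapT => no; apply: bS; apply: (small_bigcup infK sM (sexc x Vx)) => i Mi.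
  have [//|le] := card_le_total (S i) (exc x).
  by case: no; exists i.
have [||[p i] [[/= Dp Mi] np]] := @pigeonhole_le _ _ _ V0 (fun x => (f x, cl x)) (D `*` M) S0.
- by move=> x Vx; split; [exact: fD|have [] := hcl x Vx].
- by move=> le; apply: bV; apply: smallS le (smallX infK (smallX infK sD sM) sS0).
have le : S0 #<= [set x | V0 x /\ (f x, cl x) = (p, i)].
  by case: (card_le_total S0 [set x | V0 x /\ (f x, cl x) = (p, i)]).
have [C [sC SC CS]] := card_le_sub v0 le.
exists p, C; split=> // [x /sC[Vx []]//|].
apply: (small_bigcup infK (smallS CS sS0) (sS i Mi)) => x /sC[Vx [_ <-]].
by have [] := hcl x Vx.
Qed.

End Cofinality.

(** * Finite sequences, ultrafilters and further facts on orders and small sets *)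

Lemma card_le_seq (V : eqType) (Y : set V) : infinite_set Y ->
  [set s : seq V | forall x, x \in s -> Y x] #<= Y.
Proof.
move=> infY; have [y0 Yy0] := infinite_setN0 infY.
have /card_leE/(_ y0)[p [pY pinj]] := infinite_square infY.
pose e (s : seq V) := foldr (fun x z => p (x, z)) y0 s.
have eY s : (forall x, x \in s -> Y x) -> Y (e s).
  elim: s => // x s ih h /=; apply: pY; split; first by apply: h; rewrite mem_head.
  by apply: ih => z zs; apply: h; rewrite inE zs orbT.
have einj s t : (forall x, x \in s -> Y x) -> (forall x, x \in t -> Y x) ->
    size s = size t -> e s = e t -> s = t.
  elim: s t => [|x s ih] [|y t] //= hs ht [sz].
  have hs' z : z \in s -> Y z by move=> zs; apply: hs; rewrite inE zs orbT.
  have ht' z : z \in t -> Y z by move=> zs; apply: ht; rewrite inE zs orbT.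
  have Yx : Y x by apply: hs; rewrite mem_head.
  have Yy : Y y by apply: ht; rewrite mem_head.
  move=> /(pinj (x, e s) (y, e t) (conj Yx (eY s hs')) (conj Yy (eY t ht')))[-> h].
  by rewrite (ih t hs' ht' sz h).
have : ([set: nat] `*` Y) #<= Y.
  by apply: card_leX_inf => //; exact/infiniteP.
apply: card_le_trans; apply: (card_leI (f := fun s => (size s, e s))) => [s hs|s t hs ht [sz h]].
  by split=> //; apply: eY.
exact: einj.
Qed.

Lemma ultra_bigcup (T : Type) (U : set_system T) (I : finType) (A : I -> set T) :
  UltraFilter U -> U (\bigcup_i A i) -> exists i, U (A i).
Proof.
move=> ultraU UA; apply: contrapT => no.
have nU i : U (~` A i).
  by have [UAi|//] := in_ultra_setVsetC (A i) ultraU; case: no; exists i.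
have all (s : seq I) : U (\bigcap_(i in [set` s]) ~` A i).
  elim: s => [|i s ih].
    by apply: filterS filterT => x _ i.
  apply: filterS (filterI (nU i) ih) => x [nAi h] j /=.
  by rewrite inE => /orP[/eqP->//|js]; apply: h.
have h : U ((\bigcup_i A i) `&` \bigcap_(i in [set` enum I]) ~` A i).
  exact: filterI.
suff e : (\bigcup_i A i) `&` \bigcap_(i in [set` enum I]) ~` A i = set0.
  by move: h; rewrite e; exact: filter_not_empty.
rewrite -subset0 => x [[i _ Ax] hx]; apply: (hx i) => //=.
by rewrite mem_enum.
Qed.

Lemma wo_initial_small T U (K : set U) (S : set T) : S #<= K ->
  exists lt, wo S lt /\ forall x, S x -> small K (seg S lt x).
Proof.
move=> SK; have [lt [woS inS]] := wo_initial S; exists lt; split=> // x Sx le.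
by apply: (inS x Sx); apply: card_le_trans SK le.
Qed.

Lemma ispred_fun T (Q : set T) lt u v v' : wo Q lt -> Q v -> Q v' ->
  ispred Q lt u v -> ispred Q lt u v' -> v = v'.
Proof.
move=> woQ Qv Qv' [Qu uv nu] [_ uv' nu']; have [vv'|//|v'v] := wo_total woQ Qv Qv'.
  by case: (nu' v).
by case: (nu v').
Qed.

Lemma small_bigcup_seq (U : Type) (K : set U) (I : eqType) T (s : seq I) (F : I -> set T) :
  infinite_set K -> (forall i, i \in s -> small K (F i)) ->
  small K (\bigcup_(i in [set` s]) F i).
Proof.
move=> infK; elim: s => [|a s ih] sF.
  by apply: small_finite => //; rewrite (_ : [set` [::]] = set0) ?bigcup_set0 // -subset0.
apply: sub_small (smallU infK (sF a (mem_head _ _)) (ih _)) => [x [i /=]|i si].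
  by rewrite inE => /orP[/eqP->|si] Fx; [left|right; exists i].
by apply: sF; rewrite inE si orbT.
Qed.

Lemma card_le_infinite T U (A : set T) (B : set U) :
  infinite_set A -> A #<= B -> infinite_set B.
Proof. by move=> infA AB finB; apply: infA; exact: card_le_finite AB finB. Qed.

Section Coloured.
Context (V : eqType) (r : nat) (side : V -> bool) (clr : V -> V -> 'I_r).
Hypothesis clrC : forall u v, clr u v = clr v u.

(** * Skeletons *)

Definition adj (k : 'I_r) : rel V :=
  fun u v => (side u != side v) && (clr u v == k).

Lemma adjC k u v : adj k u v = adj k v u.
Proof. by rewrite /adj eq_sym clrC. Qed.

(** The existential [s] lets the same lemmas serve both orientations of the bipartition. *)
Definition opp (X R : set V) := exists s,
  (forall x, X x -> side x = s) /\ (forall y, R y -> side y = ~~ s).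

Lemma opp_sub X R X' R' : X' `<=` X -> R' `<=` R -> opp X R -> opp X' R'.
Proof. by move=> sX sR [s [h1 h2]]; exists s; split=> [x /sX|x /sR]; auto. Qed.

Lemma opp_disj X R v : opp X R -> X v -> ~ R v.
Proof. by move=> [s [h1 h2]] Xv Rv; have := h2 v Rv; rewrite h1 //; case: s {h1 h2}. Qed.

Lemma opp_adj X R x y : opp X R -> X x -> R y -> adj (clr x y) x y.
Proof.
move=> [s [h1 h2]] Xx Ry; rewrite /adj (h1 x Xx) (h2 y Ry) eqxx andbT.
by case: s {h1 h2}.
Qed.

Definition nbr k v : set V := [set u | adj k v u].

(* A skeleton: consecutive vertices of [X] need not be adjacent; these free steps
   are turned into short paths later. *)
Definition cstep k (X : set V) u v := X v /\ (X u \/ adj k u v).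
Definition clim k (X : set V) w v := ~ X v /\ adj k w v.

Definition skeleton k X Q lt :=
  gpath (cstep k X) (clim k X) Q lt /\ exists u, ismin Q lt u /\ X u.

(** With both ends in [X], closed skeletons can follow one another by free steps. *)
Definition cskel k X Q lt := skeleton k X Q lt /\ exists u, ismax Q lt u /\ X u.

Lemma skeleton_sub k (X X' Q : set V) lt : X' `<=` X ->
  (forall v, Q v -> X v -> X' v) -> skeleton k X' Q lt -> skeleton k X Q lt.
Proof.
move=> sX sQ [[woQ h] [u [mu Xu]]]; split; last by exists u; split=> //; apply: sX.
split=> // v Qv; case: (h v Qv) => [?|[w [pw [Xv st]]]|[ex lm]].
- by constructor 1.
- constructor 2; exists w; split=> //; split; first exact: sX.
  by case: st => [/sX|]; [left|right].
- constructor 3; split=> // w Qw wv; have [z [? ? ? [nX ?]]] := lm w Qw wv.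
  by exists z; split=> //; split=> // /(sQ v Qv).
Qed.

Lemma cskel_sub k (X X' Q : set V) lt : X' `<=` X ->
  (forall v, Q v -> X v -> X' v) -> cskel k X' Q lt -> cskel k X Q lt.
Proof.
by move=> sX sQ [sk [u [mu Xu]]]; split; [exact: skeleton_sub sk|exists u; split=> //; exact: sX].
Qed.

(** Each [w] of [W] is inserted right after its own vertex [h w] of [X]. The new steps join vertices
    of [X] and are therefore free. *)
Lemma cskel_add k (X Q W : set V) lt : cskel k X Q lt -> W `<=` X ->
  (forall x, W x -> ~ Q x) -> W #<= (Q `&` X) ->
  exists lt', cskel k X (Q `|` W) lt'.
Proof.
move=> [[gQ [q [minq Xq]]] [t [maxt Xt]]] WX WQ le.
have [h [hQ hinj]] := card_leE le q.
have /choice[l lP] u : exists s : seq V,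
    (s = [::] /\ forall w, W w -> h w <> u) \/ exists w, [/\ W w, h w = u & s = [:: w]].
  have [[w [Ww wu]]|no] := pselect (exists w, W w /\ h w = u).
    by exists [:: w]; right; exists w.
  by exists [::]; left; split=> // w Ww wu; apply: no; exists w.
have lW u x : x \in l u -> [/\ W x, h x = u & l u = [:: x]].
  by case: (lP u) => [[-> _]|[w [Ww wu ->]]] //; rewrite inE => /eqP->.
have lX u : X u -> X (last u (l u)).
  by case: (lP u) => [[-> _]|[w [Ww wu ->]]] //= _; apply: WX.
have [||||||lt' [g mn mx]] := @gpath_insert _ Q lt l _ _ (cstep k X) (clim k X) gQ.
- move=> u Qu; case: (lP u) => [[-> _]|[w [Ww wu ->]]] //=.
  by rewrite inE andbT; apply/eqP => e; apply: (WQ w Ww); rewrite -e.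
- move=> u Qu; case: (lP u) => [[-> _]|[w [Ww wu ->]]] //=; rewrite andbT.
  by apply/asboolP; split; [exact: WX|left; rewrite -wu; have [] := hQ w Ww].
- move=> u v Qv _ [Xv st]; split=> //.
  by case: (lP u) => [[-> _]|[w [Ww wu ->]]] //=; left; apply: WX.
- by move=> u v x Qu Qv /lW[_ <- _] /lW[_ <- _].
- by move=> u x Qu /lW[Wx _ _]; apply: WQ.
- by [].
exists lt'; rewrite (_ : Q `|` W = \bigcup_(u in Q) [set` u :: l u]).
  split; first by split=> //; exists q; split=> //; apply: mn.
  by exists (last t (l t)); split; [exact: mx|exact: lX].
apply/seteqP; split=> [x [Qx|Wx]|x [u Qu]].
- by exists x => //=; rewrite mem_head.
- have [Qh Xh] := hQ x Wx; exists (h x) => //=.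
  case: (lP (h x)) => [[_ /(_ x Wx)]|[w [Ww wx ->]]] //.
  by rewrite (hinj _ _ Ww Wx wx) !inE eqxx orbT.
by rewrite /= inE => /orP[/eqP->|/lW[]]; [left|right].
Qed.

Definition limitp I (N : set I) ltN n :=
  [/\ N n, exists j, N j /\ ltN j n & forall j, ~ ispred N ltN j n].

(** [Vn n] absorbs [W n] except for [a n], which becomes the entrance of block [n]. At a limit index
    the entrance is preceded by [b n], a limit vertex outside [X] that is joined to [a n] and has
    neighbours in cofinally many earlier [W j]. All other passages between blocks are free steps. *)
Lemma skeleton_assemble k (X : set V) I (i0 : I) (N : set I) ltN
    (W Vn : I -> set V) (ltV : I -> V -> V -> Prop) (a b : I -> V) :
  wo N ltN -> N !=set0 ->
  (forall n, N n -> [/\ W n `<=` X, W n (a n), cskel k X (Vn n) (ltV n) &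
     W n #<= (Vn n `&` X)]) ->
  (forall n m x, N n -> N m -> W n x -> W m x -> n = m) ->
  (forall n m x, N n -> N m -> Vn n x -> Vn m x -> n = m) ->
  (forall n m x, N n -> N m -> W n x -> ~ Vn m x) ->
  (forall n, limitp N ltN n -> [/\ ~ X (b n), adj k (b n) (a n) &
     forall j, N j -> ltN j n -> exists j' w,
       [/\ N j', ltN j j', ltN j' n, W j' w & adj k w (b n)]]) ->
  (forall n m, limitp N ltN n -> N m -> ~ Vn m (b n)) ->
  (forall n m, limitp N ltN n -> limitp N ltN m -> b n = b m -> n = m) ->
  exists Q lt, [/\ skeleton k X Q lt,
    (forall x, Q x <-> (exists2 n, N n & W n x \/ Vn n x) \/
       exists2 n, limitp N ltN n & x = b n) &
    forall n, ismax N ltN n -> cskel k X Q lt].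
Proof.
move=> woN N0 hN disW disV disWV hb bV binj; have [irr tr mn] := woN.
have /choice[Q2 /choice[lt2 hQ2]] n : exists Q2, exists lt2, N n ->
    cskel k X Q2 lt2 /\ Q2 = Vn n `|` (W n `\` [set a n]).
  have [Nn|nN] := pselect (N n); last by exists set0, (ltV n).
  have [WX Wa sk le] := hN n Nn.
  have [|||lt' sk'] := @cskel_add k X (Vn n) (W n `\` [set a n]) (ltV n) sk.
  - by move=> x [/WX].
  - by move=> x [Wx _]; apply: disWV Wx.
  - by apply: card_le_trans le; apply: subset_card_le => x [].
  by exists (Vn n `|` (W n `\` [set a n])), lt'.
(* The second coordinate orders each block: 0 for [b n] (limit indices only), 1 for [a n], 2 for the
   skeleton that absorbs the rest. *)
pose N2 := [set p : I * nat | N p.1 /\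
  [\/ p.2 = 0%N /\ limitp N ltN p.1, p.2 = 1%N | p.2 = 2]].
pose ltN2 := lexlt (@fst I nat) ltN (fun _ p q => (p.2 < q.2)%N).
pose P (p : I * nat) := if p.2 is 0%N then [set` [:: b p.1]] else
  if p.2 is 1%N then [set` [:: a p.1]] else Q2 p.1.
pose ltP (p : I * nat) := if p.2 is 0%N then ltidx [:: b p.1] else
  if p.2 is 1%N then ltidx [:: a p.1] else lt2 p.1.
have woN2 : wo N2 ltN2.
  apply: (wo_lex woN) => [p []//|i Ni].
  apply: (wo_pull wo_ltn (f := snd)) => //.
  by move=> [p1 p2] [q1 q2] /= [_ ->] [_ ->] ->.
have /choice[m hm] p : exists m, N2 p -> ismin (P p) (ltP p) m /\
    ((p.2 = 0%N -> m = b p.1) /\ (p.2 = 1%N -> m = a p.1) /\ (p.2 = 2 -> X m)).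
  have [Np|] := pselect (N2 p); last by exists (a p.1).
  case: p Np => n c [/= Nn [[-> _]|->|->]]; rewrite /P /ltP /=.
  - by exists (b n) => _; split=> //; have [] := @gpath_list V (cstep k X) (clim k X) (b n) [::] isT isT.
  - by exists (a n) => _; split=> //; have [] := @gpath_list V (cstep k X) (clim k X) (a n) [::] isT isT.
  - have [[[_ [u [mu Xu]]] _] _] := hQ2 n Nn.
    by exists u.
have PE p x : N2 p -> P p x ->
    [\/ [/\ p.2 = 0%N, limitp N ltN p.1 & x = b p.1],
        [/\ p.2 = 1%N, W p.1 x & x = a p.1],
        [/\ p.2 = 2, W p.1 x & x <> a p.1] |
        p.2 = 2 /\ Vn p.1 x].
  case: p => n c [/= Nn [[-> Ln]|->|->]]; rewrite /P /=.
  - by rewrite inE => /eqP->; constructor 1.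
  - rewrite inE => /eqP->; constructor 2; split=> //.
    by have [] := hN n Nn.
  - have [_ ->] := hQ2 n Nn.
    by case=> [|[]]; [constructor 4|constructor 3].
have bW n j x : limitp N ltN n -> N j -> W j x -> b n <> x.
  by move=> Ln Nj Wx e; have [nX _ _] := hb n Ln; apply: nX; rewrite e;
    have [WX _ _ _] := hN j Nj; apply: WX.
have dis p q x : N2 p -> N2 q -> P p x -> P q x -> p = q.
  case: p => n c; case: q => n' c' Np Nq; have [/= Nn _] := Np; have [/= Nn' _] := Nq.
  move=> /(PE _ _ Np)/= hx /(PE _ _ Nq)/= hx'.
  case: hx => [[-> Ln xE]|[-> Wx xE]|[-> Wx xE]|[-> Vx]];
  case: hx' => [[-> Ln' xE']|[-> Wx' xE']|[-> Wx' xE']|[-> Vx']].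
  + by rewrite (binj n n') // -xE.
  + by case: (bW _ _ _ Ln Nn' Wx').
  + by case: (bW _ _ _ Ln Nn' Wx').
  + by move: Vx'; rewrite xE => /(bV _ _ Ln Nn').
  + by case: (bW _ _ _ Ln' Nn Wx).
  + by rewrite (disW n n' x).
  + by have e := disW n n' x Nn Nn' Wx Wx'; subst n'.
  + by case: (disWV _ _ _ Nn Nn' Wx).
  + by case: (bW _ _ _ Ln' Nn Wx).
  + by have e := disW n n' x Nn Nn' Wx Wx'; subst n'.
  + by rewrite (disW n n' x).
  + by case: (disWV _ _ _ Nn Nn' Wx).
  + by move: Vx; rewrite xE' => /(bV _ _ Ln' Nn).
  + by case: (disWV _ _ _ Nn' Nn Wx').
  + by case: (disWV _ _ _ Nn' Nn Wx').
  + by rewrite (disV n n' x).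
have N21 n : N n -> N2 (n, 1%N) by move=> Nn; split=> //; constructor 2.
have N22 n : N n -> N2 (n, 2%N) by move=> Nn; split=> //; constructor 3.
have [|||lt [g minQ maxQ]] := @gpath_sum V _ (i0, 0) N2 ltN2 P ltP m
    (cstep k X) (clim k X) woN2 _ _ dis.
- move=> [n c] [/= Nn [[-> Ln]|->|->]]; rewrite /P /ltP /=.
  + by have [] := @gpath_list V (cstep k X) (clim k X) (b n) [::] isT isT.
  + by have [] := @gpath_list V (cstep k X) (clim k X) (a n) [::] isT isT.
  + by have [[[? _] _] _] := hQ2 n Nn.
- by move=> p Np; have [] := hm p Np.
- move=> [n c] Np; have [_ [m0 [m1 m2]]] := hm _ Np.
  case: (Np) => /= Nn [[e Ln]|e|e]; subst c.
  + constructor 3; have [_ [j0 [Nj0 j0n]] _] := Ln; have [nX _ lm] := hb n Ln.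
    split; first by exists (j0, 1%N); split; [exact: N21|left].
    move=> [j d] [/= Nj _] [/= jn|[_]//].
    have [j' [w [Nj' jj' j'n Ww aw]]] := lm j Nj jn; rewrite m0 //.
    have [wa|wa] := pselect (w = a j').
      exists (j', 1%N), w; split; [exact: N21|by left|by left| |by split].
      by rewrite /P /= inE; apply/eqP.
    exists (j', 2), w; split; [exact: N22|by left|by left| |by split].
    by rewrite /P /=; have [_ ->] := hQ2 j' Nj'; right; split.
  + rewrite m1 //; have [WX Wa _ _] := hN n Nn; have Xa := WX _ Wa.
    have [Ln|nLn] := pselect (limitp N ltN n).
      constructor 2; exists (n, 0%N); split.
        split; [by split=> //; constructor 1|by right|].
        move=> [j d] [/= Nj _] [/= nj|[/= e d0]] [/= jn|[/= e' d1]].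
        - exact: (wo_asym woN Nn Nj nj jn).
        - by subst j; apply: (irr n Nn).
        - by subst j; apply: (irr n Nn).
        - by move: (leq_trans d0 d1); rewrite ltnn.
      exists (b n); split; last by split=> //; right; have [] := hb n Ln.
      by have [] := @gpath_list V (cstep k X) (clim k X) (b n) [::] isT isT.
    have [nmin|/existsNP[j0 /not_implyP[Nj0 /contrapT j0n]]] :=
        pselect (forall j, N j -> ~ ltN j n).
      constructor 1 => -[j d] [/= Nj hd] [/= jn|[/= e d1]]; first exact: nmin jn.
      by subst j; case: hd => [[_ //]|e|e]; move: d1; rewrite e.
    have [n' pn'] : exists n', ispred N ltN n' n.
      by apply: contrapT => no; apply: nLn; split=> // [|j pj]; [exists j0|apply: no; exists j].
    have [Nn' n'n nbt] := pn'.
    constructor 2; exists (n', 2); split.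
      split; [exact: N22|by left|].
      move=> [j d] [/= Nj hd] [/= nj|[/= e d0]] [/= jn|[/= e' d1]].
      - exact: nbt jn.
      - by subst j; case: hd => [[_ //]|e|e]; move: d1; rewrite e.
      - by subst j; case: hd => [[e _]|e|e]; move: d0; rewrite e.
      - by subst j; subst n'; apply: (irr n Nn).
    have [[_ [u [mu Xu]]] _] := hQ2 n' Nn'.
    by exists u; split=> //; split=> //; left.
  + constructor 2; exists (n, 1%N); split.
      split; [exact: N21|by right|].
      move=> [j d] [/= Nj _] [/= nj|[/= e d0]] [/= jn|[/= e' d1]].
      - exact: (wo_asym woN Nn Nj nj jn).
      - by subst j; apply: (irr n Nn).
      - by subst j; apply: (irr n Nn).
      - by move: (leq_trans d0 d1); rewrite ltnn.
    have [WX Wa _ _] := hN n Nn; exists (a n); split.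
      by have [] := @gpath_list V (cstep k X) (clim k X) (a n) [::] isT isT.
    by split; [exact: m2|left; exact: WX].
have [n0 mn0] : exists n0, ismin N ltN n0.
  have [//|n0 [Nn0 h]] := mn N _ N0; exists n0; split=> // u Nu un0.
  case: (h u Nu) => [e|n0u]; first by rewrite e in un0; exact: (irr n0 Nn0 un0).
  exact: (wo_asym woN Nu Nn0 un0 n0u).
have [Nn0 nl0] := mn0; have [WX0 Wa0 _ _] := hN n0 Nn0.
have sk : skeleton k X (\bigcup_(i in N2) P i) lt.
  split=> //; exists (a n0); split; last exact: WX0.
  apply: (minQ (n0, 1%N)).
    split; first exact: N21.
    move=> [j d] [/= Nj hd] [/= jn|[/= e d1]]; first exact: nl0 jn.
    subst j; case: hd => [[_ [_ [j' [Nj' jn]] _]]|e|e]; first exact: nl0 jn.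
      by move: d1; rewrite e.
    by move: d1; rewrite e.
  by have [] := @gpath_list V (cstep k X) (clim k X) (a n0) [::] isT isT.
exists (\bigcup_(i in N2) P i), lt; split=> //.
- move=> x; split.
    move=> [p Np Px]; have [Npp _] := Np.
    case: (PE _ _ Np Px) => [[_ Ln ->]|[_ Wx _]|[_ Wx _]|[_ Vx]].
    + by right; exists p.1.
    + by left; exists p.1 => //; left.
    + by left; exists p.1 => //; left.
    + by left; exists p.1 => //; right.
  case=> [[n Nn h]|[n Ln ->]].
    have [xa|xa] := pselect (x = a n).
      by exists (n, 1%N); [exact: N21|rewrite /P /= inE; apply/eqP].
    exists (n, 2%N); first exact: N22.
    by rewrite /P /=; have [_ ->] := hQ2 n Nn; case: h => h; [right; split|left].
  exists (n, 0%N); last by rewrite /P /= inE.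
  by split; [have [] := Ln|constructor 1].
- move=> n [Nn mx]; have [[_ [u [mu Xu]]] _] := hQ2 n Nn.
  split=> //; exists u; split=> //; apply: (maxQ (n, 2)) => //.
  split; first exact: N22.
  move=> [j d] [/= Nj hd] [/= nj|[/= e d1]]; first exact: mx nj.
  by subst j; case: hd => [[e _]|e|e]; move: d1; rewrite e.
Qed.

(** * Rich colours *)

(* The intermediate set [S'] bounds the size of the skeletons independently of [D];
   this keeps small unions of such skeletons small when [K] is singular. *)
Definition rich (K : set V) k (X R : set V) := forall S : set V, small K S ->
  exists S' : set V, [/\ S #<= S', small K S' & forall D : set V, small K D ->
    exists Q lt, [/\ cskel k X Q lt, Q `<=` (X `|` R) `\` D,
      S' #<= (Q `&` X) & Q #<= S']].

Lemma rich_sub K k X R X' R' : X' `<=` X -> R' `<=` R -> opp X R ->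
  rich K k X' R' -> rich K k X R.
Proof.
move=> sX sR oXR h S sS; have [S' [SS' sS' hD]] := h S sS.
exists S'; split=> // D sD; have [Q [lt [sk QD S'Q QS']]] := hD D sD.
exists Q, lt; split=> //.
- apply: cskel_sub sk => // v /QD[[//|/sR Rv] _] Xv.
  by case: (opp_disj oXR Xv).
- by move=> v /QD[[/sX|/sR] ? ?]; split=> //; [left|right].
- by apply: card_le_trans S'Q (subset_card_le _) => v [Qv /sX].
Qed.

(** The failure of [rich] concerns every small [S'] above some [S k]. As there are finitely many
    colours, one [S0] lies above all of these, and the forbidden sets that belong to [S0] unite to
    one small [D0]. The vertex [v0] makes [S0] nonempty. *)
Lemma nonrich K (X R : set V) (v0 : V) : infinite_set K ->
  exists S0 D0 : set V, [/\ small K S0, S0 !=set0, small K D0 &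
    forall k, ~ rich K k X R -> ~ exists Q lt, [/\ cskel k X Q lt,
      Q `<=` (X `|` R) `\` D0, S0 #<= (Q `&` X) & Q #<= S0]].
Proof.
move=> infK.
have /choice[S hS] k : exists S : set V, small K S /\ (~ rich K k X R ->
    forall S' : set V, S #<= S' -> small K S' -> exists D : set V, small K D /\
    ~ exists Q lt, [/\ cskel k X Q lt, Q `<=` (X `|` R) `\` D,
      S' #<= (Q `&` X) & Q #<= S']).
  have [rk|/existsNP[S /not_implyP[sS nS]]] := pselect (rich K k X R).
    by exists set0; split=> //; apply: small_finite.
  exists S; split=> // _ S' SS' sS'; apply: contrapT => no; apply: nS.
  exists S'; split=> // D sD; apply: contrapT => nQ; apply: no.
  by exists D.
pose S0 := \bigcup_k S k `|` [set v0].
have sS0 : small K S0.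
  apply: smallU => //; last exact: small_finite.
  by apply: small_bigcup_fin => // k; have [] := hS k.
have /choice[D hD] k : exists D : set V, small K D /\ (~ rich K k X R ->
    ~ exists Q lt, [/\ cskel k X Q lt, Q `<=` (X `|` R) `\` D,
      S0 #<= (Q `&` X) & Q #<= S0]).
  have [rk|nr] := pselect (rich K k X R).
    by exists set0; split=> //; apply: small_finite.
  have [sS /(_ nr S0)[||D [sD nD]]] := hS k => //; last by exists D.
  by apply: subset_card_le => x Sx; left; exists k.
exists S0, (\bigcup_k D k); split=> //; first by exists v0; right.
  by apply: small_bigcup_fin => // k; have [] := hD k.
move=> k nr [Q [lt [sk QD S0Q QS0]]]; have [_ /(_ nr)] := hD k; apply.
exists Q, lt; split=> // v /QD[? nD]; split=> // Dv; apply: nD.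
by exists k.
Qed.

(** A block must avoid the union of the earlier blocks, which is known to be small only under a
    common bound. A least witness [sg S] of richness for every [S] provides one: the witness for the
    union of the earlier [Sd m] also serves each [Sd m], so it is at least as large as
    [sg (Sd m)]. *)
Lemma rich_blocks K k (X R : set V) I (N : set I) ltN (Sd : I -> set V)
    (D0 : set V) : infinite_set K -> rich K k X R -> wo N ltN -> small K D0 ->
  (forall n, N n -> [/\ small K (seg N ltN n), small K (Sd n) &
     small K (\bigcup_(m in seg N ltN n) Sd m)]) ->
  exists (Vn : I -> set V) (lt : I -> V -> V -> Prop),
    (forall n, N n -> [/\ cskel k X (Vn n) (lt n), Vn n `<=` (X `|` R) `\` D0,
      Sd n #<= (Vn n `&` X) & small K (Vn n)]) /\
    (forall n m x, N n -> N m -> Vn n x -> Vn m x -> n = m).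
Proof.
move=> infK rk woN sD0 hN.
pose G (S S' : set V) := [/\ S #<= S', small K S' & forall D : set V, small K D ->
    exists Q lt, [/\ cskel k X Q lt, Q `<=` (X `|` R) `\` D,
      S' #<= (Q `&` X) & Q #<= S']] : Prop.
have /choice[sg hsg] (S : set V) : exists S' : set V, small K S ->
    G S S' /\ forall S'', G S S'' -> S' #<= S''.
  have [sS|] := pselect (small K S); last by exists S.
  have [S1 G1] := rk S sS.
  have [[S' G'] mn] := @card_min {S' : set V | G S S'} V (fun s => sval s) (exist (G S) S1 G1).
  exists S' => _; split=> // S'' G''; exact: (mn (exist (G S) S'' G'')).
have [||f hf] := @wo_rec I (set V * (V -> V -> Prop))%type (set0, fun _ _ => False) N ltN
   (fun n f Q => [/\ cskel k X Q.1 Q.2, Q.1 `<=` (X `|` R) `\` D0,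
      Sd n #<= (Q.1 `&` X), Q.1 #<= sg (Sd n) &
      forall m x, N m -> ltN m n -> (f m).1 x -> ~ Q.1 x]) woN.
- move=> n f g Q Nn fg [? ? ? ? h]; split=> // m x Nm mn; rewrite -fg //.
  exact: h.
- move=> n f Nn ih; have [sseg sSn sU] := hN n Nn.
  pose tau := \bigcup_(m in seg N ltN n) Sd m.
  have [[tau1 stau h1] _] := hsg tau sU.
  have sD : small K (D0 `|` \bigcup_(m in seg N ltN n) (f m).1).
    apply: smallU => //; apply: (small_bigcup infK sseg stau) => m [Nm mn].
    have [_ _ _ le _] := ih m Nm mn; apply: card_le_trans le _.
    have [_ sSm _] := hN m Nm; have [_] := hsg (Sd m) sSm; apply.
    split=> //; apply: card_le_trans tau1; apply: subset_card_le => x Sx.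
    by exists m.
  have [[Sn1 sSn' h2] _] := hsg (Sd n) sSn.
  have [Q [lt [sk QD SQ QS]]] := h2 _ sD.
  exists (Q, lt); split=> //=.
  + by move=> v /QD[? nD]; split=> // Dv; apply: nD; left.
  + exact: card_le_trans Sn1 SQ.
  + by move=> m x Nm mn fx /QD[_ nD]; apply: nD; right; exists m.
exists (fun n => (f n).1), (fun n => (f n).2); split=> [n Nn|n m x Nn Nm Vx Vx'].
  have [? ? ? le _] := hf n Nn; split=> //.
  have [_ sSn _] := hN n Nn; have [[_ s _] _] := hsg _ sSn.
  exact: smallS le s.
have [nm|//|mn] := wo_total woN Nn Nm.
  by have [_ _ _ _ /(_ n x Nn nm Vx)] := hf m Nm.
by have [_ _ _ _ /(_ m x Nm mn Vx')] := hf n Nn.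
Qed.

(** * Long skeletons when one side is larger *)

Lemma adj_clr k u v : adj k u v -> clr u v = k.
Proof. by move=> /andP[_ /eqP]. Qed.

Lemma cskel_finite k (X : set V) : finite_set X -> X !=set0 ->
  exists lt, cskel k X X lt.
Proof.
move=> /finite_seqP[s0 Xs0] [x0 Xx0]; subst X; pose s := undup s0.
have sE : [set` s0] = [set` s].
  by apply/seteqP; split=> x /=; rewrite mem_undup.
rewrite sE in Xx0 *; have us : uniq s by exact: undup_uniq.
case: s us Xx0 {sE} => // x s us _.
have ps : path (stepb (cstep k [set` x :: s])) x s.
  have all y t : {subset y :: t <= x :: s} ->
      path (stepb (cstep k [set` x :: s])) y t.
    elim: t y => // z t ih y sub /=; apply/andP; split.
      apply/asboolP; split; first by apply: sub; rewrite !inE eqxx orbT.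
      by left; apply: sub; rewrite mem_head.
    by apply: ih => w wt; apply: sub; rewrite inE wt orbT.
  exact: all.
have [g mn mx] := gpath_list (clim k [set` x :: s]) us ps.
exists (ltidx (x :: s)); split.
  by split=> //; exists x; split=> //=; rewrite mem_head.
by exists (last x s); split=> //=; exact: mem_last.
Qed.

(** Induction on the size of [X], which also takes the role of [K]. If more than |X| vertices of [R]
    had fewer than |X| rich edges, the induction would give a skeleton in a poor colour. Hence a
    rich [k] joins more than |X| vertices of [R] to |X| vertices of [X] each. A typical one, [ys],
    dictates the order of the blocks: every limit that it forms is formed by more than |X| vertices,
    enough to give each limit position its own. *)
Lemma cskel_exists (X R : set V) (J : set 'I_r) : opp X R -> X !=set0 ->
  R #!<= X -> (forall x y, X x -> R y -> J (clr x y)) ->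
  exists k Q lt, [/\ J k, cskel k X Q lt, Q `<=` X `|` R, X #<= (Q `&` X) &
    Q #<= X].
Proof.
elim/card_ind: X R J => X ih R J oXR X0 bR colJ.
have [v0 Xv0] := X0.
have [finX|infX] := pselect (finite_set X).
  have [lt sk] := cskel_finite (clr v0 v0) finX X0.
  have [y Ry] : R !=set0.
    by apply/set0P/eqP => R0; apply: bR; rewrite R0; exact: card_ge0.
  have {sk}[lt' sk] := cskel_finite (clr v0 y) finX X0.
  exists (clr v0 y), X, lt'; split=> //; first exact: colJ.
  by rewrite setIid; exact: card_lexx.
have bigR (A : set V) (B : set V) : A #!<= X -> small X B -> (A `\` B) #!<= X.
  move=> bA sB le; apply: bA.
  have /card_le_trans : A #<= ((A `\` B) `|` B).
    apply: subset_card_le => x Ax; have [|] := pselect (B x); first by right.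
    by left.
  by apply; apply: card_leU => //; exact: small_le.
(* By minimality, no big subpair loses a rich colour. *)
pose ok (p : set V * set V) := [/\ p.1 `<=` X, p.2 `<=` R, X #<= p.1 & p.2 #!<= X].
have [[X' R'] [[/= sX' sR' bX' bR'] hmin]] := @min_measure _ ok
  (fun p => #|[pred k | `[< rich X k p.1 p.2 >]]|)
  (ex_intro _ (X, R) (And4 (@subset_refl _ X) (@subset_refl _ R) (card_lexx X) bR)).
have oXR' : opp X' R' by apply: opp_sub oXR.
have her X'' R'' k : X'' `<=` X' -> R'' `<=` R' -> X #<= X'' -> R'' #!<= X ->
    rich X k X' R' -> rich X k X'' R''.
  move=> sX'' sR'' bX'' bR''.
  apply: (@pred_card_eq _ (fun k => rich X k X'' R'') (fun k => rich X k X' R')).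
    by move=> k'; apply: rich_sub.
  apply: (hmin (X'', R'')); split=> //; [exact: subset_trans sX'|exact: subset_trans sR'].
have [S0 [D0 [sS0 [s0 Ss0] sD0 nr]]] := nonrich X' R' v0 infX.
have bX'D : X #<= (X' `\` D0) by apply: contrapT; apply: smallD => //; exact.
have [X0' [X1 [sX0 sX1 bX0 bX1 X01]]] := split_big infX bX'D.
have bR'D := bigR _ _ bR' sD0.
have infR : infinite_set (R' `\` D0).
  move=> fin; apply: bR'D; apply: card_le_trans ((infiniteP X).1 infX).
  exact: finite_set_countable.
have [R0 [R1 [sR0 sR1 bR0 bR1 R01]]] := split_big infR (card_lexx _).
have {}bR0 : R0 #!<= X by move=> /(card_le_trans bR0).
have {}bR1 : R1 #!<= X by move=> /(card_le_trans bR1).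
have sX0' : X0' `<=` X' by move=> x /sX0[].
have sX1' : X1 `<=` X' by move=> x /sX1[].
have sR0' : R0 `<=` R' by move=> x /sR0[].
have sR1' : R1 `<=` R' by move=> x /sR1[].
have XR0 x : X x -> R0 x -> False by move=> Xx /sR0'/sR'; apply: opp_disj oXR Xx.
have XR1 x : X x -> R1 x -> False by move=> Xx /sR1'/sR'; apply: opp_disj oXR Xx.
pose Jr k := rich X k X' R'.
pose good y := X #<= [set x | X0' x /\ Jr (clr x y)].
(* Otherwise place |X| disjoint copies of [S0] into [X0']. A bad [y] sends no rich edge to some
   copy, and for more than |X| bad vertices it is the same copy [C]. The induction on [C] yields a
   skeleton in a poor colour that [nr] forbids. *)
have bad_small : [set y | R0 y /\ ~ good y] #<= X.
  apply: contrapT => bad.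
  have /card_leE/(_ v0)[h [hX hinj]] : (X `*` S0) #<= X0'.
    by apply: card_le_trans bX0; apply: card_leX_inf => //; apply: small_le.
  have /choice[c hc] y : exists i, R0 y /\ ~ good y ->
      X i /\ forall s, S0 s -> ~ Jr (clr (h (i, s)) y).
    have [[Ry ngy]|] := pselect (R0 y /\ ~ good y); last by exists v0.
    apply: contrapT => no; apply: ngy.
    have /choice[g hg] i : exists s, X i -> S0 s /\ Jr (clr (h (i, s)) y).
      have [Xi|] := pselect (X i); last by exists v0.
      apply: contrapT => no'; apply: no; exists i => _; split=> // s Ss js.
      by apply: no'; exists s.
    apply: (card_leI (f := fun i => h (i, g i))) => [i Xi|i j Xi Xj].
      by have [Sg Jg] := hg i Xi; split=> //; apply: hX.
    have [Sg _] := hg i Xi; have [Sg' _] := hg j Xj.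
    by move=> /(hinj (i, g i) (j, g j) (conj Xi Sg) (conj Xj Sg')) [].
  have [||p [Xp bp]] := @pigeonhole_le _ _ _ [set y | R0 y /\ ~ good y] c X X.
  - by move=> y /hc[].
  - by move=> le; apply: bad; apply: card_le_trans le (infinite_square infX).
  pose C := [set h (p, s) | s in S0].
  have CX0 : C `<=` X0' by move=> _ [s Ss <-]; apply: hX.
  have CS : C #<= S0 by exact: card_image_le.
  have SC : S0 #<= C.
    apply: (card_leI (f := fun s => h (p, s))) => [s Ss|s t Ss St]; first by exists s.
    by move=> /(hinj (p, s) (p, t) (conj Xp Ss) (conj Xp St)) [].
  have CX : X #!<= C by move=> /card_le_trans/(_ CS); exact: sS0.
  have CleX : C #<= X by apply: card_le_trans CS (small_le sS0).
  have [||||k [Q [lt [nJ sk QC CQ QS]]]] := ih C CX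
      [set x | [set y | R0 y /\ ~ good y] x /\ c x = p] (fun k => ~ Jr k).
  - apply: opp_sub oXR' => [x /CX0/sX0' //|y [[/sR0' //]]].
  - by exists (h (p, s0)), s0.
  - by move=> /card_le_trans/(_ CleX).
  - move=> _ y [s Ss <-] [hy cy]; have [_] := hc y hy; rewrite cy; exact.
  apply: (nr k nJ); exists Q, lt; split.
  - apply: cskel_sub sk => [x /CX0/sX0'//|x /QC[//|[[Rx _] _]] Xx].
    by case: (XR0 x (sX' _ Xx) Rx).
  - move=> x /QC[/CX0/sX0[? ?]|[[/sR0[? ?] _] _]]; first by split=> //; left.
    by split=> //; right.
  - apply: card_le_trans SC (card_le_trans CQ (subset_card_le _)) => x [Qx /CX0/sX0'].
    by split.
  - exact: card_le_trans QS CS.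
have good_big : [set y | R0 y /\ good y] #!<= X.
  move=> le; apply: bR0.
  have sub : R0 `<=` [set y | R0 y /\ good y] `|` [set y | R0 y /\ ~ good y].
    by move=> y Ry; have [g|g] := pselect (good y); [left|right].
  by apply: card_le_trans (subset_card_le sub) _; apply: card_leU.
have /choice[kc hkc] y : exists k, R0 y /\ good y ->
    Jr k /\ X #<= [set x | X0' x /\ clr x y = k].
  have [[Ry gy]|] := pselect (R0 y /\ good y); last by exists (clr v0 v0).
  have [|k hk] := card_le_fin infX _ gy (F := fun k => [set x | [/\ X0' x, Jr k & clr x y = k]]).
    by move=> x [X0x Jx]; exists (clr x y).
  exists k => _; split.
    have [x [//]] : [set x | [/\ X0' x, Jr k & clr x y = k]] !=set0.
    by apply/set0P/eqP => e; move: hk; rewrite e => /card_le0P e0; move: Xv0; rewrite e0.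
  by apply: card_le_trans hk _; apply: subset_card_le => x [].
have [||k [_ bR3]] := @pigeonhole_le _ _ _ [set y | R0 y /\ good y] kc [set: 'I_r] X.
- by [].
- move=> le; apply: good_big; apply: card_le_trans le _; apply: card_leX_inf => //.
  apply: card_le_trans ((infiniteP X).1 infX); apply: finite_set_countable.
  exact: finite_finset.
pose R3 := [set y | [set y | R0 y /\ good y] y /\ kc y = k].
have R3R0 y : R3 y -> R0 y by move=> [[]].
have adjE x y : X x -> R0 y -> clr x y = k -> adj k x y.
  by move=> Xx Ry <-; apply: (opp_adj oXR) => //; apply/sR'/sR0'.
have R3P y : R3 y -> Jr k /\ X #<= [set x | X0' x /\ adj k x y].
  move=> [hy ky]; have [Jk le] := hkc y hy; rewrite ky in Jk le; split=> //.
  apply: card_le_trans le (subset_card_le _) => x [X0x ex]; split=> //.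
  by apply: adjE => //; [apply/sX'/sX0'|case: hy].
have [lt [woX0 inX0]] := wo_initial X0'; have [irr tr mn] := woX0.
have sseg x : X0' x -> small X (seg X0' lt x).
  move=> X0x le; apply: (inX0 x X0x).
  by apply: card_le_trans (subset_card_le (subset_trans sX0' sX')) le.
have unbounded (N : set V) u : N `<=` X0' -> X #<= N -> X0' u ->
    exists w, N w /\ lt u w.
  move=> NX bN X0u; apply: contrapT => no.
  have : small X (seg X0' lt u `|` [set u]).
    by apply: smallU => //; [exact: sseg|exact: small_finite].
  apply; apply: card_le_trans bN (subset_card_le _) => w Nw.
  have [wu|->|uw] := wo_total woX0 (NX w Nw) X0u; [left; split=> //; exact: NX|by right|].
  by case: no; exists w.
pose below (g : option V) w := if g is Some g' then lt w g' else True.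
(* The vertices that can stand just before [n] as a limit of vertices below [g]; [None] stands for
   the end of [X0']. *)
pose E g n := [set y | [/\ R3 y, adj k n y & forall u, X0' u -> below g u ->
  exists w, [/\ X0' w, lt u w, below g w & adj k w y]]].
pose idx := [set p : option V * V | [/\ if p.1 is Some g then X0' g else True,
  X0' p.2 & E p.1 p.2 #<= X]].
have X0leX : X0' #<= X by apply: subset_card_le; apply: subset_trans sX'.
have optle (N : set V) : N #<= X -> [set i | if i is Some n then N n else True] #<= X.
  move=> leN.
  have : (some @` N `|` [set None]) #<= X.
    apply: card_leU => //; first exact: card_le_trans (card_image_le _ _) leN.
    by apply: small_le; apply: small_finite.
  apply: card_le_trans; apply: subset_card_le => -[n|] //= Nn; last by right.
  by left; exists n.
have exc : \bigcup_(p in idx) E p.1 p.2 #<= X.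
  apply: card_bigcup_le => // [|p []//].
  have : ([set i | if i is Some n then X0' n else True] `*` X0') #<= X.
    by apply: card_leX_inf => //; apply: optle.
  by apply: card_le_trans; apply: subset_card_le => p [? ? ?]; split.
(* The sets [E g n] of size at most |X| have at most |X| vertices together, so some [ys] avoids them
   all: whenever [ys] lies in [E g n], so do more than |X| vertices. *)
have [ys [R3ys nexc]] : exists y, R3 y /\ ~ (\bigcup_(p in idx) E p.1 p.2) y.
  apply: contrapT => no; apply: bR3; apply: card_le_trans exc.
  apply: subset_card_le => y R3y; apply: contrapT => ne; apply: no.
  by exists y.
have Ebig g n : (if g is Some g' then X0' g' else True) -> X0' n -> E g n ys ->
    E g n #!<= X.
  by move=> Xg X0n Ey le; apply: nexc; exists (g, n).
have [Jk bN] := R3P ys R3ys.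
pose N := [set x | X0' x /\ adj k x ys].
have NX0 : N `<=` X0' by move=> x [].
have [|n0 [Nn0 mn0]] := mn N NX0.
  by apply/set0P/eqP => e; move: bN; rewrite -/N e => /card_le0P e0; move: Xv0; rewrite e0.
pose N' := N `\ n0.
have N'X0 : N' `<=` X0' by move=> x [/NX0].
have bN' : X #<= N'.
  by apply: contrapT; apply: smallD; [by []|exact|exact: small_finite].
have n0lt n : N' n -> lt n0 n by move=> [Nn ne]; case: (mn0 n Nn).
have X0n0 : X0' n0 := NX0 _ Nn0.
have woN' : wo N' lt by apply: wo_sub woX0.
have N'unb := unbounded N' _ N'X0 bN'.
(* The least neighbour [n0] of [ys] is reserved for the last index [None], so that there is a last
   block and the skeleton is closed. *)
pose NI := [set i | if i is Some n then N' n else True].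
have woNI : wo NI (ltopt lt) by exact: wo_opt.
(* Block [n] is the interval of [X0'] after all earlier members of [N'] and up to [n]. The blocks
   must cover everything after [n0], because the limit vertices chosen later may have their
   neighbours outside [N]. *)
pose W i := if i is Some n then [set x | [/\ X0' x, lt n0 x, x = n \/ lt x n &
  forall m, N' m -> lt m n -> lt m x]] else [set n0].
pose a i := odflt n0 i.
have WX0 i : NI i -> W i `<=` X0' by case: i => [n|] _ x; [case|move=> ->].
have Wa i : NI i -> W i (a i).
  by case: i => [n|] //= N'n; split; [exact: N'X0|exact: n0lt|left|].
have blockof w : X0' w -> lt n0 w -> exists n, [/\ N' n, W (Some n) w &
    forall m, N' m -> w = m \/ lt w m -> n = m \/ lt n m].
  move=> X0w n0w; have [_ _ mn'] := woN'.
  have [||n [[N'n wn] nP]] := mn' [set m | N' m /\ (w = m \/ lt w m)].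
  - by move=> ? [].
  - by have [m [N'm wm]] := N'unb w X0w; exists m; split=> //; right.
  exists n; split=> //; last first.
    by move=> m N'm wm; case: (nP m (conj N'm wm)) => [->|]; [left|right].
  split=> // m N'm mn''.
  have [//|e|wm] := wo_total woX0 (N'X0 _ N'm) X0w.
    have [e'|nm] := nP m (conj N'm (or_introl (esym e))).
      by rewrite e' in mn''; case: (irr n (N'X0 _ N'n)).
    by case: (wo_asym woN' N'm N'n mn'' nm).
  have [e'|nm] := nP m (conj N'm (or_intror wm)).
    by rewrite e' in mn''; case: (irr n (N'X0 _ N'n)).
  by case: (wo_asym woN' N'm N'n mn'' nm).
have disW i j x : NI i -> NI j -> W i x -> W j x -> i = j.
  move: i j => [n|] [m|] //= N'n N'm.
  - move=> [X0x _ xn hn] [_ _ xm hm].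
    have [nm|->//|mn'] := wo_total woN' N'n N'm.
    + have nx := hm n N'n nm; case: xn => [e|xn].
        by subst x; case: (irr n X0x).
      by case: (wo_asym woX0 X0x (N'X0 _ N'n) xn nx).
    + have mx := hn m N'm mn'; case: xm => [e|xm].
        by subst x; case: (irr m X0x).
      by case: (wo_asym woX0 X0x (N'X0 _ N'm) xm mx).
  - by move=> [X0x n0x _ _] e; subst x; case: (irr n0 X0x).
  - by move=> e [X0x n0x _ _]; subst x; case: (irr n0 X0x).
(* A limit at [n] is to be formed below the least strict bound of the members of [N'] before [n];
   everything there after [n0] belongs to earlier blocks. *)
have /choice[lub hlub] n : exists g, N' n -> [/\ X0' g, forall m, N' m -> lt m n -> lt m g &
    forall u, X0' u -> lt u g -> exists m, [/\ N' m, lt m n & ~ lt m u]].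
  have [N'n|] := pselect (N' n); last by exists n0.
  have [||g [[X0g gP] gm]] := mn [set x | X0' x /\ forall m, N' m -> lt m n -> lt m x].
  - by move=> ? [].
  - by exists n; split=> //; exact: N'X0.
  exists g => _; split=> // u X0u ug; apply: contrapT => no.
  have [|e|gu] := gm u; first split=> // m N'm mn'.
  - by apply: contrapT => nmu; apply: no; exists m.
  - by subst u; case: (irr g X0g).
  - by case: (wo_asym woX0 X0u X0g ug gu).
pose gam i := if i is Some n then Some (lub n) else None.
have gamX i : NI i -> if gam i is Some g' then X0' g' else True.
  by case: i => [n|] //= N'n; have [] := hlub n N'n.
have Eys i : limitp NI (ltopt lt) i -> E (gam i) (a i) ys.
  case: i => [n|] [Ni _ nop] /=.
    have [_ hl1 hl2] := hlub n Ni; split=> //; first by have [[_]] := Ni.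
    move=> u X0u ug; have [m [N'm mn' nmu]] := hl2 u X0u ug.
    have [w [N'w mw wn]] : exists w, [/\ N' w, lt m w & lt w n].
      apply: contrapT => no; apply: (nop (Some m)); split=> // -[w|] N'w mw wn //.
      by apply: no; exists w.
    exists w; split; [exact: N'X0| |exact: hl1|by have [[_]] := N'w].
    have [//|e|um] := wo_total woX0 (N'X0 _ N'm) X0u; first by subst u.
    by apply: (tr u m w) => //; exact: N'X0.
  split=> //; first by have [] := Nn0.
  move=> u X0u _; have [w [[X0w aw] uw]] := unbounded N u NX0 bN X0u.
  by exists w.
pose LN := [set i | limitp NI (ltopt lt) i].
have [i LNi|b [bE binj]] := @inj_choice _ _ n0 LN (ltopt lt) (fun i => E (gam i) (a i))
    (wo_sub (fun i => fun h : LN i => let: And3 p _ _ := h in p) woNI).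
  have [Ni _ _] := LNi; move=> le; apply: (Ebig (gam i) (a i)).
  - exact: gamX.
  - by apply: WX0 (Wa _ Ni).
  - exact: Eys.
  - apply: card_le_trans le _; apply: card_le_trans (optle N' _).
      by apply: subset_card_le => j [[]].
    by apply: card_le_trans (subset_card_le N'X0) X0leX.
(* [X1] and [R1] were split off to supply the absorbing skeletons; by the minimal choice [k] is
   still rich there. *)
have rk1 : rich X k X1 R1 by apply: her Jk.
have [St [_ sSt hSt]] := rk1 [set n0] (small_finite infX (finite_set1 _)).
have [] := rk1 [set n0] (small_finite infX (finite_set1 n0)).
move=> S1 [S1le sS1 /(_ set0 (small_finite infX (finite_set0 _)))].
move=> [VN [ltVN [skVN VNsub S1VN VNS1]]].
have sVN : small X VN by exact: smallS VNS1 sS1.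
have Wseg n : N' n -> W (Some n) `<=` seg X0' lt n `|` [set n].
  by move=> N'n x [X0x _ [->|xn] _]; [right|left].
have [n N'n|Vb [ltVb [hVb disVb]]] := rich_blocks (Sd := fun n => W (Some n))
    infX rk1 woN' sVN.
  have sn : small X (seg X0' lt n) by apply: sseg; exact: N'X0.
  have sn' : small X (seg X0' lt n `|` [set n]).
    by apply: smallU => //; exact: small_finite.
  split.
  - by apply: sub_small sn => x [/N'X0].
  - by apply: sub_small sn'; exact: Wseg.
  - apply: sub_small sn => x [m [N'm mn'] [X0x _ xm _]]; split=> //.
    by case: xm => [->//|xm]; apply: (tr x m n) => //; exact: N'X0.
pose Vn i := if i is Some n then Vb n else VN.
pose ltV i := if i is Some n then ltVb n else ltVN.
have hVn i : NI i -> [/\ cskel k X1 (Vn i) (ltV i), Vn i `<=` X1 `|` R1,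
    W i #<= (Vn i `&` X1) & small X (Vn i)].
  case: i => [n|] /= Ni.
    by have [? sub ? ?] := hVb n Ni; split=> // x /sub[].
  split=> //; first by move=> x /VNsub[].
  exact: card_le_trans S1le S1VN.
have [i Ni||i j x Ni Nj|i j x Ni Nj Wx Vx|i Li|i j Li Nj Vb'||Q [ltQ [skQ QE maxQ]]] :=
  skeleton_assemble (k := k) (X := X) (W := W)
    (Vn := Vn) (ltV := ltV) (a := a) (b := b) None woNI (ex_intro _ None I).
- have [sk sub WV _] := hVn i Ni; split.
  + by move=> x /(WX0 i Ni)/sX0'/sX'.
  + exact: Wa.
  + apply: cskel_sub sk => [x /sX1'/sX'//|x /sub[//|Rx] Xx].
    by case: (XR1 x Xx Rx).
  + by apply: card_le_trans WV (subset_card_le _) => x [Vx /sX1'/sX'].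
- exact: disW.
- have disVN n : N' n -> Vb n x -> VN x -> False.
    by move=> N'n Vx; have [_ /(_ x Vx)[_ nV] _ _] := hVb n N'n.
  move: i j Ni Nj => [n|] [m|] //= N'n N'm.
  + by move=> Vx Vx'; rewrite (disVb n m x).
  + by move=> Vx /(disVN n N'n Vx).
  + by move=> Vx Vx'; case: (disVN m N'm Vx' Vx).
- have [_ sub _ _] := hVn j Nj; have X0x := WX0 i Ni _ Wx.
  case: (sub x Vx) => [/(X01 x X0x)//|R1x].
  by apply: (XR1 x) => //; apply/sX'/sX0'.
- have [Ni _ nop] := Li; have [R3b ab hb] := bE i Li; split.
  + by move=> Xb; apply: (XR0 (b i)) => //; exact: R3R0.
  + by rewrite adjC.
  + move=> j Nj ji.
    case: j Nj ji => [m|] //= N'm mi.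
    have gm : below (gam i) m.
      by case: i Li Ni nop R3b ab hb mi => [n|] //= Li N'n nop _ _ _ mn'; have [_ h _] := hlub n N'n; apply: h.
    have [w [X0w mw wg aw]] := hb m (N'X0 _ N'm) gm.
    have n0w : lt n0 w by apply: (tr n0 m w) => //; [exact: N'X0|exact: n0lt].
    have [n' [N'n' Ww n'min]] := blockof w X0w n0w.
    have [_ _ wn' _] := Ww.
    exists (Some n'), w; split=> //.
      by case: wn' => [<-//|wn']; apply: (tr m w n') => //; exact: N'X0.
    case: i {hb ab R3b nop gm aw} Li Ni mi wg => [n|] //= Li N'n mn' wg.
    have [_ _ h2] := hlub n N'n; have [m' [N'm' m'n nm'w]] := h2 w X0w wg.
    have [|e|n'm'] := n'min m' N'm'.
    * by have [|->|] := wo_total woX0 (N'X0 _ N'm') X0w; [|left|right].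
    * by rewrite e.
    * by apply: (tr n' m' n) => //; exact: N'X0.
- have [R3b _ _] := bE i Li; have R0b := R3R0 _ R3b.
  have [_ sub _ _] := hVn j Nj; case: (sub _ Vb') => [X1b|R1b].
    by apply: (XR0 (b i)) => //; apply/sX'/sX1'.
  exact: (R01 (b i)).
- exact: binj.
have maxN : ismax NI (ltopt lt) None by split=> // -[y|] _ [].
exists k, Q, ltQ; split.
- have [Nys _] := Nn0; have [_ ays] := Nn0.
  rewrite -(adj_clr ays); apply: colJ; [exact/sX'/sX0'|exact/sR'/sR0'/R3R0].
- exact: maxQ maxN.
- move=> x /QE[[i Ni [Wx|Vx]]|[i Li ->]].
  + by left; apply/sX'/sX0'/(WX0 i Ni).
  + have [_ sub _ _] := hVn i Ni; case: (sub x Vx) => [/sX1'/sX'|/sR1'/sR']; by [left|right].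
  + by right; apply/sR'/sR0'/R3R0; have [] := bE i Li.
- apply: card_le_trans bN' (subset_card_le _) => n N'n; split.
    by apply/QE; left; exists (Some n) => //; left; apply: (Wa (Some n)).
  exact/sX'/sX0'/N'X0.
- have NIX : NI #<= X.
    by apply: optle; apply: card_le_trans (subset_card_le N'X0) X0leX.
  have : (\bigcup_(i in NI) (W i `|` Vn i) `|` b @` LN) #<= X.
    apply: card_leU => //.
      apply: card_bigcup_le => // i Ni; have [_ _ _ sV] := hVn i Ni.
      apply: card_leU => //; last exact: small_le.
      exact: card_le_trans (subset_card_le (WX0 i Ni)) X0leX.
    apply: card_le_trans (card_image_le _ _) (card_le_trans (subset_card_le _) NIX).
    by move=> i [].
  apply: card_le_trans; apply: subset_card_le => x /QE[[i Ni h]|[i Li ->]].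
    by left; exists i.
  by right; exists i.
Qed.

(** * The core of a colour *)

Definition excluded (K : set V) k (X R : set V) :=
  forall x, X x -> small K (R `&` nbr k x).

(** The two sides may have equal size here, so limits come from [catch]: a small subset of [X0]
    meets the neighbourhoods of all but few vertices of [R0]. The recursion runs along the cofinal
    index set [M], where unions over initial segments of small sets stay small. *)
Lemma skeleton_big (K X R : set V) k : infinite_set K -> opp X R ->
  K #<= X -> K #<= R ->
  (forall X' R', X' `<=` X -> R' `<=` R -> K #<= X' -> K #<= R' ->
     rich K k X' R' /\ ~ excluded K k X' R') ->
  exists Q lt, [/\ skeleton k X Q lt, Q `<=` X `|` R & K #<= (Q `&` X)].
Proof.
move=> infK oXR bX bR her; have [k0 Kk0] := infinite_setN0 infK.
have [Xa [X1 [sXa sX1 bXa bX1 Xa1]]] := split_big infK bX.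
have [X0 [sX0a bX0 X0K]] := card_le_sub k0 bXa.
have sX0 : X0 `<=` X := subset_trans sX0a sXa.
have X01 x : X0 x -> ~ X1 x by move=> /sX0a; exact: Xa1.
have [R0 [R1 [sR0 sR1 bR0 bR1 R01]]] := split_big infK bR.
pose missed (W : set V) := [set y | R0 y /\ forall w, W w -> ~ adj k w y].
(* If this fails, choose distinct vertices [y x], each missed by everything before [x]. Then [x] can
   be adjacent to [y z] only for [z] up to [x], so [k] is excluded on a big subpair. *)
have catch (D : set V) : small K D ->
    exists W, [/\ W `<=` X0 `\` D, small K W & small K (missed W)].
  move=> sD; apply: contrapT => no.
  have bXD : K #<= (X0 `\` D) by apply: contrapT; apply: smallD => //; exact.
  have [lt [woX inX]] := wo_initial (X0 `\` D).
  have sseg x : (X0 `\` D) x -> small K (seg (X0 `\` D) lt x).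
    move=> Xx le; apply: (inX x Xx); apply: card_le_trans le.
    by apply: card_le_trans X0K; apply: subset_card_le => z [].
  have [x Xx|y [yE yinj]] := inj_choice k0 (E := fun x => missed (seg (X0 `\` D) lt x)) woX.
    move=> le; apply: no; exists (seg (X0 `\` D) lt x); split.
    - by move=> z [].
    - exact: sseg.
    - exact: smallS le (sseg x Xx).
  have [||||_] := her (X0 `\` D) (y @` (X0 `\` D)).
  - by move=> x [/sX0].
  - by move=> _ [x /yE[/sR0 ? _] <-].
  - exact: bXD.
  - by apply: card_le_trans bXD _; apply: (card_leI (f := y)) => // x Xx; exists x.
  apply => x Xx; apply: (@smallS _ K _ _ _ (seg (X0 `\` D) lt x `|` [set x])); last first.
    by apply: smallU => //; [exact: sseg|exact: small_finite].
  apply: card_le_trans (card_image_le y _); apply: subset_card_le => _ [[z Xz <-] axz].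
  exists z => //; have [_ hz] := yE z Xz.
  have [xz|->|zx] := wo_total woX Xx Xz; [|by right|by left].
  by case: (hz x).
have [M [S [lt [woM sS bS MK [inM regM]]]]] := cofinal_family infK.
have [f [fX finj]] := card_leE bX0 k0.
have [g [gS ginj]] := card_leE (big_card bS) k0.
(* The covering of a big set by the [S i] is carried over to [X0], so that the blocks together
   contain a big part of [X0]. *)
pose T i := f @` [set x | K x /\ S i (g x)].
have sT i : M i -> small K (T i).
  move=> Mi; apply: smallS (sS i Mi); apply: card_le_trans (card_image_le _ _) _.
  by apply: (card_leI (f := g)) => [x []//|x y [Kx _] [Ky _]]; apply: ginj.
have TX i : T i `<=` X0 by move=> _ [x [Kx _] <-]; apply: fX.
have bT : K #<= \bigcup_(i in M) T i.
  apply: (card_leI (f := f)) => // x Kx; have [i Mi Si] := gS x Kx.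
  by exists i => //; exists x.
have sseg i : M i -> small K (seg M lt i).
  by move=> Mi le; apply: (inM i Mi); apply: card_le_trans MK le.
have [|i h Mi ih|W hW] := @wo_rec V (set V) set0 M lt (fun i h W =>
    [/\ W `<=` X0, small K W, small K (missed W),
        forall j x, M j -> lt j i -> h j x -> ~ W x &
        T i `<=` W `|` \bigcup_(j in seg M lt i) h j]) woM.
- move=> i h h' W Mi hh' [? ? ? h1 h2]; split=> //.
    by move=> j x Mj ji; rewrite -hh' //; exact: h1.
  by move=> x /h2[|[j [Mj ji] hx]]; [left|right; exists j => //; rewrite -hh'].
- pose D := \bigcup_(j in seg M lt i) h j.
  have sD : small K D by apply: regM; [exact: inM|move=> j [Mj ji]; have [] := ih j Mj ji].
  have [W [WX sW mW]] := catch D sD; exists (W `|` (T i `\` D)); split.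
  + by move=> x [/WX[]|[/TX]].
  + by apply: smallU => //; apply: sub_small (sT i Mi) => x [].
  + by apply: sub_small mW => y [Ry hy]; split=> // w Ww; apply: hy; left.
  + by move=> j x Mj ji hx [/WX[_]|[_]]; apply; exists j.
  + by move=> x Tx; have [Dx|nDx] := pselect (D x); [right|left; right].
(* Vertices with a neighbour in every block up to [i]. Only few vertices of [R0] are lost, so a new
   one can be chosen for each [i]. *)
pose E i := [set y | R0 y /\ forall j, M j -> j = i \/ lt j i ->
  exists w, W j w /\ adj k w y].
have bE i : M i -> ~ small K (E i).
  move=> Mi sE.
  have sm : small K (\bigcup_(j in seg M lt i) missed (W j) `|` missed (W i)).
    apply: smallU => //; last by have [] := hW i Mi.
    by apply: regM; [exact: inM|move=> j [Mj _]; have [] := hW j Mj].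
  have : small K R0.
    apply: sub_small (smallU infK sE sm) => y Ry; apply: contrapT => no.
    apply: (no); left; split=> // j Mj ji; apply: contrapT => nw.
    have my : missed (W j) y by split=> // w Ww a; apply: nw; exists w.
    by apply: no; right; case: ji => [e|ji]; [subst j; right|left; exists j].
  exact.
have [i Mi le|b [bE' binj]] := inj_choice k0 (E := E) woM.
  by apply: (bE i Mi); exact: smallS le (sseg i Mi).
have /choice[a ha] i : exists w, M i -> W i w /\ adj k w (b i).
  have [Mi|] := pselect (M i); last by exists k0.
  by have [_ /(_ i Mi (or_introl erefl))[w]] := bE' i Mi; exists w.
have [rk1 _] := her X1 R1 sX1 sR1 bX1 bR1.
have [i Mi|Vn [ltV [hV disV]]] := rich_blocks (Sd := W) infK rk1 woM
    (small_finite infK (finite_set0 V)).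
  split; [exact: sseg|by have [] := hW i Mi|].
  by apply: regM; [exact: inM|move=> j [Mj _]; have [] := hW j Mj].
have M0 : M !=set0.
  by have [x [i Mi _]] := big_ex infK bS; exists i.
have disW i j x : M i -> M j -> W i x -> W j x -> i = j.
  move=> Mi Mj Wx Wx'; have [ij|//|ji] := wo_total woM Mi Mj.
    by have [_ _ _ /(_ i x Mi ij Wx)] := hW j Mj.
  by have [_ _ _ /(_ j x Mj ji Wx')] := hW i Mi.
have WX i : M i -> W i `<=` X0 by move=> /hW[].
have VX i x : M i -> Vn i x -> X1 x \/ R1 x by move=> Mi Vx; have [_ /(_ x Vx)[]] := hV i Mi.
have [i Mi|||i j x Mi Mj Wx Vx|i Li|i j Li Mj Vb||Q [ltQ [skQ QE _]]] :=
  skeleton_assemble (k := k) (X := X) (W := W)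
    (Vn := Vn) (ltV := ltV) (a := a) (b := b) k0 woM M0.
- have [sk sub WV _] := hV i Mi; split.
  + by move=> x /(WX i Mi)/sX0.
  + by have [] := ha i Mi.
  + apply: cskel_sub sk => // v /(VX i v Mi)[//|/sR1 Rv] Xv.
    by case: (opp_disj oXR Xv).
  + by apply: card_le_trans WV (subset_card_le _) => x [Vx /sX1].
- exact: disW.
- exact: disV.
- have X0x := WX i Mi x Wx; case: (VX j x Mj Vx) => [|/sR1]; first exact: X01.
  exact: opp_disj oXR (sX0 _ X0x).
- have [Mi _ nop] := Li; have [R0b hb] := bE' i Mi; have [_ ab] := ha i Mi; split.
  + by move=> Xb; apply: (opp_disj oXR Xb); exact: sR0.
  + by rewrite adjC.
  + move=> j Mj ji; have [j' [Mj' jj' j'i]] : exists j', [/\ M j', lt j j' & lt j' i].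
      apply: contrapT => no; apply: (nop j); split=> // w Mw jw wi.
      by apply: no; exists w.
    have [w [Ww aw]] := hb j' Mj' (or_intror j'i).
    by exists j', w.
- have [Mi _ _] := Li; have [R0b _] := bE' i Mi.
  case: (VX j _ Mj Vb) => [/sX1 Xb|]; last exact: R01.
  by apply: (opp_disj oXR Xb); exact: sR0.
- by move=> i j [Mi _ _] [Mj _ _]; exact: binj.
exists Q, ltQ; split=> //.
- move=> x /QE[[i Mi [/(WX i Mi)/sX0|/(VX i x Mi)[/sX1|/sR1]]]|[i [Mi _ _] ->]];
    [by left|by left|by right|].
  by right; apply: sR0; have [] := bE' i Mi.
apply: card_le_trans bT (subset_card_le _) => x [i Mi Tx]; split; last exact/sX0/(TX i).
apply/QE; left; have [_ _ _ _ /(_ x Tx)[Wx|[j [Mj _] Wx]]] := hW i Mi.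
  by exists i => //; left.
by exists j => //; left.
Qed.

(* As [U] has only big members, any two vertices of [X] have a big set of common
   neighbours. *)
Definition core (K : set V) k (X R : set V) (U : set_system V) :=
  [/\ UltraFilter U, forall A, U A -> K #<= A,
      forall x, X x -> U (R `&` nbr k x) &
      forall X' R', X' `<=` X -> R' `<=` R -> K #<= X' -> K #<= R' ->
        exists Q lt, [/\ skeleton k X' Q lt, Q `<=` X' `|` R' & K #<= (Q `&` X')]].

(** Take a maximal [Y] such that every finite part of it is joined by edges of rich colours to a big
    common set. If [Y] were small, the vertices outside it would yield a pair joined in poor colours
    only, against [nonrich]. So [Y] is big; the common sets generate a filter, and an ultrafilter
    above it selects a rich colour for each vertex of [Y]. *)
Lemma core_exists (K Z R : set V) : infinite_set K -> opp Z R ->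
  K #<= Z -> K #<= R ->
  exists k X R' U, [/\ X `<=` Z, R' `<=` R, K #<= X & core K k X R' U].
Proof.
move=> infK oZR bZ bR; have [k0 Kk0] := infinite_setN0 infK.
pose ok (p : set V * set V) := [/\ p.1 `<=` Z, p.2 `<=` R, K #<= p.1 & K #<= p.2].
(* Neither count can grow on a subpair, so a minimal sum makes both properties hereditary. *)
pose mes (p : set V * set V) := (#|[pred k | `[< ~ excluded K k p.1 p.2 >]]| +
  #|[pred k | `[< rich K k p.1 p.2 >]]|)%N.
have [[X R'] [[/= sX sR bX bR'] hmin]] := @min_measure _ ok mes
  (ex_intro _ (Z, R) (And4 (@subset_refl _ Z) (@subset_refl _ R) bZ bR)).
have oXR : opp X R' by apply: opp_sub oZR.
have her X' R'' : X' `<=` X -> R'' `<=` R' -> K #<= X' -> K #<= R'' -> forall k,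
    (rich K k X R' -> rich K k X' R'') /\ (~ excluded K k X R' -> ~ excluded K k X' R'').
  move=> sX' sR'' bX' bR'' k.
  have le := hmin (X', R'') (And4 (subset_trans sX' sX) (subset_trans sR'' sR) bX' bR'').
  have i1 j : rich K j X' R'' -> rich K j X R' by apply: rich_sub.
  have i2 j : ~ excluded K j X' R'' -> ~ excluded K j X R'.
    move=> ne e; apply: ne => x /sX' Xx; apply: sub_small (e x Xx) => y [/sR''].
    by split.
  have l1 := pred_card_le i1; have l2 := pred_card_le i2.
  split; [apply: (pred_card_eq i1)|apply: (pred_card_eq i2)].
    by move: le; rewrite /mes /= => le; rewrite -(leq_add2l #|[pred k | `[< ~ excluded K k X R' >]]|); apply: leq_trans le _; rewrite leq_add2r.
  by move: le; rewrite /mes /= => le; rewrite -(leq_add2r #|[pred k | `[< rich K k X R' >]]|); apply: leq_trans le _; rewrite leq_add2l.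
have [S0 [D0 [sS0 [s0 Ss0] sD0 nr]]] := nonrich X R' k0 infK.
pose J k := rich K k X R'.
pose NJ (s : seq V) := [set y | R' y /\ forall x, x \in s -> J (clr x y)].
pose P (Y : set V) := Y `<=` X /\ forall s : seq V, (forall x, x \in s -> Y x) -> K #<= NJ s.
have NJ0 : R' `<=` NJ [::] by move=> y Ry; split.
have [F FP Ftot|Y [[YX YP] Ymax]] := @Zorn_bigcup _ P.
  split=> [x [A FA Ax]|s hs]; first by have [h _] := FP A FA; apply: h.
  have [s0'|[A FA sA]] : s = [::] \/ exists2 A, F A & forall x, x \in s -> A x.
    elim: s hs => [|x s ih] hs; [by left|right].
    have [A FA Ax] := hs x (mem_head _ _).
    have [|->|[B FB sB]] := ih; first by move=> z zs; apply: hs; rewrite inE zs orbT.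
      by exists A => // z; rewrite inE => /eqP->.
    have [AB|BA] := Ftot A B FA FB.
      by exists B => // z; rewrite inE => /orP[/eqP->|/sB//]; exact: AB.
    by exists A => // z; rewrite inE => /orP[/eqP->//|/sB/BA].
  by rewrite s0'; apply: card_le_trans bR' (subset_card_le NJ0).
  by have [_ h] := FP A FA; apply: h.
have bY : K #<= Y.
  apply: contrapT => sY; pose V0 := X `\` (Y `|` D0).
  have bV0 : ~ small K V0.
    by apply: smallD => //; exact: smallU.
  have /choice[F hF] a : exists s : seq V, V0 a -> (forall x, x \in s -> Y x) /\
      small K [set y | NJ s y /\ J (clr a y)].
    have [[Xa nYD]|] := pselect (V0 a); last by exists [::].
    have nYa : ~ Y a by move=> Ya; apply: nYD; left.
    have : ~ P (Y `|` [set a]).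
      by apply: Ymax; split=> [x|]; [left|move=> /(_ a (or_intror erefl))].
    move=> /not_andP[[x [/YX//|->//]]|/existsNP[s /not_implyP[hs ns]]].
    exists [seq x <- s | x != a] => _; split.
      by move=> x; rewrite mem_filter => /andP[/eqP xa /hs[]].
    apply: sub_small ns => y [[Ry hy] Ja]; split=> // x xs.
    by have [->//|xa] := eqVneq x a; apply: hy; rewrite mem_filter xa.
  (* The pigeonhole needs the finite sets [f a] to come from a small family: the finite sequences in
     [Y] if [Y] is infinite, one list of all of [Y] if it is finite. *)
  have [f [D [sD fD DY fF]]] : exists (f : V -> seq V) (D : set (seq V)),
      [/\ small K D, forall a, V0 a -> D (f a), forall s x, D s -> x \in s -> Y x &
          forall a, V0 a -> small K [set y | NJ (f a) y /\ J (clr a y)]].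
    have [/finite_seqP[t Yt]|infY] := pselect (finite_set Y).
      exists (fun=> t), [set t]; split=> //; first exact: small_finite.
        by move=> s x -> ; rewrite Yt.
      move=> a Va; have [FY sF] := hF a Va; apply: sub_small sF => y [[Ry hy] Ja].
      by split=> //; split=> // x /FY; rewrite Yt; exact: hy.
    exists F, [set s : seq V | forall x, x \in s -> Y x]; split=> //.
    - exact: smallS (card_le_seq infY) sY.
    - by move=> a /hF[].
    - by move=> s x; apply.
    - by move=> a /hF[].
  have [s [C [Ds CV SC CS sE]]] := uniform_class infK bV0 sD sS0 fD fF.
  pose E := \bigcup_(a in C) [set y | NJ (f a) y /\ J (clr a y)].
  have bN : ~ small K (NJ s) by move=> h; apply/h/YP => x; exact: DY.
  have bR0 : ~ small K (NJ s `\` (E `|` D0)) by apply: smallD => //; exact: smallU.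
  have CX : C `<=` X by move=> x /CV[[]].
  (* Without the common exceptions [E] only poor colours remain between the small set [C] and a big
     set. *)
  have [k [Q [lt [nJ sk QC CQ QS]]]] : exists k Q lt, [/\ ~ J k, cskel k C Q lt,
      Q `<=` C `|` (NJ s `\` (E `|` D0)), C #<= (Q `&` C) & Q #<= C].
    apply: cskel_exists => [|||x y Cx [[Ry hy] nE] Jxy].
    - by apply: opp_sub oXR => // y [[]].
    - have [c0 [Sc _]] := card_leE SC k0; exists (c0 s0); exact: Sc.
    - move=> le; apply: bR0; exact: smallS (card_le_trans le CS) sS0.
    - apply: nE; left; exists x => //; split=> //.
      by have [_ ->] := CV x Cx.
  apply: (nr k nJ); exists Q, lt; split.
  - apply: cskel_sub sk => // x /QC[//|[[Rx _] _]] Xx.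
    by case: (opp_disj oXR Xx).
  - move=> x /QC[Cx|[[Rx _] nE]].
      by have [[Xx nD] _] := CV x Cx; split; [left|move=> D0x; apply: nD; right].
    by split; [right|move=> D0x; apply: nE; right].
  - by apply: card_le_trans SC (card_le_trans CQ (subset_card_le _)) => x [Qx /CX].
  - exact: card_le_trans QS CS.
(* Complements of small sets are put into the filter, so that the ultrafilter has only big
   members. *)
pose G (A : set V) := exists s D, [/\ forall x, x \in s -> Y x, small K D & NJ s `\` D `<=` A].
have bNJ s : (forall x, x \in s -> Y x) -> ~ small K (NJ s) by move=> /YP h; exact.
have PG : ProperFilter G.
  split.
    move=> [s [D [hs sD sub]]].
    by have [x /sub] := big_ex infK (smallD infK (bNJ s hs) sD).
  split.
  - exists [::], set0; split=> //; exact: small_finite.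
  - move=> A B [s [D [hs sD sub]]] [s' [D' [hs' sD' sub']]].
    exists (s ++ s'), (D `|` D'); split; first by move=> x; rewrite mem_cat => /orP[/hs|/hs'].
      exact: smallU.
    move=> x [[Rx hx] nD]; split.
      apply: sub; split; last by move=> Dx; apply: nD; left.
      by split=> // z zs; apply: hx; rewrite mem_cat zs.
    apply: sub'; split; last by move=> Dx; apply: nD; right.
    by split=> // z zs; apply: hx; rewrite mem_cat zs orbT.
  - by move=> A B AB [s [D [hs sD sub]]]; exists s, D; split=> // x /sub/AB.
have [U [ultraU GU]] := ultraFilterLemma PG.
have bU A : U A -> K #<= A.
  move=> UA; apply: contrapT => sA.
  have UnA : U (~` A).
    by apply: GU; exists [::], A; split=> // x [].
  have h : U (A `&` ~` A) by exact: filterI.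
  by move: h; rewrite setICr; exact: filter_not_empty.
have /choice[kc hkc] a : exists k, Y a -> J k /\ U [set y | R' y /\ clr a y = k].
  have [Ya|] := pselect (Y a); last by exists (clr k0 k0).
  have Ua : U (\bigcup_k [set y | [/\ J k, R' y & clr a y = k]]).
    apply: GU; exists [:: a], set0; split.
    - by move=> x; rewrite inE => /eqP->.
    - exact: small_finite.
    - move=> y [[Ry hy] _]; exists (clr a y) => //; split=> //.
      by apply: hy; rewrite mem_head.
  have [k Uk] := ultra_bigcup ultraU Ua; exists k => _; split.
    by have [y []] := big_ex infK (fun s => s (bU _ Uk)).
  by apply: filterS Uk => y [].
have [|k bXk] := card_le_fin infK _ bY (F := fun k => [set a | Y a /\ kc a = k]).
  by move=> a Ya; exists (kc a).
pose Xk := [set a | Y a /\ kc a = k].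
have UXk x : Xk x -> U (R' `&` nbr k x).
  move=> [Yx kx]; have [_] := hkc x Yx; rewrite kx; apply: filterS => y [Ry <-].
  by split=> //; exact: (opp_adj oXR (YX x Yx) Ry).
have [x0 Xx0] := big_ex infK (fun s => s bXk).
have Jk : J k by have [Yx <-] := Xx0; have [] := hkc x0 Yx.
exists k, Xk, R', U; split=> //; first by move=> x [/YX/sX].
split=> // X' R'' sX' sR'' bX' bR''; apply: skeleton_big => //.
  by apply: opp_sub oXR => // x /sX'[/YX].
move=> X'' R3 sX'' sR3 bX'' bR3.
have [||||h1 h2] := her X'' R3 _ _ _ _ k => //.
- by move=> x /sX''/sX'[/YX].
- exact: subset_trans sR''.
split; [exact: h1|apply: h2] => exc.
by apply: (exc x0); [have [/YX] := Xx0|exact: bU (UXk x0 Xx0)].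
Qed.

(** * Traceable sets *)

Lemma adj_neq k u v : adj k u v -> u <> v.
Proof. by move=> /andP[/eqP h _] e; apply: h; rewrite e. Qed.

Definition linked (K : set V) k (W T : set V) := forall t t', T t -> T t' ->
  t <> t' -> forall D : set V, small K D -> exists l,
  [/\ path (adj k) t (rcons l t'), uniq l & forall x, x \in l -> W x /\ ~ D x].

Definition skeletal (K : set V) k (X R : set V) := forall X' R', X' `<=` X ->
  R' `<=` R -> K #<= X' -> K #<= R' ->
  exists Q lt, [/\ skeleton k X' Q lt, Q `<=` X' `|` R' & K #<= (Q `&` X')].

Definition traceable K (W : set V) k (X R T : set V) :=
  [/\ [/\ opp X R, X `<=` T, T `<=` W & R `<=` W],
      [/\ T #<= K, K #<= X & K #<= R], linked K k W T & skeletal K k X R].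

Definition escape k (T M : set V) := exists rho : V -> V,
  (forall e e', M e -> M e' -> rho e = rho e' -> e = e') /\
  forall e, M e -> T (rho e) /\ (rho e = e \/ adj k e (rho e)).

Lemma escape_sub k (T M M' : set V) : M' `<=` M -> escape k T M -> escape k T M'.
Proof.
move=> sM [rho [inj h]]; exists rho; split=> [e e' /sM ? /sM|e /sM]; [exact: inj|exact: h].
Qed.

Lemma excluded_sub K k (X R X' R' : set V) : X' `<=` X -> R' `<=` R ->
  excluded K k X R -> excluded K k X' R'.
Proof. by move=> sX sR e x /sX/e; apply: sub_small => y [/sR]. Qed.

Lemma set_of_list_small (K : set V) (s : seq V) : infinite_set K -> small K [set` s].
Proof. by move=> infK; apply: small_finite => //; exact: finite_seq. Qed.

(** Both [t] and [t'] are led to vertices of [X]; these have a big set of common neighbours, one of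
    which closes the path. *)
Lemma linked_of_reach (K W T X R : set V) k (U : set_system V) : infinite_set K ->
  UltraFilter U -> (forall A, U A -> K #<= A) -> R `<=` W ->
  (forall x, X x -> U (R `&` nbr k x)) ->
  (forall t, T t -> forall D : set V, small K D -> exists s,
     [/\ path (adj k) t s, X (last t s), uniq s & forall x, x \in s -> W x /\ ~ D x]) ->
  linked K k W T.
Proof.
move=> infK ultraU bU RW UX reach t t' Tt Tt' ne D sD.
pose D1 := D `|` [set` [:: t; t']].
have sD1 : small K D1 by apply: smallU => //; exact: set_of_list_small.
have [s [ps Xs us sW]] := reach t Tt _ sD1.
have sD2 : small K (D1 `|` [set` s]) by apply: smallU => //; exact: set_of_list_small.
have [s' [ps' Xs' us' sW']] := reach t' Tt' _ sD2.
have UN : U ((R `&` nbr k (last t s)) `&` (R `&` nbr k (last t' s'))).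
  by apply: filterI; exact: UX.
have sD3 : small K ((D1 `|` [set` s]) `|` [set` s']).
  by apply: smallU => //; exact: set_of_list_small.
have [c [[[Rc xc] [_ x'c]] nc]] := big_ex infK (smallD infK (fun h => h (bU _ UN)) sD3).
exists (s ++ c :: rev s'); split.
- rewrite rcons_cat rcons_cons cat_path ps /= xc /= -rev_cons lastI rev_rcons /=.
  rewrite adjC x'c /= rev_path.
  by rewrite (eq_path (e' := adj k)) // => a b; rewrite adjC.
- rewrite cat_uniq us cons_uniq rev_uniq us' andbT /= mem_rev.
  rewrite negb_or -andbA; apply/and3P; split.
  + by apply/negP => cs; apply: nc; left; right.
  + apply/hasPn => y; rewrite mem_rev => ys'; apply/negP => ys.
    by have [_] := sW' y ys'; apply; right.
  + by apply/negP => cs; apply: nc; right.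
- move=> x; rewrite mem_cat inE mem_rev => /or3P[xs|/eqP->|xs].
  + by have [Wx nD] := sW x xs; split=> // Dx; apply: nD; left.
  + by split; [exact: RW|move=> Dc; apply: nc; left; left; left].
  + by have [Wx nD] := sW' x xs; split=> // Dx; apply: nD; left; left.
Qed.

(** [T] takes in the vertices of [Z] with a big neighbourhood in [M] and those of [Y0] with one in
    [X], since both kinds can reach [X] around any small set. [Y0] is the other bipartition class in
    the first round of the two-sided case and empty in later rounds. *)
Lemma step (K W Z R Y0 : set V) : infinite_set K -> opp Z R -> opp Z Y0 ->
  Z `<=` W -> R `<=` W -> Y0 `<=` W -> K #<= Z -> Z #<= K -> K #<= R -> Y0 #<= K ->
  exists k X R1 M T, [/\ [/\ traceable K W k X R1 T, X `<=` Z & T `<=` Z `|` Y0],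
    ~ excluded K k Z R, [/\ M `<=` R, K #<= M & escape k T M],
    forall z, Z z -> ~ T z -> small K (M `&` nbr k z) &
    forall y, Y0 y -> ~ T y -> small K (X `&` nbr k y)].
Proof.
move=> infK oZR oZY ZW RW YW bZ ZK bR YK; have [k0 Kk0] := infinite_setN0 infK.
have [k [X [R1 [U [XZ R1R bX [ultraU bU UX sk]]]]]] := core_exists infK oZR bZ bR.
have [lt [woX inX]] := wo_initial X.
have XK : X #<= K by apply: card_le_trans ZK; exact: subset_card_le.
have [x Xx le|m [mE minj]] := inj_choice k0 (E := fun x => R1 `&` nbr k x) woX.
  by apply: (inX x Xx); apply: card_le_trans XK (card_le_trans (bU _ (UX x Xx)) le).
(* Each [x] has its private neighbour [m x], so inverting [m] leads [M] injectively back into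
   [X]. *)
pose M := m @` X.
have bM : K #<= M.
  by apply: card_le_trans bX _; apply: (card_leI (f := m)) => // x Xx; exists x.
have /choice[rho hrho] e : exists x, M e -> X x /\ m x = e.
  by have [[x Xx xe]|] := pselect (M e); [exists x|exists k0].
have rinj e e' : M e -> M e' -> rho e = rho e' -> e = e'.
  by move=> /hrho[_ h] /hrho[_ h'] e0; rewrite -h -h' e0.
have radj e : M e -> X (rho e) /\ adj k e (rho e).
  move=> /hrho[Xr me]; split=> //; have [_] := mE _ Xr.
  by rewrite me => h; rewrite adjC.
pose T := [set v | [\/ X v, Z v /\ K #<= (M `&` nbr k v) | Y0 v /\ K #<= (X `&` nbr k v)]].
have XT : X `<=` T by move=> x Xx; constructor 1.
have TZY : T `<=` Z `|` Y0 by move=> x [/XZ|[]|[]]; [left|left|right].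
have R1W : R1 `<=` W by move=> x /R1R/RW.
have MR : M `<=` R by move=> _ [x Xx <-]; apply: R1R; have [] := mE x Xx.
have [x0 Xx0] := big_ex infK (fun h => h bX).
exists k, X, R1, M, T; split.
- split=> //; split.
  + split=> //; first by apply: opp_sub oZR.
    by move=> x /TZY[/ZW|/YW].
  + split=> //; last by apply: card_le_trans (bU _ (UX x0 Xx0)) (subset_card_le _) => y [].
    by apply: card_le_trans (subset_card_le TZY) _; apply: card_leU.
  + apply: (linked_of_reach infK ultraU bU R1W UX) => t Tt D sD.
    pose D' := D `|` [set t].
    have sD' : small K D' by apply: smallU => //; exact: small_finite.
    case: Tt => [Xt|[Zt bt]|[Yt bt]].
    * by exists [::]; split.
    * have sB : small K [set e | M e /\ D' (rho e)].
        apply: smallS sD'; apply: (card_leI (f := rho)) => [e []//|e e' [Me _] [Me' _]].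
        exact: rinj.
      have [e [[Me te] nB]] := big_ex infK (smallD infK (fun h => h bt) (smallU infK sD' sB)).
      have [Xr ar] := radj e Me.
      have nr : ~ D' (rho e) by move=> Dr; apply: nB; right.
      exists [:: e; rho e]; split=> //=.
      -- by rewrite ar !andbT; exact: te.
      -- by rewrite inE andbT; apply/eqP; exact: adj_neq ar.
      -- move=> x; rewrite !inE => /orP[/eqP->|/eqP->].
           by split; [exact/RW/MR|move=> De; apply: nB; left; left].
         by split; [exact/ZW/XZ|move=> De; apply: nr; left].
    * have [x [[Xx tx] nD]] := big_ex infK (smallD infK (fun h => h bt) sD').
      exists [:: x]; split=> //=; first by rewrite andbT; exact: tx.
      by move=> y; rewrite inE => /eqP->; split; [exact/ZW/XZ|move=> Dx; apply: nD; left].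
  + exact: sk.
- move=> ex; apply: (ex x0 (XZ _ Xx0)); apply: card_le_trans (bU _ (UX x0 Xx0)) _.
  by apply: subset_card_le => y [/R1R].
- split=> //; exists rho; split=> // e Me; have [Xr ar] := radj e Me.
  by split; [exact: XT|right].
- by move=> z Zz nT le; apply: nT; constructor 2.
- by move=> z Zz nT le; apply: nT; constructor 3.
Qed.

(** Each round finds a colour not excluded before and excludes it for what remains, so the number of
    colours bounds the number of rounds. Passing to a smaller [R] keeps earlier exclusions and
    escapes. The last clause is the progress needed for an induction on the number of colours. *)
Lemma loop (K W : set V) (A : {set 'I_r}) (Z R : set V) :
  infinite_set K -> opp Z R -> Z `<=` W -> R `<=` W -> Z #<= K -> K #<= R ->
  (forall k, k \in A -> excluded K k Z R) ->
  exists (A' : {set 'I_r}) Zl Rl (X Rr T : 'I_r -> set V),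
  [/\ [/\ A \subset A', Zl `<=` Z, small K Zl, Rl `<=` R & K #<= Rl],
      (forall k, k \in A' -> excluded K k Zl Rl),
      (forall k, k \in A' -> k \notin A -> [/\ traceable K W k (X k) (Rr k) (T k),
         T k `<=` Z & escape k (T k) Rl]),
      (forall z, Z z -> Zl z \/ exists k, [/\ k \in A', k \notin A & T k z]) &
      (K #<= Z -> A \proper A')].
Proof.
have [n] := ubnP #|~: A|.
elim: n A Z R => // n ih A Z R lenA infK oZR ZW RW ZK bR exA.
have [sZ|/contrapT bZ] := pselect (small K Z).
  exists A, Z, R, (fun=> set0), (fun=> set0), (fun=> set0); split=> // [|k ->//|z Zz]; first by split.
  by left.
have oZ0 : opp Z set0 by have [s [h _]] := oZR; exists s.
have [k [X [R1 [M [T [[tr XZ TZ] nex [MR bM esc] hZ _]]]]]] :=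
  step infK oZR oZ0 ZW RW (@sub0set _ W) bZ ZK bR (card_ge0 _ _).
have kA : k \notin A by apply/negP => /exA.
have {}TZ : T `<=` Z by move=> x /TZ[].
have [|||||||j|A' [Zl [Rl [X' [Rr' [T' [[sA ZlZ sZl RlM bRl] exA' trA' covA' _]]]]]]] :=
  ih (k |: A) (Z `\` T) M.
- rewrite -ltnS; apply: leq_trans lenA; rewrite ltnS; apply: proper_card.
  by rewrite properC finset.properEcard finset.subsetUr cardsU1 kA /=.
- exact: infK.
- by apply: opp_sub oZR => // x [].
- by move=> x [/ZW].
- by move=> x /MR/RW.
- by apply: card_le_trans ZK; apply: subset_card_le => x [].
- exact: bM.
- rewrite in_setU1 => /orP[/eqP->|jA]; first by move=> z [Zz nT]; exact: hZ.
  by apply: excluded_sub (exA j jA) => // x [].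
have kA' : k \in A' by apply: (fintype.subsetP sA); rewrite setU11.
exists A', Zl, Rl, (fun j => if j == k then X else X' j),
  (fun j => if j == k then R1 else Rr' j), (fun j => if j == k then T else T' j).
split=> //.
- split=> //; first by apply: fintype.subset_trans sA; exact: finset.subsetUr.
    by move=> x /ZlZ[].
  by move=> x /RlM/MR.
- move=> j jA' jA; have [->|jk] := eqVneq j k; first by split=> //; apply: escape_sub esc.
  have [|? TZ' ?] := trA' j jA'; first by rewrite in_setU1 negb_or jk.
  by split=> // x /TZ'[].
- move=> z Zz; have [Tz|nT] := pselect (T z).
    by right; exists k; rewrite eqxx.
  have [|[j [jA' jA Tj]]] := covA' z (conj Zz nT); first by left.
  right; exists j; move: jA; rewrite in_setU1 negb_or => /andP[jk jA].
  by rewrite (negbTE jk).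
- move=> _; apply/properP; split; last by exists k.
  by apply: fintype.subset_trans sA; exact: finset.subsetUr.
Qed.

(** * Building disjoint paths *)

(** Skeletons are to live on the sets [B' j] without destroying linkage. One recursion picks,
    pairwise disjointly, [K] many paths for every pair to be linked and [K] many vertices for every
    [B' j]; a small [D] cannot meet all paths of a pair. *)
Lemma split_linked (K W : set V) (J I : finType) (B : J -> set V) (kc : I -> 'I_r)
    (T : I -> set V) : infinite_set K -> (forall j, K #<= B j) ->
  (forall i, T i #<= K) -> (forall i, linked K (kc i) W (T i)) ->
  exists B' : J -> set V, [/\ forall j, B' j `<=` B j /\ K #<= B' j,
    forall j j' x, B' j x -> B' j' x -> j = j' &
    forall i, linked K (kc i) (W `\` \bigcup_j B' j) (T i)].
Proof.
move=> infK bB TK lk; have [k0 Kk0] := infinite_setN0 infK.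
(* The last component [c] numbers the [K] copies of each task. *)
pose Tk := [set q : I * V * V * V + J * V | match q with
  | inl (i, t, t', c) => [/\ T i t, T i t', t <> t' & K c]
  | inr (j, c) => K c end].
have finK (F : finType) : [set: F] #<= K.
  apply: card_le_trans ((infiniteP K).1 infK); apply: finite_set_countable.
  exact: finite_finset.
have TTK : \bigcup_i T i #<= K by apply: card_bigcup_le.
have TkK : Tk #<= K.
  have : (inl @` ((([set: I] `*` \bigcup_i T i) `*` \bigcup_i T i) `*` K) `|`
          inr @` ([set: J] `*` K)) #<= K.
    apply: card_leU => //; apply: card_le_trans (card_image_le _ _) _.
      by do 3!apply: card_leX_inf => //.
    by apply: card_leX_inf.
  apply: card_le_trans; apply: subset_card_le => -[[[[i t] t'] c]|[j c]] /=.
    by move=> [? ? _ ?]; left; exists (i, t, t', c) => //; split=> //=; split=> /=; [split=> //=; exists i|exists i].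
  by move=> Kc; right; exists (j, c).
have [lt [woT sT]] := wo_initial_small TkK.
pose spec (q : I * V * V * V + J * V) (l : seq V) := match q with
  | inl (i, t, t', c) => [/\ path (adj (kc i)) t (rcons l t'), uniq l & forall x, x \in l -> W x]
  | inr (j, c) => exists x, l = [:: x] /\ B j x end.
have [q f g l Tq fg [h1 h2]|q f Tq ih|f hf] := @wo_rec _ (seq V) [::] Tk lt (fun q f l =>
    spec q l /\ forall s x, Tk s -> lt s q -> x \in f s -> x \notin l) woT.
- by split=> // s x Ts sq; rewrite -fg //; exact: h2.
- pose D := \bigcup_(s in seg Tk lt q) [set` f s].
  have sD : small K D.
    by apply: small_bigcup_finite; [|exact: sT|move=> s _; exact: finite_seq].
  case: q Tq ih @D sD => [[[[i t] t'] c]|[j c]] Tq ih D sD.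
    have [Tt Tt' ne _] := Tq; have [l [pl ul lW]] := lk i t t' Tt Tt' ne D sD.
    exists l; split; first by split=> // x /lW[].
    move=> s x Ts sq fx; apply/negP => /lW[_]; apply; exists s => //.
  have [x [Bx nD]] := big_ex infK (smallD infK (fun h => h (bB j)) sD).
  exists [:: x]; split; first by exists x.
  move=> s y Ts sq fy; rewrite inE; apply/eqP => e; subst y; apply: nD.
  by exists s.
have dis s q x : Tk s -> Tk q -> x \in f s -> x \in f q -> s = q.
  move=> Ts Tq fs fq; have [sq|//|qs] := wo_total woT Ts Tq.
    by have [_ /(_ s x Ts sq fs)] := hf q Tq; rewrite fq.
  by have [_ /(_ q x Tq qs fq)] := hf s Ts; rewrite fs.
pose B' j := [set x | exists c, K c /\ f (inr (j, c)) = [:: x]].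
have Tinr j c : K c -> Tk (inr (j, c)) by [].
exists B'; split.
- move=> j; split.
    move=> x [c [Kc fx]]; have [[y [fy By]] _] := hf _ (Tinr j c Kc).
    by move: fx; rewrite fy => -[<-].
  have /choice[b hb] c : exists x, K c -> f (inr (j, c)) = [:: x].
    have [Kc|] := pselect (K c); last by exists k0.
    by have [[y [fy _]] _] := hf _ (Tinr j c Kc); exists y.
  apply: (card_leI (f := b)) => [c Kc|c c' Kc Kc' e]; first by exists c; rewrite hb.
  have h : b c \in f (inr (j, c)) by rewrite hb // mem_head.
  have h' : b c \in f (inr (j, c')) by rewrite hb // e mem_head.
  by have [] := dis _ _ _ (Tinr j c Kc) (Tinr j c' Kc') h h'.
- move=> j j' x [c [Kc fx]] [c' [Kc' fx']].
  have := dis _ _ x (Tinr j c Kc) (Tinr j' c' Kc').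
  by rewrite fx fx' mem_head => /(_ isT isT)[].
- move=> i t t' Tt Tt' ne D sD.
  have Tinl c : K c -> Tk (inl (i, t, t', c)) by [].
  have [c [Kc hc]] : exists c, K c /\ forall x, x \in f (inl (i, t, t', c)) -> ~ D x.
    apply: contrapT => no; apply: sD.
    have /choice[d hd] c : exists x, K c -> x \in f (inl (i, t, t', c)) /\ D x.
      have [Kc|] := pselect (K c); last by exists k0.
      apply: contrapT => no'; apply: no; exists c; split=> // x fx Dx.
      by apply: no'; exists x.
    apply: (card_leI (f := d)) => [c /hd[]//|c c' Kc Kc' e].
    have [h _] := hd c Kc; have [h' _] := hd c' Kc'; rewrite -e in h'.
    by have [] := dis _ _ _ (Tinl c Kc) (Tinl c' Kc') h h'.
  have [[pl ul lW] _] := hf _ (Tinl c Kc).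
  exists (f (inl (i, t, t', c))); split=> // x fx; split; last exact: hc.
  split; first exact: lW.
  move=> [j _ [c' [Kc' fx']]].
  have := dis _ _ x (Tinl c Kc) (Tinr j c' Kc') fx.
  by rewrite fx' mem_head => /(_ isT).
Qed.

Lemma linked_segment (K W T D : set V) k u v x s : infinite_set K ->
  linked K k W T -> small K D -> T u -> T v -> T x -> T (last x s) ->
  path (adj k) x s -> uniq (x :: s) -> u \notin x :: s -> v \notin x :: s ->
  exists l1 l2, [/\ path (adj k) u (rcons (l1 ++ (x :: s) ++ l2) v),
    uniq (l1 ++ (x :: s) ++ l2) &
    forall y, y \in l1 ++ l2 -> [/\ W y, ~ D y & y \notin x :: s]].
Proof.
move=> infK lk sD Tu Tv Tx Tl ps us nu nv.
pose D1 := D `|` [set` x :: s].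
have sD1 : small K D1 by apply: smallU => //; exact: set_of_list_small.
have ux : u <> x by move=> e; move: nu; rewrite e mem_head.
have lv : last x s <> v by move=> e; move: nv; rewrite -e mem_last.
have [l1 [p1 u1 h1]] := lk u x Tu Tx ux D1 sD1.
have sD2 : small K (D1 `|` [set` l1]) by apply: smallU => //; exact: set_of_list_small.
have [l2 [p2 u2 h2]] := lk (last x s) v Tl Tv lv _ sD2.
exists l1, l2; split.
- move: p1; rewrite rcons_cat cat_path rcons_path => /andP[-> p1] /=.
  by rewrite p1 rcons_cat cat_path ps p2.
- move: us => /= /andP[xs us].
  rewrite cat_uniq u1 /= mem_cat (negbTE xs) /= cat_uniq us u2 /= andbT.
  rewrite negb_or; apply/and3P; split.
  + apply/andP; split; apply/negP => h.
      by have [_] := h1 x h; apply; right; rewrite /= mem_head.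
    move: h => /hasP[y]; rewrite mem_cat => /orP[ys|yl2] yl1.
      by have [_] := h1 y yl1; apply; right; rewrite /= inE ys orbT.
    by have [_] := h2 y yl2; apply; right.
  + by apply/negP => h; have [_] := h2 x h; apply; left; right; rewrite /= mem_head.
  + apply/hasPn => y yl2; apply/negP => ys.
    by have [_] := h2 y yl2; apply; left; right; rewrite /= inE ys orbT.
- move=> y; rewrite mem_cat => /orP[/h1[Wy nD]|/h2[Wy nD]].
    split=> //; first by move=> Dy; apply: nD; left.
    by apply/negP => h; apply: nD; right.
  split=> //; first by move=> Dy; apply: nD; left; left.
  by apply/negP => h; apply: nD; left; right.
Qed.

(** One recursion runs over the gaps of all skeletons. Each vertex of [T i] missed by the skeletons
    and each segment [sg z] owned by [i] gets its own gap of skeleton [i], which is then filled by a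
    finite path through it. The skeletons lie in the reserved set [H], so fillings cannot run into
    them. *)
Lemma assemble_paths (K W : set V) (I : finType) (kc : I -> 'I_r) (act : pred I)
    (X R T : I -> set V) (D0 Zb : set V) (own : V -> I) (sg : V -> seq V) :
  infinite_set K ->
  (forall i, act i -> traceable K W (kc i) (X i) (R i) (T i)) ->
  small K D0 -> small K Zb ->
  (forall z, Zb z -> act (own z) /\ exists x s, [/\ sg z = x :: s,
     path (adj (kc (own z))) x s, T (own z) x /\ T (own z) (last x s), uniq (x :: s) &
     forall y, y \in x :: s -> W y /\ ~ D0 y]) ->
  (forall z z' y, Zb z -> Zb z' -> y \in sg z -> y \in sg z' -> z = z') ->
  exists (P : I -> set V) (lt : I -> V -> V -> Prop),
  [/\ forall i, act i -> gpath (adj (kc i)) (adj (kc i)) (P i) (lt i),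
      (forall i, ~~ act i -> P i = set0) /\ (forall i x, P i x -> W x /\ ~ D0 x),
      forall i j x, P i x -> P j x -> i = j,
      forall i x, act i -> T i x -> D0 x \/ exists j, P j x &
      forall z y, Zb z -> y \in sg z -> P (own z) y].
Proof.
move=> infK tr sD0 sZb hsg dissg; have [k0 Kk0] := infinite_setN0 infK.
pose G := \bigcup_(z in Zb) [set` sg z].
have sG : small K G.
  by apply: small_bigcup_finite => // z _; exact: finite_seq.
have sDG : small K (D0 `|` G) by exact: smallU.
pose T' i := if act i then T i else set0.
(* For an inactive index [K] is a placeholder that keeps every member of the family big. *)
pose B (j : I * bool) := if act j.1 then (if j.2 then X j.1 else R j.1) `\` (D0 `|` G) else K.
have [[i b]|i|i|B' [hB' disB' lkH]] := @split_linked K W _ I B kc T' infK.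
- rewrite /B /=; case ai: (act i) => //; apply: contrapT; apply: smallD => //.
  by have [_ [_ bX bR] _ _] := tr i ai; case: b => h; apply: h.
- rewrite /T'; case ai: (act i); last exact: card_ge0.
  by have [_ [? _ _] _ _] := tr i ai.
- rewrite /T'; case ai: (act i); last by move=> t t' [].
  by have [_ _ ? _] := tr i ai.
pose H := \bigcup_j B' j.
pose X' i := B' (i, true).
have X'X i : act i -> X' i `<=` X i `\` (D0 `|` G).
  by move=> ai; have [h _] := hB' (i, true); move: h; rewrite /B /= ai.
have R'R i : act i -> B' (i, false) `<=` R i `\` (D0 `|` G).
  by move=> ai; have [h _] := hB' (i, false); move: h; rewrite /B /= ai.
have /choice[Q /choice[ltQ hQ]] i : exists Q, exists lt, act i ->
    [/\ skeleton (kc i) (X' i) Q lt, Q `<=` X' i `|` B' (i, false) & K #<= (Q `&` X' i)].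
  case ai: (act i); last by exists set0, (fun _ _ => False).
  have [_ _ _ sk] := tr i ai; have [_ bX'] := hB' (i, true); have [_ bR'] := hB' (i, false).
  have [Q [lt ?]] := sk (X' i) (B' (i, false)) (fun x h => (X'X i ai x h).1)
    (fun x h => (R'R i ai x h).1) bX' bR'.
  by exists Q, lt.
pose QQ := [set x | exists i, act i /\ Q i x].
have QH i x : act i -> Q i x -> H x.
  by move=> ai Qx; have [_ /(_ x Qx)[h|h] _] := hQ i ai; [exists (i, true)|exists (i, false)].
have QG i x : act i -> Q i x -> ~ (D0 `|` G) x.
  by move=> ai Qx; have [_ /(_ x Qx)[/(X'X i ai)[]|/(R'R i ai)[]] _] := hQ i ai.
have disQ i j x : act i -> act j -> Q i x -> Q j x -> i = j.
  move=> ai aj Qi Qj; have [_ /(_ x Qi)hi _] := hQ i ai.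
  have [_ /(_ x Qj)hj _] := hQ j aj.
  by case: hi => hi; case: hj => hj; have [] := disB' _ _ _ hi hj.
have QW i x : act i -> Q i x -> W x.
  move=> ai Qx; have [[_ XT TW RW] _ _ _] := tr i ai.
  by have [_ /(_ x Qx)[/(X'X i ai)[/XT/TW]|/(R'R i ai)[/RW]]] := hQ i ai.
have X'T i : act i -> X' i `<=` T i.
  by move=> ai x /(X'X i ai)[Xx _]; have [[_ XT _ _] _ _ _] := tr i ai; apply: XT.
(* [pos] marks the gaps of the skeletons, which the recursion below fills. *)
pose isnext i u v := [/\ Q i v, ispred (Q i) (ltQ i) u v, X' i u & X' i v].
pose pos i u := exists v, isnext i u v.
(* Every vertex of [X' i] on the skeleton, except a last one, opens a gap: its successor is not a
   limit vertex and hence lies in [X' i]. *)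
have bpos i : act i -> K #<= [set u | pos i u].
  move=> ai; have [[[woQ gQ] _] _ bQ] := hQ i ai; have [irr trQ mnQ] := woQ.
  have sub : (Q i `&` X' i) `\` [set u | Q i u /\ forall v, Q i v -> ~ ltQ i u v]
      `<=` [set u | pos i u].
    move=> u [[Qu Xu] nmax].
    have [v0 [Qv0 uv0]] : exists v, Q i v /\ ltQ i u v.
      apply: contrapT => no; apply: nmax; split=> // v Qv uv; apply: no.
      by exists v.
    have [||v [[Qv uv] mv]] := mnQ [set v | Q i v /\ ltQ i u v].
    - by move=> x [].
    - by exists v0.
    have pv : ispred (Q i) (ltQ i) u v.
      split=> // w Qw uw wv; case: (mv w (conj Qw uw)) => [e|vw].
        by subst w; apply: (irr v Qv).
      exact: (wo_asym woQ Qv Qw vw wv).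
    case: (gQ v Qv) => [h|[u' [pu' [Xv _]]]|[_ lm]].
    - by case: (h u Qu).
    - by exists v.
    - by have [w [Qw uw wv _]] := lm u Qu uv; have [_ _ /(_ w Qw uw)] := pv.
  apply: card_le_trans (subset_card_le sub); apply: contrapT; apply: smallD => //.
  apply: small_finite => //; have [[u0 [Qu0 m0]]|no] :=
    pselect (exists u, Q i u /\ forall v, Q i v -> ~ ltQ i u v); last first.
    rewrite (_ : [set u | _] = set0) // -subset0 => u hu.
    by apply: no; exists u.
  apply: (sub_finite_set (B := [set u0])) => // u [Qu mu].
  have [uu0|//|u0u] := wo_total woQ Qu Qu0; first by case: (mu u0).
  by case: (m0 u).
pose Tk := [set q : I * V | act q.1 /\ pos q.1 q.2].
have finK (F : finType) : [set: F] #<= K.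
  apply: card_le_trans ((infiniteP K).1 infK); apply: finite_set_countable.
  exact: finite_finset.
have TkK : Tk #<= K.
  have : ([set: I] `*` \bigcup_i T' i) #<= K.
    apply: card_leX_inf => //; apply: card_bigcup_le => // i _; rewrite /T'.
    by case ai: (act i); [have [_ [] ] := tr i ai|exact: card_ge0].
  apply: card_le_trans; apply: subset_card_le => -[i u] [/= ai [v [_ _ Xu _]]].
  by split=> //=; exists i => //; rewrite /T' ai; exact: X'T.
have [lt [woT sT]] := wo_initial_small TkK.
pose item i := [set q : V + V | match q with
  | inl t => T i t /\ ~ QQ t | inr z => Zb z /\ own z = i end].
have /choice[tau htau] i : exists tau : V + V -> V, act i ->
    (forall q, item i q -> pos i (tau q)) /\
    (forall q q', item i q -> item i q' -> tau q = tau q' -> q = q').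
  case ai: (act i); last by exists (fun=> k0).
  have le : item i #<= [set u | pos i u].
    apply: card_le_trans (bpos i ai).
    have : (inl @` T i `|` inr @` Zb) #<= K.
      have [_ [TK _ _] _ _] := tr i ai.
      apply: card_leU => //; apply: card_le_trans (card_image_le _ _) _ => //.
      exact: small_le.
    apply: card_le_trans; apply: subset_card_le => -[t [Tt _]|z [Zz _]].
      by left; exists t.
    by right; exists z.
  by have [tau [h1 h2]] := card_leE le k0; exists tau.
have /choice[it hit] (q : I * V) : exists o : option (V + V),
    (forall x, o = Some x -> item q.1 x /\ tau q.1 x = q.2) /\
    (o = None -> forall x, item q.1 x -> tau q.1 x <> q.2).
  have [[x [ix tx]]|no] := pselect (exists x, item q.1 x /\ tau q.1 x = q.2).
    by exists (Some x); split=> // y [<-].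
  by exists None; split=> // _ x ix tx; apply: no; exists x.
have itE i x : act i -> item i x -> it (i, tau i x) = Some x.
  move=> ai ix; have [h1 h2] := hit (i, tau i x).
  case e : (it _) => [y|]; last by case: (h2 e x ix).
  have [iy ty] := h1 y e; have [_ tinj] := htau i ai.
  by congr Some; apply: tinj.
(* A filling may meet [G] only in the segment assigned to its gap; otherwise it could block a
   segment that is placed later. *)
pose spec (q : I * V) (l : seq V) := exists v, [/\ isnext q.1 q.2 v,
  path (adj (kc q.1)) q.2 (rcons l v), uniq l,
  (forall x, x \in l -> [/\ W x, ~ D0 x, ~ QQ x &
     G x -> exists z, it q = Some (inr z) /\ x \in sg z]) &
  (forall z, it q = Some (inr z) -> forall x, x \in sg z -> x \in l)].
(* When its gap is reached, [t] may already lie on an earlier filling, hence the last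
   alternative. *)
have [q f g l Tq fg [h1 h2 h3]|q f Tq ih|f hf] := @wo_rec _ (seq V) [::] Tk lt (fun q f l =>
    [/\ spec q l, forall s x, Tk s -> lt s q -> x \in f s -> x \notin l &
     forall t, it q = Some (inl t) -> [\/ t \in l, D0 t, G t |
       exists s, [/\ Tk s, lt s q & t \in f s]]]) woT.
- split=> // [s x Ts sq|t /h3]; first by rewrite -fg //; exact: h2.
  case=> [?|?|?|[s [Ts sq fs]]]; [by constructor 1|by constructor 2|by constructor 3|].
  by constructor 4; exists s; split=> //; rewrite -fg.
- pose F := \bigcup_(s in seg Tk lt q) [set` f s].
  have sF : small K F.
    by apply: small_bigcup_finite; [|exact: sT|move=> s _; exact: finite_seq].
  have sD : small K ((D0 `|` G) `|` F) by exact: smallU.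
  case: q Tq ih @F sF sD => i u [ai [v nv]] ih F sF sD; rewrite /= in ai nv.
  have [Qv puv Xu Xv] := nv; have [Qu _ _] := puv.
  have lki : linked K (kc i) (W `\` H) (T i) by have := lkH i; rewrite /T' ai.
  have Tu := X'T i ai _ Xu; have Tv := X'T i ai _ Xv.
  have fresh y : (W `\` H) y -> ~ ((D0 `|` G) `|` F) y ->
      [/\ W y, ~ D0 y, ~ QQ y & ~ G y] /\ forall s, Tk s -> lt s (i, u) -> y \notin f s.
    move=> [Wy nH] nD; split.
      split=> //; [by move=> ?; apply: nD; left; left| |by move=> ?; apply: nD; left; right].
      by move=> [j [aj Qy]]; apply: nH; exact: QH Qy.
    by move=> s Ts su; apply/negP => fy; apply: nD; right; exists s.
  have uv : u <> v.
    move=> e; have [_ h _] := puv; have [[[[irr _ _] _] _] _ _] := hQ i ai.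
    by subst v; apply: (irr u Qu).
  have direct : exists l, [/\ path (adj (kc i)) u (rcons l v), uniq l &
      forall y, y \in l -> (W `\` H) y /\ ~ ((D0 `|` G) `|` F) y].
    by have [l ?] := lki u v Tu Tv uv _ sD; exists l.
  have [l [pl ul hl]] := direct.
  have plain : (forall z, it (i, u) <> Some (inr z)) ->
      (forall t, it (i, u) = Some (inl t) -> [\/ D0 t, G t | F t]) ->
      exists l, [/\ spec (i, u) l, forall s x, Tk s -> lt s (i, u) -> x \in f s -> x \notin l &
        forall t, it (i, u) = Some (inl t) -> [\/ t \in l, D0 t, G t |
          exists s, [/\ Tk s, lt s (i, u) & t \in f s]]].
    move=> nz ht; exists l; split.
    - exists v; split=> // [x /hl[Wx nD]|z /nz//].
      by have [[? ? ? ?] _] := fresh x Wx nD.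
    - move=> s x Ts su fx; apply/negP => /hl[Wx nD].
      by have [_ /(_ s Ts su)] := fresh x Wx nD; rewrite fx.
    - move=> t /ht[?|?|[s [Ts su] fs]]; [by constructor 2|by constructor 3|].
      by constructor 4; exists s.
  case e : (it (i, u)) => [[t|z]|]; last 1 first.
  + by have := plain; rewrite e; apply.
  + have [it1 _] := hit (i, u); have [[/= Tt nQt] tu] := it1 _ e.
    have [Dt|nDt] := pselect (((D0 `|` G) `|` F) t).
      have := plain; rewrite e; apply=> // t' [<-].
      by case: Dt => [[?|?]|?]; [constructor 1|constructor 2|constructor 3].
    have tu' : u \notin [:: t].
      by rewrite inE; apply/eqP => e'; apply: nQt; rewrite -e'; exists i.
    have tv' : v \notin [:: t].
      by rewrite inE; apply/eqP => e'; apply: nQt; rewrite -e'; exists i.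
    have [l1 [l2 [p12 u12 h12]]] := linked_segment (s := [::]) infK lki sD Tu Tv Tt Tt isT isT tu' tv'.
    have inl12 y : y \in l1 ++ [:: t] ++ l2 -> y = t \/ y \in l1 ++ l2.
      rewrite !mem_cat inE => /or3P[h|/eqP->|h]; [right|by left|right];
        by rewrite h ?orbT.
    have Wt : W t by have [[_ _ TW _] _ _ _] := tr i ai; exact: TW.
    exists (l1 ++ [:: t] ++ l2); split.
    * exists v; split=> // [x /inl12[->|/h12[Wx nD _]]|z].
      - by split=> //; [move=> ?; apply: nDt; left; left|move=> ?; case: nDt; left; right].
      - by have [[? ? ? ?] _] := fresh x Wx nD.
      - by rewrite e.
    * move=> s x Ts su fx; apply/negP => /inl12[xt|/h12[Wx nD _]].
        by apply: nDt; right; exists s => //; rewrite /= -xt.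
      by have [_ /(_ s Ts su)] := fresh x Wx nD; rewrite fx.
    * by move=> t' [<-]; constructor 1; rewrite !mem_cat inE eqxx orbT.
  + have [it1 _] := hit (i, u); have [[/= Zz oz] tu] := it1 _ e.
    have [_ [x [s [sgz ps [Tx Tl] us hs]]]] := hsg z Zz.
    rewrite oz in ps Tx Tl.
    have nQsg y : y \in x :: s -> ~ QQ y.
      move=> ys [j [aj Qy]]; apply: (QG j y aj Qy); right; exists z => //=.
      by rewrite sgz.
    have nu : u \notin x :: s by apply/negP => /nQsg; apply; exists i.
    have nv' : v \notin x :: s by apply/negP => /nQsg; apply; exists i.
    have [l1 [l2 [p12 u12 h12]]] := linked_segment infK lki sD Tu Tv Tx Tl ps us nu nv'.
    have inl12 y : y \in l1 ++ (x :: s) ++ l2 -> y \in x :: s \/ y \in l1 ++ l2.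
      rewrite !mem_cat => /or3P[h|->|h]; [right|by left|right];
        by rewrite h ?orbT.
    exists (l1 ++ (x :: s) ++ l2); split.
    * exists v; split=> // [y /inl12[ys|/h12[Wy nD _]]|z'].
      - have [Wy nD] := hs y ys; split=> //; first exact: nQsg.
        by move=> _; exists z; rewrite sgz.
      - by have [[? ? ? nG] _] := fresh y Wy nD; split=> // /nG.
      - rewrite e => -[<-] y; rewrite sgz => ys.
        by rewrite !mem_cat ys orbT.
    * move=> q y Tq qu fy; apply/negP => /inl12[ys|/h12[Wy nD _]].
        have [[v' [_ _ _ hq _]] _ _] := ih q Tq qu.
        have [_ _ _ Gq] := hq y fy.
        have [|z' [eq yz']] := Gq; first by exists z => //=; rewrite sgz.
        have [it1' _] := hit q; have [iz' tz'] := it1' _ eq.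
        have [Zz' oz'] : Zb z' /\ own z' = q.1 by [].
        have zz' : z = z' by apply: (dissg z z' y) => //; rewrite sgz.
        have qE : q = (i, u).
          case: q {Tq qu fy ih hq Gq eq it1'} oz' iz' tz' => j w /= oz' iz' tz'.
          have ij : j = i by rewrite -oz' -zz'.
          by rewrite -tz' ij -tu zz'.
        by have [irr _ _] := woT; apply: (irr q Tq); rewrite {2}qE.
      by have [_ /(_ q Tq qu)] := fresh y Wy nD; rewrite fy.
    * by [].
have Tk2 i u : act i -> pos i u -> Tk (i, u) by move=> ai pu.
have disf s q x : Tk s -> Tk q -> x \in f s -> x \in f q -> s = q.
  move=> Ts Tq fs fq; have [sq|//|qs] := wo_total woT Ts Tq.
    by have [_ /(_ s x Ts sq fs)] := hf q Tq; rewrite fq.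
  by have [_ /(_ q x Tq qs fq)] := hf s Ts; rewrite fs.
(* Where no gap opens, a step of the skeleton is already an edge of colour [kc i], and nothing is
   inserted. *)
pose l i u := if pselect (act i /\ pos i u) then f (i, u) else [::].
have lE i u : act i -> pos i u -> l i u = f (i, u).
  by move=> ai pu; rewrite /l; case: pselect => // h; case: h.
have lP i u x : x \in l i u -> [/\ act i, pos i u & x \in f (i, u)].
  by rewrite /l; case: pselect => // -[].
have fP i u x : act i -> pos i u -> x \in f (i, u) -> [/\ W x, ~ D0 x & ~ QQ x].
  move=> ai pu fx; have [[v [_ _ _ h _]] _ _] := hf (i, u) (Tk2 _ _ ai pu).
  by have [] := h x fx.
have /choice[ltP hP] i : exists lt', act i ->
    gpath (adj (kc i)) (adj (kc i)) (\bigcup_(u in Q i) [set` u :: l i u]) lt'.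
  case ai: (act i); last by exists (fun _ _ => False).
  have [[gQ _] _ _] := hQ i ai; have [woQ _] := gQ.
  have [||||||lt' [g _ _]] := @gpath_insert _ (Q i) (ltQ i) (l i) _ _ (adj (kc i)) (adj (kc i)) gQ;
    last by exists lt'.
  - move=> u Qu; rewrite /l; case: pselect => // -[_ pu] /=; apply/andP; split.
      by apply/negP => /(fP i u u ai pu)[_ _]; apply; exists i.
    by have [[v [_ _ ? _ _]] _ _] := hf (i, u) (Tk2 _ _ ai pu).
  - move=> u Qu; rewrite /l; case: pselect => [h|//] /=; case: h => _ pu.
    have [[v [_ + _ _ _]] _ _] := hf (i, u) (Tk2 _ _ ai pu).
    rewrite rcons_path => /andP[/= h _].
    by rewrite (eq_path (e' := adj (kc i))) // => a b; rewrite /stepb asboolb.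
  - move=> u v Qv puv [Xv st]; rewrite /l; case: pselect => [h|npu] /=.
      case: h => _ pu.
      have [[v' [[Qv' puv' _ _] + _ _ _]] _ _] := hf (i, u) (Tk2 _ _ ai pu).
      by rewrite /= rcons_path (ispred_fun woQ Qv Qv' puv puv') => /andP[].
    by case: st => // Xu; case: npu; split=> //; exists v.
  - move=> u v x Qu Qv /lP[_ pu fx] /lP[_ pv fx'].
    by have [] := disf _ _ _ (Tk2 _ _ ai pu) (Tk2 _ _ ai pv) fx fx'.
  - by move=> u x Qu /lP[_ pu /(fP i u x ai pu)[_ _ nQ]] Qx; apply: nQ; exists i.
  - by move=> u v [].
pose P i := if act i then \bigcup_(u in Q i) [set` u :: l i u] else set0.
have Pf i u x : act i -> pos i u -> x \in f (i, u) -> P i x.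
  move=> ai pu fx; rewrite /P ai; have [v [_ [Qu _ _] _ _]] := pu.
  by exists u => //=; rewrite inE lE // fx orbT.
have PQ i x : act i -> Q i x -> P i x.
  by move=> ai Qx; rewrite /P ai; exists x => //=; rewrite mem_head.
have Pcase i x : P i x -> act i /\ (Q i x \/ exists2 u, pos i u & x \in f (i, u)).
  rewrite /P; case ai: (act i) => // -[u Qu /=]; rewrite inE => /orP[/eqP->|/lP[_ pu fx]].
    by split=> //; left.
  by split=> //; right; exists u.
exists P, ltP; split.
- by move=> i ai; rewrite /P ai; exact: hP.
- split; first by move=> i /negbTE ai; rewrite /P ai.
  move=> i x /Pcase[ai [Qx|[u pu /(fP i u x ai pu)[]//]]].
  by split; [exact: QW Qx|move=> Dx; apply: (QG i x ai Qx); left].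
- move=> i j x /Pcase[ai hi] /Pcase[aj hj].
  case: hi => [Qi|[u pu fu]]; case: hj => [Qj|[w pw fw]].
  + exact: disQ Qi Qj.
  + by have [_ _] := fP j w x aj pw fw; case; exists i.
  + by have [_ _] := fP i u x ai pu fu; case; exists j.
  + by have [] := disf _ _ _ (Tk2 _ _ ai pu) (Tk2 _ _ aj pw) fu fw.
- move=> i x ai Tx; have [[j [aj Qx]]|nQ] := pselect (QQ x).
    by right; exists j; exact: PQ.
  have ix : item i (inl x) by split.
  have [/(_ _ ix) px _] := htau i ai.
  have [[v [_ _ _ _ _]] _ /(_ x (itE i _ ai ix))] := hf (i, _) (Tk2 _ _ ai px).
  case=> [fx|Dx|[z Zz zx]|[[j w] [[aj pw] _ fx]]].
  + by right; exists i; exact: Pf fx.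
  + by left.
  + right; exists (own z); have [ao _] := hsg z Zz.
    have iz : item (own z) (inr z) by split.
    have [/(_ _ iz) pz _] := htau _ ao.
    have [[v' [_ _ _ _ h]] _ _] := hf (_, _) (Tk2 _ _ ao pz).
    by apply: Pf (h z (itE _ _ ao iz) x zx).
  + by right; exists j; exact: Pf fx.
- move=> z y Zz zy; have [ao _] := hsg z Zz.
  have iz : item (own z) (inr z) by split.
  have [/(_ _ iz) pz _] := htau _ ao.
  have [[v' [_ _ _ _ h]] _ _] := hf (_, _) (Tk2 _ _ ao pz).
  by apply: Pf (h z (itE _ _ ao iz) y zy).
Qed.

(** * Covering one side *)

Definition coloured_in (Z R : set V) (I : {set 'I_r}) :=
  forall z x, Z z -> R x -> clr z x \in I.

(** The last clause bounds the paths by the size of [Z] up to finite sets; a finite [Z] may need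
    paths with more vertices than it has. It keeps the covering of a small leftover small. *)
Definition coverable (Z R : set V) (I : {set 'I_r}) :=
  exists (P : 'I_r -> set V) (lt : 'I_r -> V -> V -> Prop),
  [/\ forall k, gpath (adj k) (adj k) (P k) (lt k),
      (forall k, k \notin I -> P k = set0) /\ (forall k, P k `<=` Z `|` R),
      forall j k x, P j x -> P k x -> j = k,
      forall z, Z z -> exists k, P k z &
      forall (K : set V) k, infinite_set K -> small K Z -> small K (P k)].

Lemma gpath0 step lim (lt : V -> V -> Prop) : gpath step lim set0 lt.
Proof. by split=> //; split=> // P P0 [x /P0]. Qed.

Lemma homogeneous (K : set V) (s : seq V) R : infinite_set K -> K #<= R ->
  exists R0 (kap : V -> 'I_r), [/\ R0 `<=` R, K #<= R0 &
    forall z x, z \in s -> R0 x -> clr z x = kap z].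
Proof.
move=> infK bR; elim: s => [|z s [R0 [kap [R0R bR0 hk]]]].
  by exists R, (fun z => clr z z); split=> // x.
have [|k bk] := @card_le_fin _ _ 'I_r R0 (fun k => R0 `&` [set x | clr z x = k]) K infK _ bR0.
  by move=> x R0x; exists (clr z x).
exists (R0 `&` [set x | clr z x = k]), (fun y => if y == z then k else kap y).
split=> // [x [/R0R]//|y x]; rewrite inE => /orP[/eqP->|ys] [R0x /= xk].
  by rewrite eqxx.
by have [->|_] := eqVneq y z => //; exact: hk.
Qed.

(** On a part [R0] of [R] every [z] sees a single colour [kap z]. The vertices with the same [kap]
    are strung together, each followed by its private vertex [rho z]. *)
Lemma coverable_finite Z R I : opp Z R -> infinite_set R -> finite_set Z ->
  coloured_in Z R I -> coverable Z R I.
Proof.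
move=> oZR infR /finite_seqP[s0 Zs0] ZRI; pose s := undup s0.
have Zs z : Z z <-> z \in s by rewrite mem_undup Zs0.
have [R0 [kap [R0R bR0 hk]]] := homogeneous s infR (card_lexx R).
have [r0 Rr0] := infinite_setN0 infR.
have ZR0 : Z #<= R0.
  apply: card_le_trans bR0; apply: (small_le (K := R)); apply: small_finite => //.
  by rewrite Zs0; exact: finite_seq.
have [rho [rR0 rinj]] := card_leE ZR0 r0.
pose zs k := [seq z <- s | kap z == k].
pose p k := flatten [seq [:: z; rho z] | z <- zs k].
have zsE k z : z \in zs k -> Z z /\ kap z = k.
  by rewrite mem_filter => /andP[/eqP <- /Zs].
have pE k x : x \in p k <-> exists z, z \in zs k /\ (x = z \/ x = rho z).
  split.
    move=> /flatten_mapP[z zk]; rewrite !inE => h; exists z; split=> //.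
    by case/orP: h => /eqP->; [left|right].
  by move=> [z [zk h]]; apply/flatten_mapP; exists z => //; rewrite !inE;
    case: h => ->; rewrite eqxx ?orbT.
have rn z z' : Z z -> Z z' -> z <> rho z'.
  by move=> Zz /rR0/R0R Rz' e; apply: (opp_disj oZR Zz); rewrite e.
have kapE z z' : Z z -> Z z' -> adj (kap z) z (rho z').
  move=> Zz Zz'; rewrite -(hk z (rho z')); first by apply: opp_adj oZR Zz _; exact/R0R/rR0.
    exact/Zs.
  exact: rR0.
have up l : uniq l -> (forall z, z \in l -> Z z) ->
    uniq (flatten [seq [:: z; rho z] | z <- l]).
  elim: l => //= z l ih /andP[zl ul] hl.
  have Zz : Z z by apply: hl; rewrite mem_head.
  have {}hl y : y \in l -> Z y by move=> yl; apply: hl; rewrite inE yl orbT.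
  rewrite ih // andbT inE negb_or -andbA; apply/and3P; split.
  - by apply/eqP; exact: rn.
  - apply/negP => /flatten_mapP[y yl]; rewrite !inE => /orP[/eqP e|/eqP].
      by move: zl; rewrite e yl.
    by apply: rn => //; exact: hl.
  - apply/negP => /flatten_mapP[y yl]; rewrite !inE => /orP[/eqP e|/eqP e].
      by case: (rn y z (hl y yl) Zz).
    by move: zl; rewrite (rinj z y) ?yl //; exact: hl.
have pp k z l : Z z -> kap z = k -> (forall y, y \in l -> Z y /\ kap y = k) ->
    path (stepb (adj k)) z (rho z :: flatten [seq [:: y; rho y] | y <- l]).
  elim: l z => [|y l ih] z Zz kz hl; rewrite /= -/(flatten _).
    by rewrite andbT; apply/asboolP; rewrite -kz; exact: kapE.
  have [Zy ky] := hl y (mem_head _ _).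
  have := ih y Zy ky (fun u ul => hl u (mem_behead (s := y :: l) ul)).
  rewrite /= => ->; rewrite andbT; apply/andP; split; apply/asboolP.
    by rewrite -kz; exact: kapE.
  by rewrite adjC -ky; exact: kapE.
exists (fun k => [set` p k]), (fun k => ltidx (p k)); split.
- move=> k; case e : (zs k) => [|z l].
    by rewrite /p e (_ : [set` _] = set0) -?subset0 //; exact: gpath0.
  have hz y : y \in z :: l -> Z y /\ kap y = k by rewrite -e; exact: zsE.
  have [Zz kz] := hz z (mem_head _ _).
  have := up (zs k) (filter_uniq _ (undup_uniq _)) (fun y yk => (zsE k y yk).1).
  rewrite /p e /= => u.
  have [] := @gpath_list _ (adj k) (adj k) z (rho z :: flatten [seq [:: y; rho y] | y <- l]) u _ => //.
  by apply: pp => // y yl; apply: hz; rewrite inE yl orbT.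
- split=> k.
    move=> kI; rewrite -subset0 => x /= /pE[z [/zsE[Zz kz] _]].
    by move/negP: kI; apply; rewrite -kz -(hk z (rho z)); [apply: ZRI => //; exact/R0R/rR0|exact/Zs|exact: rR0].
  move=> x /= /pE[z [/zsE[Zz _] [->|->]]]; first by left.
  by right; exact/R0R/rR0.
- move=> j k x /pE[z [/zsE[Zz <-] h]] /pE[z' [/zsE[Zz' <-] h']].
  case: h => xz; case: h' => xz'.
  + by rewrite -xz xz'.
  + by case: (rn z z'); rewrite // -xz.
  + by case: (rn z' z); rewrite // -xz'.
  + by rewrite (rinj z z') // -xz.
- move=> z /Zs zs_; exists (kap z); apply/pE; exists z; split; last by left.
  by rewrite mem_filter eqxx.
- by move=> K k infK _; exact: set_of_list_small.
Qed.

Lemma exit_path k (T M F : set V) z : escape k T M -> infinite_set (M `&` nbr k z) ->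
  small (M `&` nbr k z) F -> F z ->
  exists t, [/\ path (adj k) z t, T (last z t), uniq (z :: t) &
    forall x, x \in t -> (M x \/ T x) /\ ~ F x].
Proof.
move=> [rho [rinj hr]] infN sF Fz; set N := _ `&` _ in infN sF.
have sB : small N [set e | M e /\ F (rho e)].
  apply: smallS sF; apply: (card_leI (f := rho)) => [e []//|e e' [Me _] [Me' _]].
  exact: rinj.
have [e [[Me ze] nF]] := big_ex infN (smallD infN (fun h => h (card_lexx N)) (smallU infN sF sB)).
have nFe : ~ F e by move=> h; apply: nF; left.
have nFr : ~ F (rho e) by move=> h; apply: nF; right.
have ne : z != e by apply/eqP => h; apply: nFe; rewrite -h.
have nr : z != rho e by apply/eqP => h; apply: nFr; rewrite -h.
have [Tr [re|ar]] := hr e Me.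
  exists [:: e]; rewrite /= ze inE ne; split=> //; first by rewrite -re.
  by move=> x; rewrite inE => /eqP->; split=> //; left.
exists [:: e; rho e]; rewrite /= ze ar !inE negb_or ne nr andbT; split=> //.
  by rewrite /= andbT; apply/eqP; exact: adj_neq ar.
by move=> x; rewrite !inE => /orP[/eqP->|/eqP->]; split=> //; [left|right].
Qed.

(** Two exits from [z] into [T], the second avoiding the first, are joined at [z] to a segment with
    both ends in [T]; [F] is too small to prevent either. *)
Lemma detour k (T M F : set V) z : escape k T M -> infinite_set (M `&` nbr k z) ->
  small (M `&` nbr k z) F -> F z ->
  exists x s, [/\ path (adj k) x s, T x /\ T (last x s), uniq (x :: s), z \in x :: s &
    forall y, y \in x :: s -> y = z \/ ((M y \/ T y) /\ ~ F y)].
Proof.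
move=> esc infN sF Fz.
have [t [pt Tt ut ht]] := exit_path esc infN sF Fz.
have sF' : small (M `&` nbr k z) (F `|` [set` z :: t]).
  by apply: smallU => //; exact: set_of_list_small.
have [t' [pt' Tt' ut' ht']] := exit_path esc infN sF' (or_introl Fz).
exists (last z t), (rev (belast z t) ++ t').
have E : last z t :: rev (belast z t) ++ t' = rev (z :: t) ++ t'.
  by rewrite [in RHS]lastI rev_rcons.
have lz : last (last z t) (rev (belast z t)) = z.
  by case: t {pt Tt ut ht sF' ht' E} => //= a t; rewrite rev_cons last_rcons.
split.
- rewrite cat_path lz pt' andbT rev_path.
  by rewrite (eq_path (e' := adj k)) // => a b; rewrite adjC.
- by rewrite last_cat lz.
- rewrite E cat_uniq rev_uniq ut /=; have /= /andP[_ ->] := ut'; rewrite andbT.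
  apply/hasPn => y yt'; apply/negP; rewrite /= mem_rev => yt.
  by have [_] := ht' y yt'; apply; right.
- by rewrite E mem_cat mem_rev mem_head.
- move=> y; rewrite E mem_cat mem_rev inE -orbA => /or3P[/eqP->|/ht|/ht'[h nF]].
  + by left.
  + by right.
  + by right; split=> // Fy; apply: nF; left.
Qed.

(** Exclusion makes the neighbourhoods in colours of [A] small, but for singular [K] not uniformly
    so. The vertices [Zb] with more than |Y| such neighbours get disjoint detours, which have only
    |Y| vertices to avoid. For the others |Y| is a common bound: deleting their neighbourhoods
    leaves a big [R2], joined to them in other colours only. *)
Lemma leftover (K W Zl Rl D : set V) (A : {set 'I_r}) (act : pred 'I_r)
    (T : 'I_r -> set V) :
  infinite_set K -> opp Zl Rl -> Zl `<=` W -> Rl `<=` W -> small K Zl ->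
  K #<= Rl -> small K D -> (forall k, k \in A -> excluded K k Zl Rl) ->
  (forall k, k \in A -> [/\ act k, T k `<=` W & escape k (T k) Rl] \/
     forall z x, Zl z -> Rl x -> ~~ adj k z x) ->
  (forall Z R, opp Z R -> infinite_set R -> Z #<= R ->
     coloured_in Z R (~: A) -> coverable Z R (~: A)) ->
  exists (P : 'I_r -> set V) (lt : 'I_r -> V -> V -> Prop) (Zb : set V)
    (own : V -> 'I_r) (sg : V -> seq V),
  [/\ [/\ forall k, gpath (adj k) (adj k) (P k) (lt k),
          (forall k, k \in A -> P k = set0),
          forall k x, P k x -> (Zl `|` Rl) x /\ ~ D x,
          forall j k x, P j x -> P k x -> j = k &
          forall k, small K (P k)],
      Zb `<=` Zl,
      forall z, Zb z -> act (own z) /\ exists x s, [/\ sg z = x :: s,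
        path (adj (own z)) x s, T (own z) x /\ T (own z) (last x s), uniq (x :: s) &
        forall y, y \in x :: s -> [/\ W y, ~ D y & forall k, ~ P k y]],
      forall z z' y, Zb z -> Zb z' -> y \in sg z -> y \in sg z' -> z = z' &
      forall z, Zl z -> ~ D z -> (exists k, P k z) \/ exists z', Zb z' /\ z \in sg z'].
Proof.
move=> infK oZR ZW RW sZ bR sD exA escA cov.
pose Y := Zl `|` D; have sY : small K Y by exact: smallU.
pose N k z := Rl `&` nbr k z.
(* For finite [Y] there are no detours: finitely many small neighbourhoods can be deleted at
   once. *)
pose Zb := [set z | [/\ infinite_set Y, Zl z, ~ D z & exists k, k \in A /\ N k z #!<= Y]].
have /choice[own hown] z : exists k, Zb z -> k \in A /\ N k z #!<= Y.
  by have [[_ _ _ [k ?]]|] := pselect (Zb z); [exists k|exists (clr z z)].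
have finY T' (S : set T') : infinite_set Y -> finite_set S -> S #<= Y.
  by move=> infY finS; apply: small_le; exact: small_finite.
have infN z : Zb z -> infinite_set (N (own z) z).
  move=> Zz; have [infY _ _ _] := Zz; have [_ nN] := hown z Zz.
  by move=> finN; apply: nN; exact: finY.
have hesc z : Zb z -> [/\ act (own z), T (own z) `<=` W & escape (own z) (T (own z)) Rl].
  move=> Zz; have [kA _] := hown z Zz; have [_ Zlz _ _] := Zz.
  case: (escA _ kA) => // no; have [x [Rx zx]] := infinite_setN0 (infN z Zz).
  by move/negP: (no z x Zlz Rx).
have [lt [woZ _]] := wo_initial Zb.
pose spec z l := z \in l /\ exists x s, [/\ l = x :: s, path (adj (own z)) x s,
  T (own z) x /\ T (own z) (last x s), uniq (x :: s) &
  forall y, y \in l -> [/\ W y, ~ D y & Zl y -> y = z]].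
have [z f g l Zz fg [h1 h2]|z f Zz ih|sg hsg] := @wo_rec _ (seq V) [::] Zb lt (fun z f l =>
    spec z l /\ forall s x, Zb s -> lt s z -> x \in f s -> x \notin l) woZ.
- by split=> // s x Zs sz; rewrite -fg //; exact: h2.
- have [infY Zlz nDz _] := Zz; have [_ nN] := hown z Zz.
  pose F := Y `|` \bigcup_(s in seg Zb lt z) [set` f s].
  have FY : F #<= Y.
    apply: card_leU => //.
    apply: card_bigcup_le => // [|s _]; last by apply: finY => //; exact: finite_seq.
    by apply: subset_card_le => s [[_ ? _ _] _]; left.
  have sF : small (N (own z) z) F by move=> le; apply: nN; exact: card_le_trans le FY.
  have Fz : F z by left; left.
  have [_ TW esc] := hesc z Zz.
  have [x [s [ps Tl us zs hs]]] := detour esc (infN z Zz) sF Fz.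
  exists (x :: s); split.
    split=> //; exists x, s; split=> // y /hs[->|[h nF]].
      by split=> //; exact: ZW.
    split=> [|Dy|Zy]; first by case: h => [/RW|/TW].
      by apply: nF; left; right.
    by case: nF; left; left.
  move=> q y Zq qz fy; apply/negP => /hs[yz|[_ nF]]; last first.
    by apply: nF; right; exists q.
  have [[_ [x' [s' [_ _ _ _ h]]]] _] := ih q Zq qz.
  have [_ _ /(_ _)e] := h y fy; subst y.
  by have [irr _ _] := woZ; apply: (irr z Zz); rewrite {1}(e Zlz).
have dis z z' y : Zb z -> Zb z' -> y \in sg z -> y \in sg z' -> z = z'.
  move=> Zz Zz' yz yz'; have [lz|//|lz] := wo_total woZ Zz Zz'.
    by have [_ /(_ z y Zz lz yz)] := hsg z' Zz'; rewrite yz'.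
  by have [_ /(_ z' y Zz' lz yz')] := hsg z Zz; rewrite yz.
pose G := \bigcup_(z in Zb) [set` sg z].
have sZb : small K Zb by apply: sub_small sZ => z [].
have sG : small K G.
  by apply: small_bigcup_finite => // z _; exact: finite_seq.
pose Z2 := Zl `\` (D `|` G).
have sZ2 : small K Z2 by apply: sub_small sZ => z [].
pose E z := \bigcup_k (if k \in A then N k z else set0).
have sE : small K (\bigcup_(z in Z2) E z).
  have [finY'|infY] := pselect (finite_set Y).
    have /finite_seqP[q qE] : finite_set Z2.
      by apply: sub_finite_set finY' => z [Zz _]; left.
    rewrite qE; apply: small_bigcup_seq => // z zq.
    have [Zz _] : Z2 z by rewrite qE.
    by apply: small_bigcup_fin => // k; case: ifP => kA; [exact: exA|exact: small_finite].
  apply: small_bigcup sY _ => // z [Zz nz]; apply: card_bigcup_le => //.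
    by apply: finY => //; exact: finite_finset.
  move=> k _; case: ifP => kA; last exact: card_ge0.
  apply: contrapT => nN; apply: (nz); right; exists z.
    by split=> //; [move=> Dz; apply: (nz); left|exists k].
  by have [[]] := hsg z (And4 infY Zz (fun Dz => nz (or_introl Dz)) (ex_intro _ k (conj kA nN))).
pose R2 := Rl `\` ((D `|` G) `|` \bigcup_(z in Z2) E z).
have bR2 : K #<= R2.
  apply: big_card; apply: smallD => //.
  by do 2!apply: smallU => //.
have [|||z x [Zz nz] [Rx nx]|P [ltP [gP [P0 PZR] disP covP smP]]] := cov Z2 R2.
- by apply: opp_sub oZR => x [].
- exact: card_le_infinite bR2.
- by apply: card_le_trans bR2; exact: small_le.
- rewrite inE; apply/negP => kA; apply: nx; right; exists z => //.
  by exists (clr z x) => //; rewrite kA; split=> //; exact: opp_adj oZR Zz Rx.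
have PG k x : P k x -> (Zl `|` Rl) x /\ ~ (D `|` G) x.
  by move=> /PZR[[Zx nx]|[Rx nx]]; split=> //; [left|right|move=> h; apply: nx; left].
exists P, ltP, Zb, own, sg; split=> //.
- split=> // [k kA|k x /PG[? nx]|k]; first by apply: P0; rewrite inE kA.
    by split=> // Dx; apply: nx; left.
  exact: smP.
- by move=> z [].
- move=> z Zz; have [aO _ _] := hesc z Zz; split=> //.
  have [[_ [x [s [sgE ps Tl us hs]]]] _] := hsg z Zz; exists x, s; split=> // y.
  rewrite -sgE => ys; have [Wy nD _] := hs y ys; split=> // k /PG[_]; apply.
  by right; exists z.
- move=> z Zz nD; have [[z' Zz' zz']|nG] := pselect (G z); first by right; exists z'.
  by left; apply: covP; split=> // -[].
Qed.

(** [R] may be much larger than [Z], so it is cut down to the size of [Z], and [Z] itself is taken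
    for [K]. The colours outside [I] are excluded from the start. As [Z] is not small with respect
    to itself, [loop] adds a colour, and fewer colours remain for the leftover. *)
Lemma one_sided (n : nat) Z R I : opp Z R -> infinite_set R -> Z #<= R ->
  coloured_in Z R I -> (#|I| <= n)%N -> coverable Z R I.
Proof.
elim: n Z R I => [|n ih] Z R I oZR infR ZR ZRI len.
  have [finZ|infZ] := pselect (finite_set Z); first exact: coverable_finite.
  have [z Zz] := infinite_setN0 infZ; have [x Rx] := infinite_setN0 infR.
  by have := ZRI z x Zz Rx; rewrite (cards0_eq (_ : #|I| = 0)%N) ?inE //; apply/eqP; rewrite -leqn0.
have [finZ|infZ] := pselect (finite_set Z); first exact: coverable_finite.
have [z0 Zz0] := infinite_setN0 infZ.
have [R' [R'R ZR' R'Z]] := card_le_sub z0 ZR.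
pose W := Z `|` R'.
have WZ : W #<= Z by apply: card_leU.
have oZR' : opp Z R' by apply: opp_sub oZR.
have noA k : k \in ~: I -> forall z x, Z z -> R' x -> ~~ adj k z x.
  rewrite inE => kI z x Zz /R'R Rx; apply/negP => /andP[_ /eqP e].
  by move: kI; rewrite -e ZRI.
have [||||k kI z Zz|A' [Zl [Rl [X [Rr [T [[sA ZlZ sZl RlR bRl] exA' trA' covA' pA]]]]]]] :=
    @loop Z W (~: I) Z R' infZ oZR'.
- by left.
- by right.
- exact: card_lexx.
- exact: ZR'.
- apply: small_finite => //; rewrite (_ : _ `&` _ = set0) // -subset0 => x [Rx].
  by move/negP: (noA k kI z x Zz Rx).
have {}pA := pA (card_lexx Z).
pose act k := (k \in A') && (k \in I).
have actE k : act k -> k \in A' /\ k \notin ~: I.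
  by move=> /andP[? kI]; rewrite inE kI.
have trA k : act k -> _ := fun a => trA' k (actE k a).1 (actE k a).2.
have [|||||||k kA|Z' R2 o i le ci|P [lt [Zb [own [sg [[gP P0 PD disP sP] ZbZl hsg dsg cvP]]]]]] :=
  @leftover Z W Zl Rl set0 A' act T infZ.
- by apply: opp_sub oZR'.
- by move=> z /ZlZ; left.
- by move=> x /RlR; right.
- exact: sZl.
- exact: bRl.
- exact: small_finite.
- exact: exA'.
- have [kI|kI] := boolP (k \in I); last first.
    by right=> z x /ZlZ Zz /RlR; apply: noA => //; rewrite inE.
  left; have ak : act k by rewrite /act kA.
  have [tr TZ esc] := trA k ak; split=> // x /TZ; by left.
- apply: ih => //; rewrite -ltnS; apply: leq_trans len.
  by apply: proper_card; rewrite -[I]finset.setCK properC.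
(* The paths of the leftover use no colour of [A']; once the traced paths avoid their vertices, both
   families combine to one path per colour. *)
pose D0 := \bigcup_k P k.
have sD0 : small Z D0 by apply: small_bigcup_fin.
have sZb : small Z Zb by apply: sub_small sZl.
have [|z Zz|P' [lt' [gP' [P0' PW'] disP' cvP' cvS']]] :=
    @assemble_paths Z W 'I_r id act X Rr T D0 Zb own sg infZ _ sD0 sZb _ dsg.
- by move=> k /trA[].
- have [ao [x [s [e ps Tl us hs]]]] := hsg z Zz; split=> //; exists x, s; split=> // y /hs[Wy _ nP].
  by split=> // -[k _ /nP].
have PW k x : P k x -> W x.
  by move=> /PD[[/ZlZ ?|/RlR ?] _]; [left|right].
exists (fun k => if act k then P' k else P k), (fun k => if act k then lt' k else lt k).
split.
- by move=> k; case ak: (act k); [exact: gP'|exact: gP].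
- split=> k.
    move=> kI; rewrite /act (negbTE kI) andbF; apply: P0.
    by apply: (fintype.subsetP sA); rewrite inE.
  have WZR : W `<=` Z `|` R by move=> x [|/R'R]; [left|right].
  by case: (act k) => x; [move=> /PW'[/WZR]|move=> /PW/WZR].
- move=> j k x; case: (act j); case: (act k).
  + exact: disP'.
  + by move=> /PW'[_ nD] Px; case: nD; exists k.
  + by move=> Px /PW'[_ nD]; case: nD; exists j.
  + exact: disP.
- have inP' k x : P' k x -> exists k, (if act k then P' k else P k) x.
    move=> Px; exists k; case ak: (act k) => //.
    by move: Px; rewrite P0' // ak.
  have inP k x : P k x -> exists k, (if act k then P' k else P k) x.
    move=> Px; exists k; case ak: (act k) => //.
    by move: Px; rewrite P0 //; have [] := actE k ak.
  move=> z /covA'[Zz|[k [kA kI Tz]]].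
    have [//|[k /inP//]|[z' [Zz' zz']]] := cvP z Zz.
    exact: inP' (cvS' z' z Zz' zz').
  have ak : act k by rewrite /act kA; move: kI; rewrite inE negbK.
  by have [[j _ /inP//]|[j /inP']] := cvP' k z ak Tz.
- move=> K k infK sK; have sW : small K W by apply: smallS sK.
  by apply: sub_small sW => x; case: (act k); [move=> /PW'[]|exact: PW].
Qed.

(** * Covering both sides *)

(** Index [(true, k)] belongs to [A] and [(false, k)] to [B], except that [T1], drawn from both
    sides, is covered by [(true, k1)]. The rounds for [A] continue with [M1], those for [B] with
    [X1]; both start with [k1] excluded, so [(false, k1)] stays empty. *)
Lemma two_sided (A B : set V) : opp A B -> infinite_set A -> A #<= B -> B #<= A ->
  exists k1 (P : bool * 'I_r -> set V) lt,
  [/\ forall i, gpath (adj i.2) (adj i.2) (P i) (lt i), P (false, k1) = set0,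
      forall i j x, P i x -> P j x -> i = j &
      forall x, A x \/ B x -> exists i, P i x].
Proof.
move=> oAB infA AB BA; pose W := A `|` B.
have AW : A `<=` W by left.
have BW : B `<=` W by right.
have [k1 [X1 [R1 [M1 [T1 [[tr1 XA _] _ [MB bM esc1] hA hB]]]]]] :=
  step infA oAB oAB AW BW BW (card_lexx A) (card_lexx A) AB BA.
have [[oX1 X1T1 T1W R1W] [T1A bX bR1] _ _] := tr1.
have oAM : opp (A `\` T1) M1 by apply: opp_sub oAB => // x [].
have oBX : opp (B `\` T1) X1.
  have [s [h1 h2]] := oAB; exists (~~ s).
  by split=> [x [/h2]//|y /XA/h1->]; rewrite negbK.
have esc2 : escape k1 T1 X1.
  by exists id; split=> // e Xe; split; [exact: X1T1|left].
have [|||k|A1 [Zl1 [Rl1 [Xa [Ra [Ta [[sA1 ZlA sZl1 RlM bRl1] exA1 trA1 covA1 _]]]]]]] :=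
    @loop A W [set k1] (A `\` T1) M1 infA oAM _ _ _ bM.
- by move=> x [/AW].
- by move=> x /MB/BW.
- by apply: subset_card_le => x [].
- by rewrite finset.in_set1 => /eqP-> z [Az nT]; exact: hA.
have [|||k|A2 [Zl2 [Rl2 [Xb [Rb [Tb [[sA2 ZlB sZl2 RlX bRl2] exA2 trA2 covA2 _]]]]]]] :=
    @loop A W [set k1] (B `\` T1) X1 infA oBX _ _ _ bX.
- by move=> x [/BW].
- by move=> x /XA/AW.
- by apply: card_le_trans BA; apply: subset_card_le => x [].
- by rewrite finset.in_set1 => /eqP-> z [Bz nT]; exact: hB.
have k1A1 : k1 \in A1 by apply: (fintype.subsetP sA1); rewrite finset.in_set1.
have k1A2 : k1 \in A2 by apply: (fintype.subsetP sA2); rewrite finset.in_set1.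
have cov I Z R : opp Z R -> infinite_set R -> Z #<= R -> coloured_in Z R I -> coverable Z R I.
  by move=> o i le ci; apply: (one_sided o i le ci (leqnn _)).
pose Ta' k := if k == k1 then T1 else Ta k.
pose Tb' k := if k == k1 then T1 else Tb k.
have in1 k : (k \notin [set k1]%SET) = (k != k1) by rewrite finset.in_set1.
have [|||k kA1|Pa [lta [Zba [owna [sga [[gPa Pa0 PaD disPa sPa] ZbaZ hsga dsga cvPa]]]]]] :=
    @leftover A W Zl1 Rl1 set0 A1 (mem A1) Ta' infA _ _ _ sZl1 bRl1
      (small_finite infA (finite_set0 _)) exA1 _ (@cov (~: A1)%SET).
- by apply: opp_sub oAM.
- by move=> x /ZlA[/AW].
- by move=> x /RlM/MB/BW.
- left; rewrite /Ta'; have [->|kk1] := eqVneq k k1.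
    by split=> //; apply: escape_sub esc1.
  have [||tr TZ esc] := trA1 k; rewrite ?in1 //.
  by split=> // x /TZ[/AW].
(* The leftover of [B] has to avoid the paths and the detours already made for [A]. *)
pose D2 := (\bigcup_k Pa k) `|` \bigcup_(z in Zba) [set` sga z].
have sZba : small A Zba by apply: sub_small sZl1.
have sD2 : small A D2.
  apply: smallU => //; first exact: small_bigcup_fin.
  by apply: small_bigcup_finite => // z _; exact: finite_seq.
have [|||k kA2|Pb [ltb [Zbb [ownb [sgb [[gPb Pb0 PbD disPb sPb] ZbbZ hsgb dsgb cvPb]]]]]] :=
    @leftover A W Zl2 Rl2 D2 A2 (mem A2) Tb' infA _ _ _ sZl2 bRl2
      sD2 exA2 _ (@cov (~: A2)%SET).
- by apply: opp_sub oBX.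
- by move=> x /ZlB[/BW].
- by move=> x /RlX/XA/AW.
- left; rewrite /Tb'; have [->|kk1] := eqVneq k k1.
    by split=> //; apply: escape_sub esc2.
  have [||tr TZ esc] := trA2 k; rewrite ?in1 //.
  by split=> // x /TZ[/BW].
pose act (i : bool * 'I_r) := if i.1 then i.2 \in A1 else (i.2 \in A2) && (i.2 != k1).
pose pick3 (X1 : set V) (Xa Xb : 'I_r -> set V) (i : bool * 'I_r) :=
  if i.2 == k1 then X1 else if i.1 then Xa i.2 else Xb i.2.
(* Detours of colour [k1] made for [B] end in [T1], so they go onto the shared path [(true, k1)]. *)
pose own z := if pselect (Zba z) then (true, owna z) else (ownb z == k1, ownb z).
pose sg z := if pselect (Zba z) then sga z else sgb z.
have Zab z : Zbb z -> ~ Zba z.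
  by move=> /ZbbZ/ZlB[Bz _] /ZbaZ/ZlA[Az _]; exact: opp_disj oAB Az Bz.
have ownaE z : Zba z -> own z = (true, owna z) by rewrite /own; case: pselect.
have ownbE z : Zbb z -> own z = (ownb z == k1, ownb z).
  by move=> /Zab; rewrite /own; case: pselect.
have sgaE z : Zba z -> sg z = sga z by rewrite /sg; case: pselect.
have sgbE z : Zbb z -> sg z = sgb z by move=> /Zab; rewrite /sg; case: pselect.
pose D0 := (\bigcup_k Pa k) `|` (\bigcup_k Pb k).
have sD0 : small A D0 by apply: smallU => //; exact: small_bigcup_fin.
have sZb : small A (Zba `|` Zbb).
  by apply: smallU => //; apply: sub_small sZl2.
have nD2 z y : Zbb z -> y \in sgb z -> ~ D2 y.
  move=> Zz yz; have [_ [x [s [e _ _ _ hs]]]] := hsgb z Zz.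
  by have [|] := hs y; rewrite -?e.
have [i ai|z Zz|z z' y Zz Zz'|P [lt [gP [P0 PD] disP cvP cvS]]] :=
    @assemble_paths A W (bool * 'I_r)%type snd act (pick3 X1 Xa Xb)
    (pick3 R1 Ra Rb) (pick3 T1 Ta Tb) D0 (Zba `|` Zbb) own sg infA _ sD0 sZb.
- case: i ai => [[] k] /=; rewrite /act /pick3 /=.
    have [-> //|kk1 kA] := eqVneq k k1.
    by have [|//] := trA1 k kA; rewrite in1.
  move=> /andP[kA kk1]; rewrite (negbTE kk1).
  by have [|//] := trA2 k kA; rewrite in1.
- case: Zz => Zz.
    have [ao [x [s [e ps Tl us hs]]]] := hsga z Zz.
    rewrite ownaE // sgaE //; split=> //; exists x, s; split=> // y ys.
    have [Wy _ nP] := hs y ys; split=> // -[[k _ /nP]//|[k _ /PbD[_]]]; apply.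
    by right; exists z => //=; rewrite e.
  have [ao [x [s [e ps Tl us hs]]]] := hsgb z Zz.
  rewrite ownbE // sgbE //; split.
    by rewrite /act /=; have [->//|/= _] := eqVneq (ownb z) k1; rewrite andbT.
  exists x, s; split=> //; first by move: Tl; rewrite /pick3 /Tb' /=; case: eqP.
  move=> y ys; have [Wy nD nP] := hs y ys; split=> // -[[k _ Py]|[k _ /nP]//].
  by apply: nD; left; exists k.
- have cross u v : Zba u -> Zbb v -> y \in sga u -> y \in sgb v -> False.
    by move=> Zu Zv yu yv; apply: (nD2 v y Zv yv); right; exists u.
  case: Zz => Zz; case: Zz' => Zz'.
  + rewrite !sgaE //; exact: dsga.
  + by rewrite sgaE // sgbE // => y1 y2; case: (cross z z').
  + by rewrite sgbE // sgaE // => y1 y2; case: (cross z' z).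
  + rewrite !sgbE //; exact: dsgb.
pose Q (i : bool * 'I_r) := if act i then P i else if i.1 then Pa i.2 else Pb i.2.
pose ltQ (i : bool * 'I_r) := if act i then lt i else if i.1 then lta i.2 else ltb i.2.
have QP i x : P i x -> exists j, Q j x.
  by move=> Px; exists i; rewrite /Q; case: ifPn Px => // /P0->.
have QD x : D0 x -> exists j, Q j x.
  case=> -[k _ Px].
    exists (true, k); rewrite /Q /act /=; case: ifPn => // kA.
    by move: Px; rewrite Pa0.
  exists (false, k); rewrite /Q /act /=; case: ifPn => // /andP[kA _].
  by move: Px; rewrite Pb0.
have QT i x : act i -> pick3 T1 Ta Tb i x -> exists j, Q j x.
  by move=> ai /(cvP i x ai)[/QD|[j /QP]].
have Pab j k x : Pa j x -> Pb k x -> False.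
  by move=> Px /PbD[_]; apply; left; exists j.
exists k1, Q, ltQ; split.
- move=> i; rewrite /Q /ltQ; case: ifP => [/gP //|_].
  by case: ifP => _; [exact: gPa|exact: gPb].
- by rewrite /Q /act /= eqxx andbF Pb0.
- move=> i j x; rewrite /Q; case ai: (act i); case aj: (act j).
  + exact: disP.
  + move=> /PD[_ nD] h; case: nD.
    by move: h; case: ifP => _ h; [left|right]; exists j.2.
  + move=> h /PD[_ nD]; case: nD.
    by move: h; case: ifP => _ h; [left|right]; exists i.2.
  + case: i j {ai aj} => [[] i] [[] j] /=.
    * by move=> h /(disPa _ _ _ h)->.
    * by move=> h1 h2; case: (Pab _ _ _ h1 h2).
    * by move=> h1 h2; case: (Pab _ _ _ h2 h1).
    * by move=> h /(disPb _ _ _ h)->.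
- have Qsga z y : Zba z -> y \in sga z -> exists j, Q j y.
    by move=> Zz yz; apply: (QP (own z)); apply: cvS; rewrite ?sgaE //; left.
  have Qsgb z y : Zbb z -> y \in sgb z -> exists j, Q j y.
    by move=> Zz yz; apply: (QP (own z)); apply: cvS; rewrite ?sgbE //; right.
  have QT1 x : T1 x -> exists j, Q j x.
    by move=> Tx; apply: (QT (true, k1)); rewrite /pick3 /= ?eqxx.
  move=> x [Ax|Bx]; have [/QT1//|nT] := pselect (T1 x).
    have [Zx|[k [kA kk1 Tx]]] := covA1 x (conj Ax nT).
      have [//|[k Px]|[z [Zz xz]]] := cvPa x Zx; last exact: Qsga xz.
      by apply: QD; left; exists k.
    by apply: (QT (true, k)) => //; rewrite /pick3 /=; move: kk1; rewrite in1 => /negbTE->.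
  have [Zx|[k [kA kk1 Tx]]] := covA2 x (conj Bx nT).
    have [[[k _ Px]|[z Zz xz]]|nD] := pselect (D2 x).
    + by apply: QD; left; exists k.
    + exact: Qsga xz.
    have [[k Px]|[z [Zz xz]]] := cvPb x Zx nD; last exact: Qsgb xz.
    by apply: QD; right; exists k.
  move: kk1; rewrite in1 => kk1.
  by apply: (QT (false, k)); rewrite /act /pick3 /= ?kA ?(negbTE kk1).
Qed.

(** * Passage to graphs and the theorem *)

Lemma mono_edgesP k (Q : set V) e :
  [set e | exists u v, [/\ Q u, Q v, adj k u v & e = [set u; v]]] e ->
  exists u v, [/\ Q u, Q v, u <> v & e = [set u; v]].
Proof. by move=> [u [v [Qu Qv /adj_neq uv ->]]]; exists u, v. Qed.

(** All edges of colour [k] inside [Q] are taken, which includes those from limit vertices to their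
    cofinal neighbours. *)
Definition mono_graph k Q : graph V := Graph (@mono_edgesP k Q).

Lemma gpath_path_order k Q lt : gpath (adj k) (adj k) Q lt ->
  generalised_path (mono_graph k Q).
Proof.
move=> [woQ gQ]; have [irr _ mn] := woQ.
exists (fun x y => `[< x = y \/ lt x y >]); split.
  apply: antisymmetric_wo_chain.
    move=> x y; rewrite !inE /= => Qx Qy /andP[/asboolP[//|xy] /asboolP[//|yx]].
    by case: (wo_asym woQ Qx Qy xy yx).
  move=> C CQ [x0 Cx0].
  have [||m [Cm hm]] := mn [set x | x \in C].
  - by move=> x /CQ; rewrite inE.
  - by exists x0.
  exists m; split=> // x Cx; apply/asboolP.
  by case: (hm x Cx) => [->|]; [left|right].
move=> v v' Qv Qv' /asboolP[//|lv] ne.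
have adjE w : Q w -> adj k w v -> adjacent (mono_graph k Q) v w.
  by move=> Qw wv; exists v, w; split=> //; rewrite adjC.
have neq w : Q w -> lt w v -> w <> v by move=> Qw wv e; subst w; case: (irr v Qv).
case: (gQ v Qv) => [/(_ _ Qv')//|[u [[Qu uv nb] au]]|[_ lm]].
- exists u; split=> //; [exact: adjE| |by apply/asboolP; right|exact: neq].
  apply/asboolP; have [|->|uv'] := wo_total woQ Qv' Qu; [by right|by left|].
  by case: (nb v' Qv' uv').
- have [w [Qw v'w wv aw]] := lm v' Qv' lv.
  exists w; split=> //; [exact: adjE|by apply/asboolP; right|by apply/asboolP; right|exact: neq].
Qed.

End Coloured.

Theorem theorem1p2 (r : nat) (r_gt0 : (0 < r)%N)
    (kappa : Type) (kappa_infinite : infinite_set [set: kappa])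
    (A B : Type) (cardA : [set: A] #= [set: kappa])
    (cardB : [set: B] #= [set: kappa])
    (c : edge_colouring (complete_bipartite A B) r) :
  exists (P : 'I_(2 * r - 1) -> graph (A + B))
         (col : 'I_(2 * r - 1) -> 'I_r),
    [/\ vertex_partition (complete_bipartite A B) P,
        forall i, monochromatic_path c (col i) (P i) &
        forall k : 'I_r, (#|[pred i | col i == k]| <= 2)%N].
Proof.
pose V : eqType := {classic A + B}%type.
pose side (v : V) := if (v : A + B) is inl _ then true else false.
have edgeP a b : edges (complete_bipartite A B) [set inl a; inr b] by exists a, b.
pose edge a b : edges (complete_bipartite A B) := SigSub (mem_set (edgeP a b)).
(* Pairs within one class are no edges; they get colour 0, which exists because [r] is positive. *)
pose clr (u v : V) := match (u : A + B), (v : A + B) with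
  | inl a, inr b => c (edge a b) | inr b, inl a => c (edge a b)
  | _, _ => Ordinal r_gt0 end.
have clrC u v : clr u v = clr v u by case: u; case: v.
pose SA : set V := [set v | side v]; pose SB : set V := [set v | ~~ side v].
have oAB : opp side SA SB by exists true; split=> // y /negbTE.
have card_inl : SA #= [set: A].
  rewrite card_eq_le; apply/andP; split.
    apply: card_le_trans (card_image_le (inl : A -> V) _).
    by apply: subset_card_le => -[a|b] //= _; exists a.
  by apply: (card_leI (f := (inl : A -> V))) => // x y _ _ [].
have card_inr : SB #= [set: B].
  rewrite card_eq_le; apply/andP; split.
    apply: card_le_trans (card_image_le (inr : B -> V) _).
    by apply: subset_card_le => -[a|b] //= _; exists b.
  by apply: (card_leI (f := (inr : B -> V))) => // x y _ _ [].
have cAB : SA #= SB.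
  apply: card_eq_trans card_inl _; apply: card_eq_trans cardA _.
  by apply: card_esym; exact: card_eq_trans card_inr cardB.
have infA : infinite_set SA.
  have : SA #= [set: kappa] by exact: card_eq_trans card_inl cardA.
  by rewrite card_eq_le => /andP[_]; exact: card_le_infinite kappa_infinite.
have /andP[AB BA] : (SA #<= SB) && (SB #<= SA) by rewrite -card_eq_le.
have [k1 [P [lt [gP P0 disP cvP]]]] := two_sided clrC oAB infA AB BA.
(* Of the 2r indices [(false, k1)] is dropped, its path being empty; the remaining ones are
   enumerated by [h]. A colour [k] then occurs at most at [(true, k)] and [(false, k)]. *)
pose S : {set bool * 'I_r} := ~: [set (false, k1)].
have cardS : (2 * r - 1)%N = #|S|.
  by rewrite cardsCs finset.setCK cards1 card_prod card_bool card_ord.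
pose h (i : 'I_(2 * r - 1)) := enum_val (cast_ord cardS i).
have hinj : injective h by move=> i j /enum_val_inj/cast_ord_inj.
have hsur j : j != (false, k1) -> exists i, h i = j.
  move=> jk; have jS : j \in S by rewrite !inE.
  exists (cast_ord (esym cardS) (enum_rank_in jS j)).
  by rewrite /h cast_ordKV enum_rankK_in.
exists (fun i => mono_graph side clr (h i).2 (P (h i))), (fun i => (h i).2); split.
- split.
    by move=> i j _ _ [x [Px Px']]; apply: hinj; exact: disP Px Px'.
  apply/seteqP; split=> // x _.
  have [|j Pj] := cvP x; first by rewrite /SA /SB /=; case: (side x); [left|right].
  have [|i hi] := hsur j; last by exists i => //=; rewrite hi.
  by apply/eqP => e; move: Pj; rewrite e P0.
- move=> i; split.
  + split=> // e [u [v [_ _ uv ->]]].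
    case: u v uv => [a|b] [a'|b'] //= _; first by exists a, b'.
    by exists a', b; rewrite setUC.
  + exact: (gpath_path_order clrC (gP (h i))).
  + move=> e [u [v [_ _ /andP[sd /eqP <-] eE]]].
    case: u v sd eE => [a|b] [a'|b'] //= _ eE; congr c; apply: val_inj; apply: etrans eE _ => //.
    by rewrite setUC.
- move=> k; rewrite -(card_imset _ hinj).
  apply: leq_trans (_ : #|[set (true, k); (false, k)]%SET| <= 2)%N; last first.
    by rewrite cards2; case: eqP.
  apply: subset_leq_card; apply/fintype.subsetP => j /imsetP[i].
  by rewrite !inE => /eqP <- ->; case: (h i) => [[] l] /=; rewrite eqxx ?orbT.
Qed.
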